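(* For every deterministic Turing machine $M$ with space function $f(n)$, there exists a finitely presented group whose space function is equivalent to $f(n)$.
   Context: Space function of a group. Let $G=\langle A\mid R\rangle$ be a finite presentation; words are words over $A^{\pm1}$ and $||w||$ is the number of letters of $w$. For a finite sequence of words $W=(w_1,\dots,w_s)$ put $||W||=\sum_i||w_i||$. An elementary $R$-transformation of $W$ does one of the following to some $w_i$: inserts or removes a subword $aa^{-1}$ ($a\in A^{\pm1}$); inserts or removes a subword $r$ or $r^{-1}$ ($r\in R$); replaces $w_i$ by a cyclic conjugate (cyclic shift); if $w_i\equiv uv$, replaces the entry $w_i$ by the two entries $u,v$; removes $w_i$ from the sequence if it is the empty word. The space of a rewriting $W_0\to\dots\to W_t$ is $\max_{j}||W_j||$. For a word $w$ equal to $1$ in $G$, $space_G(w)$ is the minimum of the spaces of all rewritings starting with $(w)$ and ending with the empty sequence $(\,)$. The space function is $S_G(n)=\max\{space_G(w): w=1\text{ in }G,\ ||w||\le n\}$; up to the equivalence below it does not depend on the finite presentation. Equivalence. For non-decreasing functions on $\mathbb N$, $f\preceq g$ means there is a positive integer $c$ with $f(n)\le cg(cn)+cn$ for all $n\in\mathbb N$; $f\sim g$ ($f$ and $g$ are equivalent) means $f\preceq g$ and $g\preceq f$. Space function of a (multi-tape) Turing machine $M$. The space of a computation is the maximum, over its configurations, of the total number of tape letters on all tapes. For an accepted input word $u$, $space_M(u)$ is the minimum of the spaces of accepting computations starting from the input configuration of $u$. The space function is $S_M(n)=\max\{space_M(u): u \text{ accepted by } M,\ ||u||\le n\}$. (Not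 counting the letters on the input tape would give an equivalent function.) *)

(* Defs.v *)
From HB Require Import structures.
From mathcomp Require Import all_boot.
From mathcomp Require Import boolp classical_sets.

Set Implicit Arguments.
Unset Strict Implicit.
Unset Printing Implicit Defensive.

Local Open Scope nat_scope.

(* The minimum of a set of naturals; it is 0 on the empty set, a value
   that is never used below, where only nonempty sets are minimised. *)
Definition minimum (A : nat -> Prop) : nat :=
  xget 0 [set s : nat | A s /\ (forall t : nat, A t -> s <= t)]%classic.

Section RewritingSpace.

Variables (T : Type) (step : T -> T -> Prop) (final : T -> Prop).
Variable norm : T -> nat.

(* A rewriting x = x_0 -> x_1 -> ... -> x_t is given by x and the list p of
   x_1, ..., x_t. *)
Definition rewriting (x : T) (p : seq T) : Prop :=
  path (fun y z => `[< step y z >]) x p /\ final (last x p).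

Definition rewriting_space (x : T) (p : seq T) : nat :=
  \max_(y <- x :: p) norm y.

Definition min_space (x : T) : nat :=
  minimum (fun s => exists2 p, rewriting x p & rewriting_space x p = s).

End RewritingSpace.

Record presentation := Presentation {
  generator : finType;
  relators : seq (seq (generator * bool))
}.

Section Group.

Variable P : presentation.

(* (a, false) is the generator a and (a, true) is its inverse. *)
Definition signed_letter : finType := (generator P * bool)%type.
Definition word := seq signed_letter.

Definition inv_letter (a : signed_letter) : signed_letter := (a.1, ~~ a.2).
Definition inv_word (w : word) : word := rev (map inv_letter w).

(* The group <A | R> is the quotient of the free monoid on A^{+-1} by the
   congruence generated by a a^-1 = 1 and r = 1. *)
Inductive group_eq : word -> word -> Prop :=
| group_eq_refl u : group_eq u u
| group_eq_sym u v : group_eq u v -> group_eq v u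
| group_eq_trans u v w : group_eq u v -> group_eq v w -> group_eq u w
| group_eq_cat u u' v v' :
    group_eq u u' -> group_eq v v' -> group_eq (u ++ v) (u' ++ v')
| group_eq_inv a : group_eq [:: a; inv_letter a] [::]
| group_eq_rel r : r \in relators P -> group_eq r [::].

(* The words that an elementary transformation may insert or remove. *)
Inductive elementary_subword : word -> Prop :=
| elementary_inv a : elementary_subword [:: a; inv_letter a]
| elementary_rel r : r \in relators P -> elementary_subword r
| elementary_rel_inv r :
    r \in relators P -> elementary_subword (inv_word r).

(* [entry_step w W]: the entry w may be replaced by the entries of W. *)
Inductive entry_step : word -> seq word -> Prop :=
| entry_insert u v x :
    elementary_subword x -> entry_step (u ++ v) [:: u ++ x ++ v]
| entry_remove u v x :
    elementary_subword x -> entry_step (u ++ x ++ v) [:: u ++ v]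
| entry_cyclic u v : entry_step (u ++ v) [:: v ++ u]
| entry_split u v : entry_step (u ++ v) [:: u; v]
| entry_erase : entry_step [::] [::].

Inductive elementary_step : seq word -> seq word -> Prop :=
| ElementaryStep W1 w W W2 :
    entry_step w W -> elementary_step (W1 ++ w :: W2) (W1 ++ W ++ W2).

Definition total_length (W : seq word) : nat := \sum_(w <- W) size w.

Definition word_space (w : word) : nat :=
  min_space elementary_step (fun W => W = [::]) total_length [:: w].

Definition group_space (n : nat) : nat :=
  \max_(w : n.-bseq signed_letter | `[< group_eq w [::] >]) word_space w.

End Group.

(* The tape contents  alpha left head right omega,  where alpha and omega are
   the end markers; the end markers and the state are not tape letters. *)
Record tape (Y Q : Type) := Tape { left : seq Y; head : Q; right : seq Y }.

(* The substitution V -> V', where V = [alpha] u q v [omega] and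
   V' = [alpha] u' q' v' [omega]; the marker alpha (resp. omega) is present on
   both sides or on neither, according to at_left (resp. at_right).  Tapes thus
   have no blank cells: they grow and shrink as letters are inserted and
   deleted next to the head. *)
Record tape_rule (Y Q : Type) := TapeRule {
  at_left : bool;
  at_right : bool;
  source : tape Y Q;
  target : tape Y Q
}.

Definition tape_step (Y Q : Type) (r : tape_rule Y Q) (t t' : tape Y Q) :=
  exists x y : seq Y,
  [/\ at_left r -> x = [::],
      at_right r -> y = [::],
      t = Tape (x ++ left (source r)) (head (source r)) (right (source r) ++ y)
    & t' =
      Tape (x ++ left (target r)) (head (target r)) (right (target r) ++ y)].

(* The tapes are numbered by 'I_(other_tapes.+1) and tape 0 is the input tape,
   so there is at least one tape.  A command acts on all tapes at once.  The
   alphabets (and state sets) of the individual tapes are merged into one. *)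
Record machine := Machine {
  other_tapes : nat;
  letter : finType;
  state : finType;
  input_alphabet : {set letter};
  start_state : 'I_other_tapes.+1 -> state;
  accept_state : 'I_other_tapes.+1 -> state;
  command : finType;
  rule : command -> 'I_other_tapes.+1 -> tape_rule letter state
}.

Section Machine.

Variable M : machine.

Definition configuration := 'I_(other_tapes M).+1 -> tape (letter M) (state M).

Definition command_step (k : command M) (C C' : configuration) : Prop :=
  forall i, tape_step (rule k i) (C i) (C' i).

Definition machine_step (C C' : configuration) : Prop :=
  exists k : command M, command_step k C C'.

Definition applicable (k : command M) (C : configuration) : Prop :=
  exists C', command_step k C C'.

Definition deterministic : Prop :=
  forall (C : configuration) (k k' : command M),
  applicable k C -> applicable k' C -> k = k'.

(* Every head starts at the right end of its tape. *)
Definition input_configuration (u : seq (letter M)) : configuration :=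
  fun i => Tape (if i == ord0 then u else [::]) (start_state i) [::].

Definition accept_configuration (C : configuration) : Prop :=
  forall i, head (C i) = accept_state i.

Definition tape_letters (C : configuration) : nat :=
  \sum_i (size (left (C i)) + size (right (C i))).

Definition accepts (u : seq (letter M)) : Prop :=
  all (mem (input_alphabet M)) u /\
  exists p, rewriting machine_step accept_configuration
              (input_configuration u) p.

Definition input_space (u : seq (letter M)) : nat :=
  min_space machine_step accept_configuration tape_letters
    (input_configuration u).

Definition machine_space (n : nat) : nat :=
  \max_(u : n.-bseq (letter M) | `[< accepts u >]) input_space u.

End Machine.

(* Only positive n are compared: the term c * n must absorb additive constants,
   and the space function of a group always vanishes at 0. *)
Definition dominated (f g : nat -> nat) : Prop :=
  exists2 c : nat, 0 < c & forall n, 0 < n -> f n <= c * g (c * n) + c * n.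

Definition equivalent (f g : nat -> nat) : Prop :=
  dominated f g /\ dominated g f.

(* Main.v *)
(* A configuration of M is coded by a vector of Z^I (the phase, the unused space
   in unary, and the stacks written in a fixed radix), and a command by an affine
   rule c : a_c + P_c u <-> b_c + Q_c u that may be used in both directions.
   Reversed commands lead to no new acceptance since M is deterministic; the
   accepting configurations are connected to 0, and the amount of space is chosen
   on the input and then preserved.

   Let D be generated by Z^I, written x^z, a letter s with x s = s x^2 and letters
   r_c with r_c x^(P_c) = x^(Q_c) r_c.  Thanks to s, the element x^z has a word
   whose length is the number of digits of z, and D has a linear space function.
   Put e_c = x^(-b_c) r_c x^(a_c) and E = <e_c>.  Then r_c x^z E = x^(z') E exactly
   when the rule c leads from z to z'.  Adjoin first a letter t that commutes with
   E, and then a letter k that commutes with t and all r_c.  The commutator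
   [k, x^z t x^(-z)] is 1 if and only if z is connected to 0, and, up to linear
   terms, the space needed for removing it is the number of digits of the largest
   vector on the way.  Conversely, every word equal to 1 is removed by such
   commutators, as one sees by following the cosets of E that it visits. *)
From Stdlib Require Import ZArith Lia.
Require Import Defs.
From mathcomp Require Import all_boot.
From mathcomp Require Import boolp classical_sets zify.

Set Implicit Arguments.
Unset Strict Implicit.
Unset Printing Implicit Defensive.

Local Open Scope nat_scope.

(* Simplification unfolds [signed_letter P], and [lia] then sees two different
   types of lists; [slia] normalises the types first. *)
Ltac slia :=
  repeat match goal with
  | |- context [@size ?T ?w] =>
      let T' := eval cbn in T in
      progress change (@size T w) with (@size T' w)
  | H : context [@size ?T ?w] |- _ =>
      let T' := eval cbn in T in
      progress change (@size T w) with (@size T' w) in H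
  end; lia.

(** * Removing words in bounded space *)

(** The letter t turns a coset gE into the element g t g^-1, and k recognises the subgroup generated
    by t and the letters r_c, so that reachability of cosets becomes a word problem. Three obstacles
    shape the proof. Paths through vectors with few digits may be exponentially long, so every
    commutator identity must cost the maximum, not the sum, of the spaces of its parts; this works
    because an entry can be split and one part removed while the other waits. For the lower bound, a
    removal in space s must be shown to involve short cosets only: membership in the subgroup is
    replaced by a property that is closed under quotients of elements of length at most s, and this
    property is carried back along the rewriting by planar matchings. Finally, reversed commands
    reach configurations that stem from no input, about which the space function of M says nothing.
    As the amount of space is preserved after the input phase, a connected configuration either
    traces back to an input of the same total, or is joined to 0 within its own total. *)

Section Killing.

Variable P : presentation.
Implicit Types (u v w p q x c : word P) (W : seq (word P)).

Inductive kills (s : nat) : seq (word P) -> Prop :=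
| kills_nil : kills s [::]
| kills_step W W' :
    total_length W <= s -> elementary_step W W' -> kills s W' -> kills s W.

Definition kill (s : nat) (w : word P) : Prop := kills s [:: w].

Lemma total_length_cat W1 W2 :
  total_length (W1 ++ W2) = total_length W1 + total_length W2.
Proof. by rewrite /total_length big_cat. Qed.

Lemma total_length1 w : total_length [:: w] = size w.
Proof. by rewrite /total_length big_seq1. Qed.

Lemma kills_total_length s W : kills s W -> total_length W <= s.
Proof. by case=> //; rewrite /total_length big_nil. Qed.

Lemma kills_leq s s' W : s <= s' -> kills s W -> kills s' W.
Proof.
move=> les; elim=> [|W1 W2 lew st _ IH]; first exact: kills_nil.
exact: kills_step (leq_trans lew les) st IH.
Qed.

Lemma elementary_step_catr W W' W2 :
  elementary_step W W' -> elementary_step (W ++ W2) (W' ++ W2).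
Proof. by case=> U1 w U U2 st; rewrite -!catA cat_cons; constructor. Qed.

(** [W1] is removed while [W2] waits unchanged, and only then is [W2] touched; hence a maximum and
    not the sum of both spaces. *)
Lemma kills_cat s1 s2 s W1 W2 : kills s1 W1 -> kills s2 W2 ->
  s1 + total_length W2 <= s -> s2 <= s -> kills s (W1 ++ W2).
Proof.
move=> k1 k2 les1 les2.
elim: k1 => [|W W' lew st _ IH]; first exact: kills_leq k2.
apply: kills_step (elementary_step_catr _ st) IH.
by rewrite total_length_cat (leq_trans _ les1) ?leq_add2r.
Qed.

Lemma kill_entry s w w' :
  size w <= s -> entry_step w [:: w'] -> kill s w' -> kill s w.
Proof.
move=> lew st k; apply: (@kills_step _ _ [:: w']) => //.
  by rewrite total_length1.
exact: (@ElementaryStep _ [::] _ _ [::] st).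
Qed.

Lemma kill_size s w : kill s w -> size w <= s.
Proof. by move=> k; have := kills_total_length k; rewrite total_length1. Qed.

Lemma kill_leq s s' w : s <= s' -> kill s w -> kill s' w.
Proof. exact: kills_leq. Qed.

Lemma kill0 : kill 0 [::].
Proof.
apply: kills_step (kills_nil 0); first by rewrite total_length1.
by apply: (@ElementaryStep _ [::] _ [::] [::]); constructor.
Qed.

Lemma kill_rot s u v : kill s (v ++ u) -> kill s (u ++ v).
Proof.
move=> k; have := kill_size k; rewrite size_cat addnC -size_cat => les.
exact: kill_entry les (entry_cyclic u v) k.
Qed.

(* The subword [c] is cut out by a cyclic shift and a splitting, so that the
   context is stored only once while [c] is being removed. *)
Lemma kill_context s1 s2 s p c q : kill s1 c -> kill s2 (p ++ q) ->
  s1 + size p + size q <= s -> s2 <= s -> kill s (p ++ c ++ q).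
Proof.
move=> kc kpq le1 le2; apply: kill_rot; rewrite -catA.
have lec := kill_size kc.
apply: (@kills_step _ _ [:: c; q ++ p]).
- by rewrite total_length1 !size_cat; slia.
- exact: (@ElementaryStep _ [::] _ _ [::] (entry_split _ _)).
- apply: (@kills_cat s1 s2 s [:: c] [:: q ++ p]) => //.
    exact: kill_rot.
  by rewrite total_length1 size_cat; slia.
Qed.

(* [w] can be rewritten to [w'] inside any context, with space [s] besides the
   context. *)
Definition conv (s : nat) (w w' : word P) : Prop := forall p q S,
  kill S (p ++ w' ++ q) -> kill (maxn S (s + size p + size q)) (p ++ w ++ q).

Lemma conv_leq s s' w w' : conv s w w' -> s <= s' -> conv s' w w'.
Proof. by move=> cw les p q S k; apply: kill_leq (cw p q S k); slia. Qed.

Lemma conv_refl s w : conv s w w.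
Proof. by move=> p q S k; apply: kill_leq k; slia. Qed.

Lemma conv_trans s w1 w2 w3 : conv s w1 w2 -> conv s w2 w3 -> conv s w1 w3.
Proof.
by move=> c1 c2 p q S k; have := c1 p q _ (c2 p q S k); apply: kill_leq; slia.
Qed.

Lemma conv_cat s s' a b w w' : conv s w w' -> s + size a + size b <= s' ->
  conv s' (a ++ w ++ b) (a ++ w' ++ b).
Proof.
move=> cw les p q S; rewrite -!catA catA [p ++ a ++ w ++ _]catA => k.
by have := cw _ _ _ k; apply: kill_leq; rewrite !size_cat; slia.
Qed.

Lemma conv_catl s s' a w w' : conv s w w' -> s + size a <= s' ->
  conv s' (a ++ w) (a ++ w').
Proof.
move=> cw les; rewrite -[w]cats0 -[w']cats0.
by apply: conv_cat cw _; rewrite addn0.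
Qed.

Lemma conv_catr s s' b w w' : conv s w w' -> s + size b <= s' ->
  conv s' (w ++ b) (w' ++ b).
Proof. by move=> cw les; apply: (@conv_cat s s' [::]); rewrite ?addn0. Qed.

Lemma conv_at s s' p q a b w w' : conv s w w' -> a = p ++ w ++ q ->
  b = p ++ w' ++ q -> s + size p + size q <= s' -> conv s' a b.
Proof. by move=> c -> ->; exact: conv_cat. Qed.

Lemma kill_conv s S w w' : conv s w w' -> kill S w' -> kill (maxn S s) w.
Proof.
move=> cw; have := cw [::] [::] S; rewrite /= !cats0 => cw' /cw'.
by rewrite !addn0.
Qed.

Lemma kill_convW s w w' : conv s w w' -> kill s w' -> kill s w.
Proof. by move=> cw k; have := kill_conv cw k; rewrite maxnn. Qed.

Lemma conv_kill s w : kill s w -> conv s w [::].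
Proof.
move=> k p q S kpq; apply: (kill_context k kpq); last exact: leq_maxl.
exact: leq_maxr.
Qed.

Lemma kill_conv0 s w : conv s w [::] -> kill s w.
Proof. by move=> c; apply: kill_convW c _; apply: kill_leq kill0. Qed.

Lemma conv_insert x : elementary_subword x -> conv (size x) [::] x.
Proof.
move=> ex p q S k; have les := kill_size k.
rewrite !size_cat in les; apply: kill_entry (entry_insert p q ex) _.
  by rewrite !size_cat; slia.
by apply: kill_leq k; slia.
Qed.

Lemma conv_remove x : elementary_subword x -> conv (size x) x [::].
Proof.
move=> ex p q S k; apply: kill_entry (entry_remove p q ex) _.
  by rewrite !size_cat; slia.
by apply: kill_leq k; slia.
Qed.

Lemma inv_letterK : involutive (@inv_letter P).
Proof. by case=> a b; rewrite /inv_letter /= negbK. Qed.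

Lemma size_inv w : size (inv_word w) = size w.
Proof. by rewrite size_rev size_map. Qed.

Lemma inv_cat u v : inv_word (u ++ v) = inv_word v ++ inv_word u.
Proof. by rewrite /inv_word map_cat rev_cat. Qed.

Lemma inv_cons a v : inv_word (a :: v) = inv_word v ++ [:: inv_letter a].
Proof. by rewrite -cat1s inv_cat. Qed.

Lemma inv_wordK : involutive (@inv_word P).
Proof. by move=> w; rewrite /inv_word map_rev revK mapK //; exact: inv_letterK. Qed.

Lemma conv_inv s w : size w * 2 <= s ->
  conv s (w ++ inv_word w) [::] /\ conv s [::] (w ++ inv_word w).
Proof.
elim: w s => [|a w IH] s /= les; first by split; apply: conv_refl.
have le2 : size w * 2 <= s - 2.
  slia.
have [IH1 IH2] := IH _ le2.
rewrite inv_cons -cat1s [w ++ _]catA.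
split.
- apply: (@conv_trans _ _ [:: a; inv_letter a]).
    by apply: (@conv_cat _ _ [:: a] [:: inv_letter a]) IH1 _ => /=; slia.
  by apply: (@conv_leq 2); [exact: (conv_remove (elementary_inv a))|slia].
- apply: (@conv_trans _ _ [:: a; inv_letter a]).
    by apply: (@conv_leq 2); [exact: (conv_insert (elementary_inv a))|slia].
  by apply: (@conv_cat _ _ [:: a] [:: inv_letter a]) IH2 _ => /=; slia.
Qed.

Lemma conv_invV s w : size w * 2 <= s ->
  conv s (inv_word w ++ w) [::] /\ conv s [::] (inv_word w ++ w).
Proof.
by move=> les; have := @conv_inv s (inv_word w); rewrite inv_wordK size_inv; apply.
Qed.

(** Insert [inv_word w' ++ w'] to the right of [w], then remove [w ++ inv_word w'], which leaves
    [w']. *)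
Lemma conv_of_kill s s' w w' : kill s (w ++ inv_word w') ->
  s + size w + size w' * 2 <= s' -> conv s' w w'.
Proof.
move=> k les; apply: (@conv_trans _ _ (w ++ inv_word w' ++ w')).
  rewrite -[X in conv _ X]cats0; apply: conv_catl (conv_invV (leqnn _)).2 _.
  slia.
by rewrite catA; apply: (@conv_catr s _ w' _ [::]); [apply: conv_kill|slia].
Qed.

Lemma kill_of_conv s s' w w' : conv s w w' -> s + size w' <= s' ->
  size w' * 2 <= s' -> kill s' (w ++ inv_word w').
Proof.
move=> c le1 le2; apply: kill_conv0; apply: (@conv_trans _ _ (w' ++ inv_word w')).
  by apply: conv_catr c _; rewrite size_inv.
exact: (conv_inv le2).1.
Qed.

Lemma elementary_subword_inv x :
  elementary_subword x -> elementary_subword (inv_word x).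
Proof.
case=> [a|r rP|r rP]; [|by constructor|].
- by rewrite /inv_word /= /rev /= inv_letterK; constructor.
- by rewrite inv_wordK; constructor.
Qed.

Lemma kills_inv s W : kills s W -> kills s (rev (map (@inv_word P) W)).
Proof.
have tl U : total_length (rev (map (@inv_word P) U)) = total_length U.
  elim: U => // w U IH; rewrite map_cons rev_cons -cats1 total_length_cat IH.
  by rewrite -[w :: U]cat1s total_length_cat !total_length1 size_inv addnC.
elim=> [|U U' leU st _ IH]; first exact: kills_nil.
apply: kills_step IH; rewrite ?tl //; case: st => W1 w V W2 st.
rewrite !map_cat !rev_cat map_cons rev_cons -cats1 -!catA /=.
apply: ElementaryStep; case: st => {w V} [u v x ex|u v x ex|u v|u v|] /=;
  rewrite /rev /= ?inv_cat -?catA; constructor; exact: elementary_subword_inv.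
Qed.

Lemma kill_inv s w : kill s w -> kill s (inv_word w).
Proof. exact: kills_inv. Qed.

(** Rewritings cannot simply be read backwards, as splitting and erasing are one-way; the inverse of
    [w ++ inv_word w'] is removed instead. *)
Lemma conv_sym s s' w w' : conv s w w' ->
  s + size w * 2 + size w' * 4 <= s' -> conv s' w' w.
Proof.
move=> c les.
have k := kill_inv (@kill_of_conv s (s + size w' * 2) _ _ c ltac:(slia) ltac:(slia)).
by move: k; rewrite inv_cat inv_wordK => /conv_of_kill; apply; slia.
Qed.

Lemma kill_sym s s' w w' : kill s (w ++ inv_word w') ->
  s <= s' -> kill s' (w' ++ inv_word w).
Proof. by move=> /kill_inv + les; rewrite inv_cat inv_wordK; apply: kill_leq. Qed.

Lemma conv_rel r : r \in relators P -> conv (size r) r [::].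
Proof. by move=> rP; apply: conv_remove; constructor. Qed.

Lemma group_eq_catl a w w' : group_eq w w' -> group_eq (a ++ w) (a ++ w').
Proof. by move=> e; apply: group_eq_cat => //; constructor. Qed.

Lemma group_eq_catr b w w' : group_eq w w' -> group_eq (w ++ b) (w' ++ b).
Proof. by move=> e; apply: group_eq_cat => //; constructor. Qed.

Lemma group_eq_invr w : group_eq (w ++ inv_word w) [::].
Proof.
elim: w => [|a w IH]; first exact: group_eq_refl.
rewrite inv_cons -cat1s -catA [w ++ inv_word w ++ _]catA.
apply: group_eq_trans (group_eq_inv a).
by apply: (@group_eq_catl [:: a]); apply: (@group_eq_catr _ _ [::]).
Qed.

Lemma group_eq_invl w : group_eq (inv_word w ++ w) [::].
Proof. by have := group_eq_invr (inv_word w); rewrite inv_wordK. Qed.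

Lemma group_eq_mulV w w' : group_eq (w ++ inv_word w') [::] <-> group_eq w w'.
Proof.
split=> e.
- apply: (@group_eq_trans _ _ (w ++ inv_word w' ++ w')).
    rewrite -[X in group_eq X]cats0; apply: group_eq_catl.
    exact/group_eq_sym/group_eq_invl.
  by rewrite catA; apply: (@group_eq_catr _ _ [::]).
- exact: group_eq_trans (group_eq_catr _ e) (group_eq_invr _).
Qed.

Lemma group_eq_Vmul w w' : group_eq (inv_word w ++ w') [::] <-> group_eq w w'.
Proof.
split=> e.
- apply: group_eq_sym; apply: (@group_eq_trans _ _ (w ++ inv_word w ++ w')).
    by rewrite catA; apply: (@group_eq_catr _ [::]); exact/group_eq_sym/group_eq_invr.
  by rewrite -[X in group_eq _ X]cats0; apply: group_eq_catl.
- exact: group_eq_trans (group_eq_catl _ (group_eq_sym e)) (group_eq_invl _).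
Qed.

Lemma group_eq_inv_word w w' :
  group_eq w w' -> group_eq (inv_word w) (inv_word w').
Proof.
move=> e; apply/group_eq_mulV; rewrite inv_wordK.
exact/group_eq_Vmul.
Qed.

Lemma elementary_group_eq x : elementary_subword x -> group_eq x [::].
Proof.
case=> [a|r rP|r rP]; [exact: group_eq_inv|exact: group_eq_rel|].
exact: (group_eq_inv_word (group_eq_rel rP)).
Qed.

Lemma group_eq_context c p q :
  group_eq c [::] -> group_eq (p ++ c ++ q) (p ++ q).
Proof. by move=> e; apply: group_eq_catl; apply: (@group_eq_catr _ _ [::]). Qed.

Lemma group_eq_rot u v : group_eq (u ++ v) [::] -> group_eq (v ++ u) [::].
Proof.
move=> e; rewrite -[u]inv_wordK; apply/group_eq_mulV/group_eq_sym/group_eq_Vmul.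
by rewrite inv_wordK.
Qed.

Lemma kill_group_eq s w : kill s w -> group_eq w [::].
Proof.
suff H W : kills s W -> forall w, w \in W -> group_eq w [::].
  by move=> k; apply: (H _ k); rewrite inE.
elim=> // _ _ _ [W1 {}w V W2 st] _ IH u; rewrite mem_cat inE => /or3P[uW|/eqP->|uW].
- by apply: IH; rewrite mem_cat uW.
- have IHV v : v \in V -> group_eq v [::].
    by move=> vV; apply: IH; rewrite !mem_cat vV orbT.
  case: st IHV => {w V IH} [p q x ex|p q x ex|p q|p q|] IHV.
  + have := IHV _ (mem_head _ _); apply: group_eq_trans; apply: group_eq_sym.
    exact/group_eq_context/elementary_group_eq.
  + have := IHV _ (mem_head _ _); apply: group_eq_trans.
    exact/group_eq_context/elementary_group_eq.
  + exact/group_eq_rot/IHV/mem_head.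
  + apply: (@group_eq_cat _ _ [::] _ [::]); apply: IHV; rewrite !inE eqxx //.
    by rewrite orbT.
  + exact: group_eq_refl.
- by apply: IH; rewrite !mem_cat uW !orbT.
Qed.

Lemma conv_group_eq s w w' : conv s w w' -> group_eq w w'.
Proof.
move=> c; apply/group_eq_mulV; apply: (@kill_group_eq (s + size w' * 2)).
by apply: kill_of_conv c _ _; slia.
Qed.

Lemma conv_inv_word s s' w w' : conv s w w' ->
  s + size w * 2 + size w' * 4 <= s' -> conv s' (inv_word w) (inv_word w').
Proof.
move=> c les; have k : kill (s + size w' * 2) (w ++ inv_word w').
  by apply: kill_of_conv c _ _; slia.
apply: (@conv_of_kill (s + size w' * 2)); last by rewrite !size_inv; slia.
by apply: kill_rot; rewrite inv_wordK; have := kill_inv k; rewrite inv_cat inv_wordK.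
Qed.

End Killing.

Lemma minimumP (A : nat -> Prop) n : A n -> A (minimum A) /\ minimum A <= n.
Proof.
move=> An; rewrite /minimum.
have ex : exists m, `[< A m >] by exists n; apply/asboolP.
case: (ex_minnP ex) => m /asboolP Am minm.
have Hm : [set s | A s /\ (forall t, A t -> s <= t)]%classic m.
  by split=> // t At; apply: minm; apply/asboolP.
by case: (xgetI 0 Hm) => H1 H2; split=> //; apply: H2.
Qed.

Lemma min_spaceP (T : Type) (step : T -> T -> Prop) final norm x p :
  rewriting step final x p ->
  min_space step final norm x <= rewriting_space norm x p /\
  exists2 p', rewriting step final x p' &
    rewriting_space norm x p' = min_space step final norm x.
Proof.
move=> rw; pose A s := exists2 p, rewriting step final x p &
  rewriting_space norm x p = s.
by have [] := @minimumP A (rewriting_space norm x p) (ex_intro2 _ _ p rw erefl).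
Qed.

Lemma kills_rewriting (P : presentation) s (W : seq (word P)) : kills s W <->
  exists2 p, rewriting (@elementary_step P) (fun W => W = [::]) W p &
    rewriting_space (@total_length P) W p <= s.
Proof.
split.
- elim=> [|U U' leU st _ [p [pp pl] ps]].
    by exists [::]; rewrite /rewriting_space ?big_seq1 ?/total_length ?big_nil.
  exists (U' :: p).
    by split=> //=; rewrite pp andbT; apply/asboolP.
  by move: ps; rewrite /rewriting_space !big_cons => ps; rewrite geq_max leU.
- case=> p; elim: p W => [|U' p IH] W [/= pp pl]; rewrite /rewriting_space big_cons.
    by rewrite pl => _; exact: kills_nil.
  rewrite geq_max => /andP[leW le']; case/andP: pp => /asboolP st pp.
  by apply: kills_step leW st _; apply: IH.
Qed.

Lemma word_space_leq (P : presentation) s (w : word P) : kill s w -> word_space w <= s.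
Proof.
by case/kills_rewriting => p rw les; have [le _] := min_spaceP (@total_length P) rw;
   exact: leq_trans le les.
Qed.

Lemma kill_word_space (P : presentation) s (w : word P) :
  kill s w -> kill (word_space w) w.
Proof.
case/kills_rewriting => p rw _; have [_ [p' rw' e]] := min_spaceP (@total_length P) rw.
by apply/kills_rewriting; exists p'; rewrite ?e.
Qed.

(** * Free reduction *)

Section FreeReduction.

Variable X : eqType.
Implicit Types (s u v : seq (X * bool)) (a : X * bool).

Definition flip a := (a.1, ~~ a.2).

Definition push a s :=
  if s is b :: s' then if b == flip a then s' else a :: s else [:: a].

Definition fred s := foldr push [::] s.

Definition reduced s := sorted (fun a b => b != flip a) s.

Lemma flipK : involutive flip.
Proof. by case=> x b; rewrite /flip /= negbK. Qed.

Lemma reduced_cons a s :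
  reduced (a :: s) = (if s is b :: _ then b != flip a else true) && reduced s.
Proof. by case: s. Qed.

Lemma push_reduced a s : reduced s -> reduced (push a s).
Proof.
case: s => [//|b s] rs; rewrite /push; case: eqP => [_|/eqP ne].
  by move: rs; rewrite reduced_cons => /andP[].
by rewrite reduced_cons ne.
Qed.

(** Van der Waerden's argument: every letter permutes the reduced words, and the inverse letter acts
    as the inverse permutation. This makes [fred] independent of the order of cancellations. *)
Lemma push_flip a s : reduced s -> push a (push (flip a) s) = s.
Proof.
case: s => [_|b s]; rewrite /push ?eqxx // flipK reduced_cons.
case: eqP => [->|_ _]; last by rewrite eqxx.
by case: s => // c s /andP[/negbTE->].
Qed.

Lemma foldr_push_reduced s u : reduced s -> reduced (foldr push s u).
Proof. by move=> rs; elim: u => //= a u IH; apply: push_reduced. Qed.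

Lemma fred_reduced s : reduced (fred s).
Proof. exact: foldr_push_reduced. Qed.

Lemma foldr_push_fred s u : reduced s -> foldr push s (fred u) = foldr push s u.
Proof.
move=> rs; elim: u => //= a u <-.
case E: (fred u) => [|b u'] //=; case: eqP => [->|//].
by rewrite push_flip // foldr_push_reduced.
Qed.

Lemma fred_cat u v : fred (u ++ v) = fred (fred u ++ fred v).
Proof.
have H s : fred (s ++ v) = foldr push (fred v) s by rewrite /fred foldr_cat.
have fv : fred (fred v) = fred v by rewrite /fred foldr_push_fred.
rewrite H [RHS]/fred foldr_cat -/(fred (fred v)) fv.
by rewrite foldr_push_fred ?fred_reduced.
Qed.

Lemma fred_catl u u' v : fred u = fred u' -> fred (u ++ v) = fred (u' ++ v).
Proof. by move=> e; rewrite fred_cat e -fred_cat. Qed.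

Lemma fred_catr u v v' : fred v = fred v' -> fred (u ++ v) = fred (u ++ v').
Proof. by move=> e; rewrite fred_cat e -fred_cat. Qed.

Lemma fred_pair a : fred [:: a; flip a] = [::].
Proof. by rewrite /= eqxx. Qed.

Lemma fred_cancel u a v : fred (u ++ [:: a; flip a] ++ v) = fred (u ++ v).
Proof. by apply: fred_catr; rewrite (@fred_catl _ [::]) ?fred_pair. Qed.

Definition finv s := rev (map flip s).

Lemma fred_finvr s : fred (s ++ finv s) = [::].
Proof.
elim: s => // a s IH; rewrite /finv map_cons rev_cons -cats1 -cat1s -catA.
rewrite [s ++ _]catA (@fred_catr _ _ [:: flip a]) ?fred_pair //.
by rewrite (@fred_catl _ [::]).
Qed.

Lemma finvK : involutive finv.
Proof. by move=> s; rewrite /finv map_rev revK mapK //; exact: flipK. Qed.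

Lemma fred_finvl s : fred (finv s ++ s) = [::].
Proof. by rewrite -{2}[s]finvK fred_finvr. Qed.

Lemma fred_rot u v : fred (u ++ v) = [::] -> fred (v ++ u) = [::].
Proof.
move=> e; have -> : fred (v ++ u) = fred (v ++ (u ++ v) ++ finv v).
  rewrite -catA; apply: fred_catr; rewrite -[u in LHS]cats0.
  by apply: fred_catr; rewrite fred_finvr.
by rewrite (@fred_catr _ _ (finv v)) ?fred_finvr // (@fred_catl _ [::]).
Qed.

(** Recovers the surviving letters of a factor from the product and the other factor;
    [short_good_div] uses this to pass to a quotient. *)
Lemma fred_solve u v w :
  fred (u ++ v) = fred w -> fred v = fred (finv (fred u) ++ fred w).
Proof.
move=> e; rewrite -[LHS]/(fred ([::] ++ v)).
rewrite -(@fred_catl (finv (fred u) ++ fred u)) ?fred_finvl // -catA.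
apply: fred_catr; rewrite (@fred_catl _ u) ?e //; last exact: foldr_push_fred.
by rewrite [RHS]foldr_push_fred.
Qed.

Lemma fred_subset s : {subset fred s <= s}.
Proof.
elim: s => //= a s IH x; rewrite /push.
case E: (fred s) => [|b s']; first by rewrite !inE => ->.
rewrite E in IH; case: eqP => _; rewrite !inE.
  by move=> xs; rewrite IH ?orbT // inE xs orbT.
by case/orP=> [->//|xs]; rewrite IH ?orbT // inE.
Qed.

Lemma fred_subset_cat u v x :
  x \in fred (u ++ v) -> x \in fred u \/ x \in fred v.
Proof. by rewrite fred_cat => /fred_subset; rewrite mem_cat => /orP. Qed.

Lemma mem_finv s (x : X) : x \in unzip1 (finv s) -> x \in unzip1 s.
Proof.
rewrite /unzip1 map_rev mem_rev -map_comp => /mapP[y ys ->].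
exact: (map_f fst ys).
Qed.

Lemma reduced_fred s : reduced s -> fred s = s.
Proof.
elim: s => // a s IH; rewrite reduced_cons => /andP[h rs] /=.
rewrite IH // /push; case: s h {IH rs} => // b s /negbTE h.
by rewrite h.
Qed.

Lemma cancelling_pair s :
  ~~ reduced s -> exists u a v, s = u ++ [:: a; flip a] ++ v.
Proof.
elim: s => // a s IH; rewrite reduced_cons negb_and => /orP[|/IH [u [b [v ->]]]].
  case: s {IH} => // b s; rewrite negbK => /eqP->.
  by exists [::], a, s.
by exists (a :: u), b, v.
Qed.

End FreeReduction.

(** A relabelling need not be injective: it may create cancellations but destroys none. It serves
    for merging colours and for translating cosets. *)
Lemma fred_map_fred (X Y : eqType) (f : X -> Y) (s : seq (X * bool)) :
  fred [seq (f a.1, a.2) | a <- s] = fred [seq (f a.1, a.2) | a <- fred s].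
Proof.
elim: s => // a s IH.
rewrite map_cons -cat1s (@fred_catr _ _ _ [seq (f b.1, b.2) | b <- fred s]) //.
rewrite /= {2}/push; case E: (fred s) => [|b s'] //.
case: eqP => [->|] //=.
by rewrite -[LHS]/(fred ([::] ++ [:: (f a.1, a.2); flip (f a.1, a.2)] ++ _)) fred_cancel.
Qed.

Lemma fred_map (X Y : eqType) (f : X -> Y) (s : seq (X * bool)) :
  fred s = [::] -> fred [seq (f a.1, a.2) | a <- s] = [::].
Proof. by rewrite fred_map_fred => ->. Qed.

Lemma mem_fred_map (X Y : eqType) (f : X -> Y) (s : seq (X * bool)) y :
  y \in unzip1 (fred [seq (f a.1, a.2) | a <- s]) ->
  exists2 x, x \in unzip1 (fred s) & y = f x.
Proof.
rewrite fred_map_fred => /mapP[b /fred_subset /mapP[a aP ->] ->].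
by exists a.1 => //; exact: map_f.
Qed.

(** * Adjoining a letter that commutes with a subgroup *)

Section Subgroups.

Variables (P : presentation) (hs : seq (word P)).
Implicit Types (h p q w : word P).

Inductive subgroup : word P -> Prop :=
| subgroup_nil : subgroup [::]
| subgroup_gen h w : h \in hs -> subgroup w -> subgroup (h ++ w)
| subgroup_genV h w : h \in hs -> subgroup w -> subgroup (inv_word h ++ w)
| subgroup_eq w w' : group_eq w w' -> subgroup w -> subgroup w'.

Lemma subgroup_mem h : h \in hs -> subgroup h.
Proof.
by move=> hP; rewrite -[h]cats0; apply: subgroup_gen => //; exact: subgroup_nil.
Qed.

Lemma subgroup_cat w w' : subgroup w -> subgroup w' -> subgroup (w ++ w').
Proof.
elim=> [//|h u hP _ IH|h u hP _ IH|u u' e _ IH] sw'.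
- by rewrite -catA; apply: subgroup_gen => //; exact: IH.
- by rewrite -catA; apply: subgroup_genV => //; exact: IH.
- by apply: subgroup_eq (IH sw'); apply: group_eq_catr.
Qed.

Lemma subgroup_inv w : subgroup w -> subgroup (inv_word w).
Proof.
elim=> [|h u hP _ IH|h u hP _ IH|u u' e _ IH]; first exact: subgroup_nil.
- rewrite inv_cat; apply: subgroup_cat => //.
  by rewrite -[inv_word h]cats0; apply: subgroup_genV => //; exact: subgroup_nil.
- rewrite inv_cat inv_wordK; apply: subgroup_cat => //; exact: subgroup_mem.
- by apply: subgroup_eq IH; apply: group_eq_inv_word.
Qed.

(** A left coset as a set of words, so that equal cosets are Leibniz equal and can serve as letters
    for [fred]. *)
Definition coset p : set (word P) := fun w => subgroup (inv_word p ++ w).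

Lemma coset_eq p q : coset p = coset q <-> subgroup (inv_word p ++ q).
Proof.
split=> [e|spq].
  have : coset q q by apply: subgroup_eq subgroup_nil; exact/group_eq_sym/group_eq_invl.
  by rewrite -e.
have spqV : subgroup (inv_word q ++ p).
  by have := subgroup_inv spq; rewrite inv_cat inv_wordK.
have H a b w : subgroup (inv_word a ++ b) -> subgroup (inv_word b ++ w) ->
    subgroup (inv_word a ++ w).
  move=> sab sbw; apply: subgroup_eq (subgroup_cat sab sbw).
  rewrite -catA; apply: group_eq_catl; rewrite catA.
  by apply: (@group_eq_catr _ _ _ [::]); exact: group_eq_invr.
by rewrite predeqE => w; split; exact: H.
Qed.

Lemma coset_group_eq p q : group_eq p q -> coset p = coset q.
Proof.
by move=> e; apply/coset_eq; apply: subgroup_eq subgroup_nil; exact/group_eq_sym/group_eq_Vmul.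
Qed.

Lemma coset_cat p h : subgroup h -> coset (p ++ h) = coset p.
Proof.
move=> sh; apply/esym/coset_eq; apply: subgroup_eq sh; rewrite catA.
by apply: (@group_eq_catr _ _ [::]); exact/group_eq_sym/group_eq_invl.
Qed.

Lemma coset_shift g p q : coset p = coset q <-> coset (g ++ p) = coset (g ++ q).
Proof.
have e : group_eq (inv_word (g ++ p) ++ g ++ q) (inv_word p ++ q).
  rewrite inv_cat -catA; apply: group_eq_catl; rewrite catA.
  by apply: (@group_eq_catr _ _ _ [::]); exact: group_eq_invl.
split=> /coset_eq s; apply/coset_eq; apply: subgroup_eq s => //.
exact: group_eq_sym.
Qed.

Definition translate (g : word P) (X : set (word P)) : set (word P) :=
  fun w => X (inv_word g ++ w).

Lemma translate_coset g p : translate g (coset p) = coset (g ++ p).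
Proof. by rewrite predeqE => w; rewrite /translate /coset inv_cat catA. Qed.

End Subgroups.

Section Adjoin.

Variables (P : presentation) (hs : seq (word P)).
Implicit Types (h p q v : word P).

Definition lift (w : word P) : seq (option (generator P) * bool) :=
  [seq (Some a.1, a.2) | a <- w].

Definition commutator h : seq (option (generator P) * bool) :=
  (None, false) :: lift h ++ (None, true) :: lift (inv_word h).

Definition adjoin : presentation :=
  @Presentation (option (generator P))
    (map lift (relators P) ++ map commutator hs).

Implicit Types w : word adjoin.

Definition down (w : word adjoin) : word P :=
  pmap (fun a => if a.1 is Some g then Some (g, a.2) else None) w.

Lemma down_cat w w' : down (w ++ w') = down w ++ down w'.
Proof. exact: pmap_cat. Qed.

Lemma liftK v : down (lift v) = v.
Proof. by elim: v => //= -[g b] v ->. Qed.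

Lemma size_lift v : size (lift v) = size v.
Proof. exact: size_map. Qed.

Lemma size_commutator h : size (commutator h) = (size h).+1.*2.
Proof. by rewrite /= size_cat /= !size_lift size_inv; slia. Qed.

Lemma lift_cat v v' : lift (v ++ v') = lift v ++ lift v'.
Proof. exact: map_cat. Qed.

Lemma lift_inv v : lift (inv_word v) = @inv_word adjoin (lift v).
Proof. by rewrite /lift /inv_word map_rev -!map_comp. Qed.

Lemma down_inv w : down (inv_word w) = inv_word (down w).
Proof.
elim: w => // -[[g|] b] w IH; rewrite inv_cons down_cat IH ?cats0 //.
by rewrite -[down (_ :: w)]/((g, b) :: down w) inv_cons.
Qed.

Lemma size_down w : size (down w) <= size w.
Proof. by rewrite size_pmap count_size. Qed.

Lemma lift_elementary v :
  elementary_subword v -> @elementary_subword adjoin (lift v).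
Proof.
case=> [a|r rP|r rP]; first exact: (@elementary_inv adjoin).
- by apply: elementary_rel; rewrite mem_cat map_f.
- by rewrite lift_inv; apply: elementary_rel_inv; rewrite mem_cat map_f.
Qed.

Lemma kill_lift s v : kill s v -> @kill adjoin s (lift v).
Proof.
suff H W : kills s W -> @kills adjoin s (map lift W) by exact: H.
elim=> [|U U' leU st _ IH]; first exact: kills_nil.
apply: kills_step IH; first by rewrite /total_length big_map; under eq_bigr do rewrite size_lift.
case: st => W1 u V W2 st; rewrite !map_cat map_cons; apply: ElementaryStep.
by case: st => {u V} [u v' x ex|u v' x ex|u v'|u v'|] /=; rewrite ?lift_cat; constructor;
  exact: lift_elementary.
Qed.

Lemma lift_group_eq v v' : group_eq v v' -> @group_eq adjoin (lift v) (lift v').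
Proof.
elim=> {v v'} [u|u v _ IH|u v w _ IH1 _ IH2|u u' v v' _ IH1 _ IH2|a|r rP].
- exact: group_eq_refl.
- exact: group_eq_sym.
- exact: group_eq_trans IH2.
- by rewrite !lift_cat; exact: group_eq_cat.
- exact: (@group_eq_inv adjoin).
- by apply: group_eq_rel; rewrite mem_cat map_f.
Qed.

Lemma down_group_eq w w' : group_eq w w' -> group_eq (down w) (down w').
Proof.
elim=> {w w'} [u|u v _ IH|u v w _ IH1 _ IH2|u u' v v' _ IH1 _ IH2|a|r].
- exact: group_eq_refl.
- exact: group_eq_sym.
- exact: group_eq_trans IH2.
- by rewrite !down_cat; exact: group_eq_cat.
- case: a => [[g|] b]; [exact: (@group_eq_inv P)|exact: group_eq_refl].
- rewrite mem_cat => /orP[/mapP[v vP ->]|/mapP[h hP ->]].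
    by rewrite liftK; exact: group_eq_rel.
  rewrite -[down _]/(down (lift h ++ [:: (None, true)] ++ lift (inv_word h))).
  by rewrite !down_cat !liftK; exact: group_eq_invr.
Qed.

(** The conjugates g t g^-1 of the adjoined letter, one for each coset of the subgroup, freely
    generate the kernel of the map that erases t. This lists the free generators, with signs, that
    [w] contributes when read after the prefix [p]. *)
Fixpoint cosets (p : word P) (w : word adjoin) : seq (set (word P) * bool) :=
  match w with
  | [::] => [::]
  | (None, e) :: w' => (coset hs p, e) :: cosets p w'
  | (Some g, e) :: w' => cosets (p ++ [:: (g, e)]) w'
  end.

Lemma cosets_cat p w w' : cosets p (w ++ w') = cosets p w ++ cosets (p ++ down w) w'.
Proof.
elim: w p => [|[[g|] e] w IH] p /=; first by rewrite cats0.
- by rewrite IH -catA.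
- by rewrite IH.
Qed.

Lemma cosets_lift p v : cosets p (lift v) = [::].
Proof. by elim: v p => //= a v IH p. Qed.

Lemma cosets_group_eq_base p p' w : group_eq p p' -> cosets p w = cosets p' w.
Proof.
elim: w p p' => [//|[[g|] e] w IH] p p' ep /=.
- by apply: IH; apply: group_eq_catr.
- by rewrite (coset_group_eq _ ep) (IH _ _ ep).
Qed.

(** A relator t h t^-1 h^-1 contributes the cosets of p and of p h with opposite signs, and these
    cosets coincide. *)
Lemma cosets_group_eq w w' :
  group_eq w w' -> forall p, fred (cosets p w) = fred (cosets p w').
Proof.
elim=> {w w'} [u|u v _ IH|u v w _ IH1 _ IH2|u u' v v' e1 IH1 e2 IH2|a|r rP] p.
- by [].
- by rewrite IH.
- by rewrite IH1.
- rewrite !cosets_cat (fred_catl _ (IH1 p)); apply: fred_catr; rewrite IH2.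
  by congr fred; apply: cosets_group_eq_base; apply: group_eq_catl; exact: down_group_eq.
- by case: a => [[g|] b] //=; rewrite eqxx.
- move: rP; rewrite mem_cat => /orP[/mapP[v vP ->]|/mapP[h hP ->]].
    by rewrite cosets_lift.
  rewrite [commutator h]/= [cosets _ _]/= cosets_cat cosets_lift liftK /= cosets_lift.
  by rewrite coset_cat /= ?eqxx //; exact: subgroup_mem.
Qed.

Lemma mem_cosets p w X : X \in unzip1 (cosets p w) ->
  exists2 u, size u <= size w & X = coset hs (p ++ down u).
Proof.
elim: w p => [//|[[g|] e] w IH] p /=.
- move=> /IH[u leu ->]; exists ((Some g, e) :: u) => //=.
  by rewrite -catA.
- rewrite inE => /orP[/eqP->|/IH[u leu ->]]; first by exists [::]; rewrite ?cats0.
  by exists u => //; exact: leqW.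
Qed.

Lemma cosets_translate g p w :
  cosets (g ++ p) w = [seq (translate g a.1, a.2) | a <- cosets p w].
Proof.
elim: w p => [//|[[x|] e] w IH] p /=; first by rewrite -catA IH.
by rewrite IH translate_coset.
Qed.

Lemma cosets_split p w u a s : cosets p w = u ++ a :: s ->
  exists w1 w2, [/\ w = w1 ++ (None, a.2) :: w2, cosets p w1 = u,
    a.1 = coset hs (p ++ down w1) & cosets (p ++ down w1) w2 = s].
Proof.
elim: w p u => [|[[g|] e] w IH] p u /=; first by case: u.
- move=> /IH[w1 [w2 [-> h1 h2 h3]]].
  exists ((Some g, e) :: w1), w2; split=> //=; first by rewrite h2 -catA.
  by rewrite -h3 -catA.
- case: u => [[<- <-]|b u [<- /IH[w1 [w2 [-> h1 h2 h3]]]]].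
    by exists [::], w; rewrite cats0.
  by exists ((None, e) :: w1), w2; split=> //=; rewrite h1.
Qed.

Lemma cosets_nil p w : cosets p w = [::] -> w = lift (down w).
Proof. by elim: w p => //= -[[g|] e] w IH p //= /IH {1}->. Qed.

Lemma pinch p w : ~~ reduced (cosets p w) -> exists w1 v w2 e,
  w = w1 ++ ((None, e) :: lift v ++ [:: (None, ~~ e)]) ++ w2 /\ subgroup hs v.
Proof.
case/cancelling_pair=> u [[X e] [s]].
move=> /cosets_split[w1 [w2 [-> _ /= -> ]]].
rewrite -[_ :: s]cat0s => /cosets_split[v' [w3 [-> /cosets_nil-> /= + _]]].
rewrite liftK => /coset_eq sv; exists w1, (down v'), w3, e; split.
  by rewrite /= -!catA.
apply: subgroup_eq sv; rewrite catA; apply: (@group_eq_catr _ _ _ [::]).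
exact: group_eq_invl.
Qed.

Lemma kill_pinch S v e : @kill adjoin S (commutator v) ->
  @kill adjoin S (commutator (inv_word v)) ->
  @kill adjoin S (((None, e) :: lift v ++ [:: (None, ~~ e)]) ++ @inv_word adjoin (lift v)).
Proof.
move=> k1 k2; rewrite -lift_inv; case: e => /=; last by rewrite -catA.
move: k2; rewrite /commutator inv_wordK => k2; rewrite -catA.
apply: (@kill_rot adjoin _ ((None, true) :: lift v)).
by rewrite -catA cat_cons.
Qed.

(** By invariance of [fred (cosets [::] w)], a word equal to 1 has a pinch as long as it contains
    the new letter. Pinches are removed one at a time inside a context of at most n letters, so
    their costs do not add up. *)
Theorem adjoin_kill n S w :
  (forall v, size v <= n -> group_eq v [::] -> kill S v) ->
  (forall h, size h <= n -> subgroup hs h -> @kill adjoin S (commutator h)) ->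
  size w <= n -> group_eq w [::] -> kill (S + n * 4) w.
Proof.
move=> kP kH; have [m] := ubnP (size w).
elim: m w => // m IH w /ltnSE lem len ew.
have [rc|] := boolP (reduced (cosets [::] w)).
  have := reduced_fred rc; rewrite (cosets_group_eq ew) /= => /esym /cosets_nil ->.
  apply: (@kill_leq _ S); first exact: leq_addr.
  apply: kill_lift; apply: kP; first by rewrite (leq_trans (size_down w)).
  exact: (down_group_eq ew).
case/pinch=> w1 [v [w2 [e [E sv]]]]; subst w.
move: lem len; rewrite !size_cat /= size_cat /= size_lift => lem len.
have lev : size v <= n by slia.
have kc := @kill_pinch S v e (kH _ lev sv).
have {}kc := kc (kH (inv_word v) _ (subgroup_inv sv)).
rewrite size_inv in kc; have {}kc := kc lev.
have kv : @kill adjoin (S + n * 4) (w1 ++ lift v ++ w2).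
  apply: IH; rewrite ?size_cat ?size_lift; try slia.
  apply: group_eq_trans ew; apply: group_eq_catl; apply: group_eq_catr.
  exact/group_eq_sym/group_eq_mulV/(kill_group_eq kc).
have := conv_of_kill kc (leqnn _) kv; apply: kill_leq.
by rewrite /= size_cat /= size_lift; slia.
Qed.

Lemma kill_commutator_gen h : h \in hs -> @kill adjoin (size h).+1.*2 (commutator h).
Proof.
move=> hP; rewrite -size_commutator; apply: kill_conv0; apply: conv_rel.
by rewrite mem_cat; apply/orP; right; exact: map_f.
Qed.

Lemma kill_commutator_inv S h :
  @kill adjoin S (commutator h) -> @kill adjoin S (commutator (inv_word h)).
Proof.
move=> /kill_inv k.
have -> : commutator (inv_word h) =
    ((None, false) :: lift (inv_word h) ++ [:: (None, true)]) ++ lift h.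
  by rewrite /commutator inv_wordK /= -catA.
apply: kill_rot; move: k; rewrite /commutator inv_cons inv_cat inv_cons -!lift_inv inv_wordK.
by rewrite -!catA.
Qed.

Lemma kill_commutator_eq s S S' h h' : kill s (h ++ inv_word h') ->
  @kill adjoin S (commutator h') -> S <= S' -> s * 2 + size h * 8 + size h' * 8 + 4 <= S' ->
  @kill adjoin S' (commutator h).
Proof.
move=> k kc le1 le2.
have c1 : @conv adjoin (s + size h * 2 + size h' * 2) (lift h) (lift h').
  apply: (@conv_of_kill adjoin s); last by rewrite !size_lift; slia.
  by rewrite -lift_inv -lift_cat; exact: kill_lift.
have c2 : @conv adjoin (s + size h * 2 + size h' * 2) (lift (inv_word h)) (lift (inv_word h')).
  apply: (@conv_of_kill adjoin s); last by rewrite !size_lift !size_inv; slia.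
  rewrite -lift_inv -lift_cat inv_wordK; apply: kill_lift; apply: kill_rot.
  by have := kill_inv k; rewrite inv_cat inv_wordK.
apply: kill_convW _ (kill_leq le1 kc).
apply: (@conv_trans adjoin _ _ ((None, false) :: lift h' ++ (None, true) :: lift (inv_word h))).
  apply: (@conv_at adjoin _ _ [:: (None, false)] ((None, true) :: lift (inv_word h))
    _ _ _ _ c1) => //.
  by rewrite /= size_lift size_inv; slia.
apply: (@conv_at adjoin _ _ ((None, false) :: lift h' ++ [:: (None, true)]) [::] _ _ _ _ c2).
- by rewrite cats0 /= -catA.
- by rewrite cats0 /= -catA.
- by rewrite /= size_cat /= size_lift; slia.
Qed.

(* [k, h1 h2] = [k, h1] . h1 [k, h2] h1^-1 ; the first factor is removed before
   the second one, so that the spaces needed for long products do not add up. *)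
Lemma kill_commutator_cat S1 S2 S h1 h2 : @kill adjoin S1 (commutator h1) ->
  @kill adjoin S2 (commutator h2) -> S1 + size h1 * 4 + size h2 * 4 + 8 <= S -> S2 <= S ->
  @kill adjoin S (commutator (h1 ++ h2)).
Proof.
move=> k1 k2 le1 le2; pose w0 : word adjoin := lift h1 ++ [:: (None, false)].
have iw0 : inv_word w0 = (None, true) :: lift (inv_word h1).
  by rewrite inv_cat -lift_inv.
have cw0 := (@conv_invV adjoin _ w0 (leqnn _)).2.
have sw0 : size w0 = (size h1).+1 by rewrite size_cat size_lift /=; slia.
apply: (@kill_convW adjoin _ _ (commutator h1 ++ lift h1 ++ commutator h2 ++ lift (inv_word h1))).
  apply: (@conv_at adjoin _ _ ((None, false) :: lift h1)
    (lift h2 ++ (None, true) :: lift (inv_word (h1 ++ h2))) _ _ _ _ cw0).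
  - by rewrite /commutator lift_cat /= -catA.
  - by rewrite iw0 /w0 /commutator inv_cat !lift_cat /= -?catA /= -?catA /=.
  - rewrite sw0 /= size_cat /= !size_lift size_inv size_cat; slia.
rewrite -[commutator h1 ++ _]cat0s.
apply: (@kill_context adjoin S1 S S [::] (commutator h1) _ k1) => //; last first.
  rewrite !size_cat size_commutator /= !size_lift size_inv; slia.
rewrite cat0s; apply: kill_rot; rewrite -catA.
have [cV _] := @conv_invV adjoin _ (lift h1) (leqnn _); rewrite -lift_inv in cV.
apply: kill_convW _ (kill_leq le2 k2).
apply: (@conv_at adjoin _ _ (commutator h2) [::] _ _ _ _ cV); rewrite ?cats0 //.
by rewrite size_commutator size_lift /=; slia.
Qed.

(** The new letter is carried through [h] at both ends by means of the commutator with [h], which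
    leaves a conjugate of [commutator x]. The bound is a maximum involving [S], so conjugations can
    be iterated along arbitrarily long paths. *)
Lemma kill_commutator_conj Sh S S' h x : @kill adjoin Sh (commutator h) ->
  @kill adjoin S (commutator x) -> S <= S' -> Sh + size h * 8 + size x * 4 + 8 <= S' ->
  @kill adjoin S' (commutator (h ++ x ++ inv_word h)).
Proof.
move=> kh kx le1 le2; have khV := kill_commutator_inv kh.
have c1 : @conv adjoin (Sh + (size h).+1 * 3) ((None, false) :: lift h)
    (lift h ++ [:: (None, false)]).
  apply: (@conv_of_kill adjoin Sh); last by rewrite /= size_cat /= size_lift; slia.
  by rewrite inv_cat -lift_inv.
have c2 : @conv adjoin (Sh + (size h).+1 * 3) (lift (inv_word h) ++ [:: (None, true)])
    ((None, true) :: lift (inv_word h)).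
  apply: (@conv_of_kill adjoin Sh); last by rewrite /= size_cat /= size_lift size_inv; slia.
  rewrite inv_cons -lift_inv inv_wordK catA; apply: kill_rot.
  by move: khV; rewrite /commutator inv_wordK /= -!catA.
have sl := size_lift h; have slV : size (lift (inv_word h)) = size h by rewrite size_lift size_inv.
have sx := size_lift x; have sxV : size (lift (inv_word x)) = size x by rewrite size_lift size_inv.
have -> : commutator (h ++ x ++ inv_word h) =
    ((None, false) :: lift h) ++ lift x ++ (lift (inv_word h) ++ [:: (None, true)]) ++
    lift h ++ lift (inv_word x) ++ lift (inv_word h).
  by rewrite /commutator !lift_cat !inv_cat inv_wordK !lift_cat /= -!catA.
apply: (@kill_convW adjoin _ _ ((lift h ++ [:: (None, false)]) ++ lift x ++
    (lift (inv_word h) ++ [:: (None, true)]) ++ lift h ++ lift (inv_word x) ++ lift (inv_word h))).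
  apply: (conv_catr c1); rewrite !size_cat /=; slia.
apply: (@kill_convW adjoin _ _ ((lift h ++ [:: (None, false)]) ++ lift x ++
    ((None, true) :: lift (inv_word h)) ++ lift h ++ lift (inv_word x) ++ lift (inv_word h))).
  apply: (@conv_at adjoin _ _ ((lift h ++ [:: (None, false)]) ++ lift x)
    (lift h ++ lift (inv_word x) ++ lift (inv_word h)) _ _ _ _ c2).
  - by rewrite -?catA.
  - by rewrite -?catA.
  - by rewrite !size_cat /=; slia.
have [cV _] := @conv_invV adjoin _ (lift h) (leqnn _); rewrite -lift_inv in cV.
apply: (@kill_convW adjoin _ _ (lift h ++ commutator x ++ lift (inv_word h))).
  apply: (@conv_at adjoin _ _ ((lift h ++ [:: (None, false)]) ++ lift x ++ [:: (None, true)])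
    (lift (inv_word x) ++ lift (inv_word h)) _ _ _ _ cV).
  - by rewrite /= -?catA /= -?catA.
  - by rewrite /commutator /= -?catA /= -?catA.
  - by rewrite !size_cat /=; slia.
apply: kill_rot; rewrite -catA; apply: kill_convW (kill_leq le1 kx).
apply: (@conv_at adjoin _ _ (commutator x) [::] _ _ _ _ cV); rewrite ?cats0 //.
by rewrite size_commutator /=; slia.
Qed.

Lemma kill_commutator_flatten Sh (s : seq (word P)) :
  (forall h, h \in s -> @kill adjoin Sh (commutator h)) ->
  @kill adjoin (Sh + size (flatten s) * 4 + 8) (commutator (flatten s)).
Proof.
elim: s => [_|h s IH kh]; last rewrite -[flatten (h :: s)]/(h ++ flatten s).
  apply: (@kill_leq adjoin 2); first by slia.
  by apply: kill_conv0; apply: (conv_remove (@elementary_inv adjoin (None, false))).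
apply: (kill_commutator_cat (kh _ (mem_head _ _)) (IH _)); rewrite ?size_cat.
- by move=> h1 h1P; apply: kh; rewrite inE h1P orbT.
all: by slia.
Qed.

End Adjoin.

Lemma map_eq_cat (T U : Type) (f : T -> U) (l : seq T) (u v : seq U) :
  map f l = u ++ v -> exists l1 l2, [/\ l = l1 ++ l2, map f l1 = u & map f l2 = v].
Proof.
move=> e; exists (take (size u) l), (drop (size u) l).
by rewrite cat_take_drop map_take map_drop e take_size_cat // drop_size_cat.
Qed.

(** * Consequences of removing a commutator in bounded space *)

Section AdjoinLower.

Variables (P : presentation) (hs : seq (word P)) (s : nat).
(** An approximation to the subgroup generated by [hs], as far as space [s] can see it: closure
    under quotients is asked for elements of length at most [s] only. *)
Variable V : word P -> Prop.
Hypothesis V_eq : forall a b, group_eq a b -> V a -> V b.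
Hypothesis V_nil : V [::].
Hypothesis V_gen : forall h, h \in hs -> V h /\ V (inv_word h).
Hypothesis V_div : forall a b c, size a <= s -> size b <= s -> size c <= s ->
  V a -> V b -> group_eq c (inv_word a ++ b) -> V c.

Implicit Types (g p x y z : word P) (w u v : word (adjoin hs)) (X Y Z : set (word P)).

Definition class p : set (word P) := fun y => group_eq p y.

Lemma class_eq p p' : class p = class p' <-> group_eq p p'.
Proof.
split=> [e|e]; first by rewrite -/(class p p') e; exact: group_eq_refl.
rewrite predeqE => y; split=> h; last exact: group_eq_trans h.
by apply: group_eq_trans h; apply: group_eq_sym.
Qed.

(** Unlike in [cosets], the position of a stable letter is kept as a group element: [V] need not be
    a subgroup, so there are no cosets to reduce to. *)
Fixpoint marks p w : seq (set (word P) * bool) :=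
  match w with
  | [::] => [::]
  | (None, e) :: w' => (class p, e) :: marks p w'
  | (Some g, e) :: w' => marks (p ++ [:: (g, e)]) w'
  end.

Lemma marks_cat p u v : marks p (u ++ v) = marks p u ++ marks (p ++ down u) v.
Proof.
elim: u p => [|[[g|] e] u IH] p /=; first by rewrite cats0.
- by rewrite IH -catA.
- by rewrite IH.
Qed.

Lemma marks_lift p y : marks p (lift y) = [::].
Proof. by elim: y p => //= a y IH p. Qed.

Lemma marks_eq p p' w : group_eq p p' -> marks p w = marks p' w.
Proof.
elim: w p p' => [//|[[g|] e] w IH] p p' ep /=.
- by apply: IH; apply: group_eq_catr.
- by rewrite (class_eq p p').2 // (IH _ _ ep).
Qed.

Lemma marks_mem p w X : X \in unzip1 (marks p w) ->
  exists u v, w = u ++ v /\ X = class (p ++ down u).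
Proof.
elim: w p => [//|[[g|] e] w IH] p /=.
- move=> /IH[u [v [-> ->]]]; exists ((Some g, e) :: u), v; split=> //=.
  by rewrite -catA.
- rewrite inE => /orP[/eqP->|/IH[u [v [-> ->]]]].
    by exists [::], ((None, e) :: w); rewrite cats0.
  by exists ((None, e) :: u), v.
Qed.

Definition close X Y := exists x y, [/\ X = class x, Y = class y & V (inv_word x ++ y)].

Lemma close_class x y : close (class x) (class y) <-> V (inv_word x ++ y).
Proof.
split=> [[x' [y' [/class_eq ex /class_eq ey]]]|]; last by exists x, y.
by apply: V_eq; apply: group_eq_cat; [apply: group_eq_inv_word|]; exact: group_eq_sym.
Qed.

Lemma close_refl x : close (class x) (class x).
Proof.
by apply/close_class; apply: V_eq V_nil; exact/group_eq_sym/group_eq_invl.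
Qed.

(** Two stable letters of [w] are separated by a subword of [w], which represents the quotient of
    their positions up to inversion. *)
Lemma marks_short w X Y x y : X \in unzip1 (marks [::] w) ->
  Y \in unzip1 (marks [::] w) -> X = class x -> Y = class y ->
  exists2 z, size z <= size w & group_eq z (inv_word x ++ y).
Proof.
move=> /marks_mem[u [v [-> ->]]] /marks_mem[u' [v' [e ->]]] /class_eq ex /class_eq ey.
have H (T : Type) (a b c d : seq T) : a ++ b = c ++ d -> size a <= size c ->
    exists z : seq T, c = a ++ z /\ size z <= size (a ++ b).
  move=> E lea; exists (drop (size a) c); split; last first.
    by rewrite E size_drop size_cat; slia.
  rewrite -{1}[c](cat_take_drop (size a)); congr cat.
  have := congr1 (take (size a)) E; rewrite take_size_cat // takel_cat //.
have e1 : group_eq (inv_word (down u) ++ down u') (inv_word x ++ y).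
  by apply: group_eq_cat => //; exact: group_eq_inv_word.
have [le|/ltnW le] := leqP (size u) (size u').
- have [z [E ez]] := H _ _ _ _ _ e le; exists (down z).
    exact: leq_trans (size_down z) ez.
  apply: group_eq_trans e1; rewrite E down_cat catA.
  by apply: group_eq_sym; apply: (@group_eq_catr _ _ _ [::]); exact: group_eq_invl.
- have [z [E ez]] := H _ _ _ _ _ (esym e) le; exists (inv_word (down z)).
    by rewrite size_inv e; exact: leq_trans (size_down z) ez.
  apply: group_eq_trans e1; rewrite E down_cat inv_cat -catA -[X in group_eq X]cats0.
  by apply: group_eq_catl; exact/group_eq_sym/group_eq_invl.
Qed.

(** This stands in for transitivity of the coset relation; it is available only for positions in one
    word of length at most [s]. *)
Lemma close_euclid w X Y Z : size w <= s -> X \in unzip1 (marks [::] w) ->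
  Y \in unzip1 (marks [::] w) -> Z \in unzip1 (marks [::] w) ->
  close X Y -> close X Z -> close Y Z.
Proof.
move=> les mX mY mZ [x [y [eX eY Vxy]]] [x' [z [eX' eZ Vxz]]].
have [a lea ea] := marks_short mX mY eX eY.
have [b leb eb] := marks_short mX mZ eX' eZ.
have [c lec ec] := marks_short mY mZ eY eZ.
rewrite eY eZ; apply/close_class; apply: (V_eq ec).
apply: (@V_div a b c); try exact: leq_trans les.
- by apply: V_eq Vxy; exact: group_eq_sym.
- by apply: V_eq Vxz; exact: group_eq_sym.
- apply: (group_eq_trans ec); apply: group_eq_sym.
  apply: (group_eq_trans (group_eq_cat (group_eq_inv_word ea) eb)).
  rewrite inv_cat inv_wordK -catA; apply: group_eq_catl; rewrite catA.
  apply: (@group_eq_catr _ _ _ [::]); apply/group_eq_mulV.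
  by move: eX eX'; rewrite -class_eq => -> ->.
Qed.

(* A planar matching of the stable letters is encoded by colours: letters of
   the same colour are joined by an element of [V], and the sequence of
   coloured letters is freely trivial. *)
Definition valid w := group_eq (down w) [::] /\
  exists L : seq (nat * (set (word P) * bool)),
  [/\ map snd L = marks [::] w, fred [seq (a.1, a.2.2) | a <- L] = [::] &
      forall a b, a \in L -> b \in L -> a.1 = b.1 -> close a.2.1 b.2.1].

Lemma mark_mem p w (L : seq (nat * (set (word P) * bool))) a :
  map snd L = marks p w -> a \in L -> a.2.1 \in unzip1 (marks p w).
Proof. by move=> <- aL; rewrite /unzip1 -map_comp; exact: (map_f (fst \o snd)). Qed.

Lemma elementary_marks (x : word (adjoin hs)) : elementary_subword x ->
  group_eq (down x) [::] /\ forall p, marks p x = [::] \/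
    exists y z e, [/\ marks p x = [:: (class y, e); (class z, ~~ e)],
      close (class y) (class z) & close (class z) (class y)].
Proof.
move=> ex; split; first exact: (down_group_eq (elementary_group_eq ex)).
have comm h p : h \in hs -> close (class p) (class (p ++ h)) /\
    close (class (p ++ h)) (class p).
  move=> /V_gen[Vh VhV]; split; apply/close_class.
    apply: V_eq Vh; rewrite catA; apply: (@group_eq_catr _ _ [::]).
    exact/group_eq_sym/group_eq_invl.
  apply: V_eq VhV; rewrite inv_cat -catA -[X in group_eq X]cats0.
  exact/group_eq_catl/group_eq_sym/group_eq_invl.
case: ex => [[[g|] e] p|r|r] /=; first by left.
- by right; exists p, p, e; split=> //; exact: close_refl.
- rewrite mem_cat => /orP[/mapP[y _ ->] p|/mapP[h hP ->] p].
    by left; exact: marks_lift.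
  right; have [c1 c2] := comm h p hP; exists p, (p ++ h), false.
  by rewrite /commutator /= marks_cat marks_lift liftK /= marks_lift.
- rewrite mem_cat => /orP[/mapP[y _ ->] p|/mapP[h hP ->] p].
    by left; rewrite -lift_inv; exact: marks_lift.
  right; have [c1 c2] := comm h p hP; exists (p ++ h), p, false.
  rewrite /commutator inv_cons inv_cat inv_cons -!lift_inv inv_wordK -!catA.
  rewrite marks_cat marks_lift liftK /= marks_cat marks_lift liftK /=.
  split=> //; congr [:: _; (_, _)]; apply/class_eq.
  rewrite -catA -[X in group_eq _ X]cats0; apply: group_eq_catl; exact: group_eq_invr.
Qed.

Lemma marks_context p u (x : word (adjoin hs)) v : group_eq (down x) [::] ->
  marks p (u ++ x ++ v) = marks p u ++ marks (p ++ down u) x ++ marks (p ++ down u) v.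
Proof.
move=> ex; rewrite !marks_cat -catA; congr (_ ++ (_ ++ _)).
apply: marks_eq; rewrite -[X in group_eq _ X]cats0 -!catA.
do 2!apply: group_eq_catl; exact: ex.
Qed.

(** Validity is carried from the empty sequence back to the start, so this is the case of an
    insertion. If the removed pair has two colours, both colour classes are merged through it, and
    here the bound on the length enters. *)
Lemma valid_remove u (x : word (adjoin hs)) v : elementary_subword x -> size (u ++ x ++ v) <= s ->
  valid (u ++ x ++ v) -> valid (u ++ v).
Proof.
move=> ex les [e1 [L [eL fL cL]]]; have [edx mx] := elementary_marks ex.
have mm := mark_mem eL.
split.
  apply: group_eq_trans e1; rewrite !down_cat; apply: group_eq_sym.
  exact: group_eq_context.
move: (eL); rewrite marks_context // => /map_eq_cat.
move=> [LA [L' [EL eA /map_eq_cat[LM [LB [EL' eM eB]]]]]].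
subst L' L; have {mx} := mx ([::] ++ down u); rewrite -eM.
case=> [e|[x1 [x2 [e [+ cXY cYX]]]]].
  have LM0 : LM = [::] by case: LM {eL eM fL cL mm} e.
  subst LM; exists (LA ++ LB).
  by split; [rewrite map_cat eA eB marks_cat|exact: fL|exact: cL].
case: LM eL eM fL cL mm => [|[c1 [? ?]] [|[c2 [? ?]] []]] //= eL eM fL cL mm [] ? ? ? ? ; subst.
set X := class x1 in cXY cYX eL cL mm; set Y := class x2 in cXY cYX eL cL mm.
(* Renaming c2 to c1 keeps the coloured word freely trivial and turns the removed pair into a
   cancelling one. *)
pose f c := if c == c2 then c1 else c.
have fc1 : f c1 = c1 by rewrite /f; case: ifP.
have fc2 : f c2 = c1 by rewrite /f eqxx.
set L := LA ++ _ in eL fL cL mm.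
have [LX LY] : (c1, (X, e)) \in L /\ (c2, (Y, ~~ e)) \in L.
  by rewrite !mem_cat !inE !eqxx /= !orbT.
have sub a : a \in LA ++ LB -> a \in L.
  by rewrite !(mem_cat, inE) => /orP[->//|->]; rewrite !orbT.
exists [seq (f a.1, a.2) | a <- LA ++ LB]; split.
- by rewrite -map_comp /= map_cat eA eB marks_cat.
- have := fred_map f fL; rewrite -!map_comp !map_cat /= fc1 fc2.
  by rewrite (fred_cancel _ (c1, e)).
- have toX a : a \in L -> f a.1 = c1 -> close X a.2.1.
    move=> aL; rewrite /f; case: eqP => [Ea _|_ Ea]; last first.
      by apply: (cL (c1, (X, e)) a) => //=; rewrite Ea.
    apply: (close_euclid les (mm _ LY) (mm _ LX) (mm _ aL) cYX).
    exact: (cL (c2, (Y, ~~ e)) a).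
  move=> a b /mapP[a' /sub aL ->] /mapP[b' /sub bL ->] /= Ef.
  have [Ea|Ea] := eqVneq (f a'.1) c1.
    apply: (close_euclid les (mm _ LX) (mm _ aL) (mm _ bL)); apply: toX => //.
    by rewrite -Ef.
  apply: cL => //; move: Ef Ea; rewrite /f.
  by case: eqP => [_ _|_]; [rewrite eqxx|case: eqP => // _ ->; rewrite eqxx].
Qed.

(** Even and odd numbers keep the colours of two matchings apart. *)
Definition recolour (k : nat) (a : nat * (set (word P) * bool)) := (a.1.*2 + k, a.2).

Lemma valid_insert u (x : word (adjoin hs)) v : elementary_subword x ->
  valid (u ++ v) -> valid (u ++ x ++ v).
Proof.
move=> ex [e1 [L [+ fL cL]]]; have [edx mx] := elementary_marks ex.
rewrite marks_cat => /map_eq_cat[LA [LB [EL eA eB]]]; subst L.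
split.
  by apply: group_eq_trans e1; rewrite !down_cat; exact: group_eq_context.
case: (mx ([::] ++ down u)) => [e|[x1 [x2 [e [e' cXY cYX]]]]].
  by exists (LA ++ LB); split=> //; rewrite marks_context // map_cat eA eB e.
pose LM := [:: (1, (class x1, e)); (1, (class x2, ~~ e))].
exists (map (recolour 0) LA ++ LM ++ map (recolour 0) LB); split.
- by rewrite marks_context // !map_cat -!map_comp /= -eA -eB e'.
- rewrite !map_cat (fred_cancel _ (1, e)).
  rewrite -!map_comp -map_cat; have := fred_map (fun c => c.*2 + 0) fL.
  by rewrite -map_comp.
- have H a : a \in map (recolour 0) LA ++ LM ++ map (recolour 0) LB ->
      (exists2 a', a' \in LA ++ LB & a = recolour 0 a') \/ a \in LM.
    rewrite !mem_cat => /or3P[/mapP[a' aL ->]|->|/mapP[a' aL ->]]; [left|by right|left].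
      by exists a' => //; rewrite mem_cat aL.
    by exists a' => //; rewrite mem_cat aL orbT.
  have odd1 a : a \in LM -> odd a.1 by rewrite !inE => /orP[]/eqP->.
  move=> a b /H[[a' aL ->]|aM] /H[[b' bL ->]|bM] eab.
  + by apply: (cL a' b') => //; move: eab => /=; slia.
  + by have := odd1 _ bM; rewrite -eab /= addn0 odd_double.
  + by have := odd1 _ aM; rewrite eab /= addn0 odd_double.
  + move: aM bM; rewrite !inE => /orP[]/eqP-> /orP[]/eqP-> //=; exact: close_refl.
Qed.

Lemma translate_class g p : translate g (class p) = class (g ++ p).
Proof.
rewrite predeqE => y; rewrite /translate /class; split=> e.
  apply: (group_eq_trans (group_eq_catl _ e)); rewrite catA.
  apply: (@group_eq_catr _ _ _ [::]); exact: group_eq_invr.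
apply: (@group_eq_trans _ _ (inv_word g ++ g ++ p)); last exact: group_eq_catl.
rewrite catA; apply: (@group_eq_catr _ _ [::]); exact/group_eq_sym/group_eq_invl.
Qed.

Lemma marks_translate g p w : marks (g ++ p) w = [seq (translate g a.1, a.2) | a <- marks p w].
Proof.
elim: w p => [//|[[x|] e] w IH] p /=; first by rewrite -catA.
by rewrite translate_class IH.
Qed.

Lemma close_translate g X Y : close X Y -> close (translate g X) (translate g Y).
Proof.
case=> x [y [-> -> Vxy]]; rewrite !translate_class; apply/close_class; apply: V_eq Vxy.
rewrite inv_cat -catA; apply: group_eq_catl; rewrite catA.
apply: (@group_eq_catr _ _ [::]); exact/group_eq_sym/group_eq_invl.
Qed.

Lemma valid_rot u v : valid (v ++ u) -> valid (u ++ v).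
Proof.
case=> [e1 [L [+ fL cL]]]; rewrite marks_cat => /map_eq_cat[LA [LB [EL eA eB]]].
subst L; have e2 : group_eq (down u ++ down v) [::].
  by apply: group_eq_rot; rewrite -down_cat.
split; first by rewrite down_cat.
pose f (a : nat * (set (word P) * bool)) := (a.1, (translate (down u) a.2.1, a.2.2)).
exists (map f (LB ++ LA)); split.
- rewrite marks_cat map_cat map_cat -!map_comp; congr (_ ++ _).
    rewrite -[f]/f (eq_map (g := (fun a => (translate (down u) a.1, a.2)) \o snd)) //.
    rewrite map_comp eB -marks_translate; apply: marks_eq.
    by rewrite cat0s.
  rewrite (eq_map (g := (fun a => (translate (down u) a.1, a.2)) \o snd)) //.
  rewrite map_comp eA -marks_translate; apply: marks_eq.
  by rewrite cats0 cat0s; exact: group_eq_refl.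
- by rewrite -map_comp map_cat fred_rot // -map_cat.
- move=> a b /mapP[a' aL ->] /mapP[b' bL ->] /= eab.
  apply: close_translate; apply: (cL a' b') => //.
    by move: aL; rewrite !mem_cat orbC.
  by move: bL; rewrite !mem_cat orbC.
Qed.

Lemma valid_cat u v : valid u -> valid v -> valid (u ++ v).
Proof.
case=> [e1 [L [eL fL cL]]] [e2 [L' [eL' fL' cL']]].
split; first by rewrite down_cat; exact: (@group_eq_cat _ _ [::] _ [::]).
exists (map (recolour 0) L ++ map (recolour 1) L'); split.
- rewrite map_cat -!map_comp marks_cat -eL; congr (_ ++ _).
  by rewrite (marks_eq _ (p' := [::])).
- have f0 := fred_map (fun c => c.*2 + 0) fL; have f1 := fred_map (fun c => c.*2 + 1) fL'.
  rewrite -map_comp in f0; rewrite -map_comp in f1.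
  by rewrite map_cat fred_cat -!map_comp [X in X ++ _]f0 [X in _ ++ X]f1.
- move=> a b; rewrite !mem_cat => /orP[]/mapP[a' aL ->] /orP[]/mapP[b' bL ->] /= eab.
  + by apply: (cL a' b') => //; move: (congr1 half eab); rewrite !addn0 !doubleK.
  + by move: (congr1 odd eab); rewrite addn0 addn1 /= !odd_double.
  + by move: (congr1 odd eab); rewrite addn0 addn1 /= !odd_double.
  + apply: (cL' a' b') => //; move: (congr1 uphalf eab).
    by rewrite !addn1 !uphalf_half /= !odd_double /= !uphalf_double => -[].
Qed.

Lemma kills_valid W : kills s W -> forall w, w \in W -> valid w.
Proof.
elim=> // W0 W' _ st kW IH u; case: st kW IH => W1 w U W2 st kW IH.
rewrite mem_cat inE => /or3P[uW|/eqP->|uW].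
- by apply: IH; rewrite mem_cat uW.
- have IHU v : v \in U -> valid v /\ size v <= s.
    move=> vU; split; first by apply: IH; rewrite !mem_cat vU orbT.
    have := kills_total_length kW; rewrite !total_length_cat.
    by rewrite {2}/total_length (big_rem v) //=; slia.
  case: st IHU => {w U IH kW} [p q x ex|p q x ex|p q|p q|] IHU.
  + by have [] := IHU _ (mem_head _ _) => h1 h2; apply: valid_remove h1.
  + by apply: valid_insert => //; exact: (IHU _ (mem_head _ _)).1.
  + exact/valid_rot/(IHU _ (mem_head _ _)).1.
  + by apply: valid_cat; apply: (IHU _ _).1; rewrite !inE eqxx ?orbT.
  + by split; [exact: group_eq_refl|exists [::]].
- by apply: IH; rewrite !mem_cat uW !orbT.
Qed.

(** The commutator has only two stable letters, at the positions 1 and h; since the coloured word is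
    freely trivial, they have the same colour. *)
Theorem adjoin_kill_commutator h : @kill (adjoin hs) s (commutator h) -> V h.
Proof.
move=> k; have [_ [L [eL fL cL]]] := kills_valid k (mem_head _ _).
move: eL fL cL; rewrite /commutator /= marks_cat marks_lift /= marks_lift liftK.
case: L => [|[c1 [X1 e1]] [|[c2 [X2 e2]] [|]]] //= [-> -> -> ->].
case: eqP => //= -[->] _ /(_ (c1, (class [::], false)) (c1, (class h, true))).
by rewrite !inE !eqxx orbT => /(_ isT isT erefl) /close_class.
Qed.

End AdjoinLower.

(** * The tower over Z^I *)

Section Tower.

(** [M l e] and [M l (~~ e)] are diagonal matrices with x^(M l e u) l^e = l^e x^(M l (~~ e) u),
    which gives an HNN extension of Z^I with stable letters [L]; the sign [true] marks the inverse
    letter. *)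
Variables (I L : finType) (M : L -> bool -> I -> Z).
Hypothesis M_gt0 : forall l e i, (0 < M l e i)%Z.

Definition vec := I -> Z.
Implicit Types (y z u c : vec) (l : L) (e b : bool) (i : I).

Definition zero : vec := fun _ => 0%Z.
Definition add z y : vec := fun i => (z i + y i)%Z.
Definition opp z : vec := fun i => (- z i)%Z.
Definition unit i (a : Z) : vec := fun j => if j == i then a else 0%Z.

Definition residue l e z : vec := fun i => (z i mod M l e i)%Z.
Definition quotient l e z : vec := fun i => (z i / M l e i)%Z.
Definition scale l e u : vec := fun i => (M l e i * u i)%Z.
Definition divides l e z := [forall i, (z i mod M l e i =? 0)%Z].

Lemma dividesP l e z : reflect (forall i, (z i mod M l e i = 0)%Z) (divides l e z).
Proof. by apply: (iffP forallP) => H i; apply/Z.eqb_eq; exact: H. Qed.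

Lemma divides_scale l e u : divides l e (scale l e u).
Proof. by apply/dividesP => i; rewrite /scale Z.mul_comm Z_mod_mult. Qed.

Lemma divides_quotient l e z : divides l e z -> scale l e (quotient l e z) = z.
Proof.
move/dividesP=> dz; apply/funext => i; rewrite /scale /quotient.
by have := Z.div_mod (z i) (M l e i); have := M_gt0 l e i; have := dz i; lia.
Qed.

Lemma residue_quotient l e z : z = add (residue l e z) (scale l e (quotient l e z)).
Proof.
apply/funext => i; rewrite /add /residue /scale /quotient.
by have := Z.div_mod (z i) (M l e i); have := M_gt0 l e i; lia.
Qed.

Lemma quotient_scale l e c u : residue l e c = c ->
  quotient l e (add c (scale l e u)) = u.
Proof.
move=> rc; apply/funext => i; rewrite /quotient /add /scale Z.mul_comm.
have M0 := M_gt0 l e i; rewrite Z.div_add; last by lia.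
have <- : (c i mod M l e i = c i)%Z by rewrite -[in RHS]rc.
by rewrite Zmod_div.
Qed.

Lemma residue_scale l e c u : residue l e (add c (scale l e u)) = residue l e c.
Proof.
by apply/funext => i; rewrite /residue /add /scale Z.mul_comm Z_mod_plus_full.
Qed.

Lemma residue_id l e z : residue l e (residue l e z) = residue l e z.
Proof. by apply/funext => i; rewrite /residue Zmod_mod. Qed.

Lemma divides_residue l e z : divides l e (residue l e z) = divides l e z.
Proof. by rewrite /divides; apply: eq_forallb => i; rewrite /residue Zmod_mod. Qed.

Lemma divides_add_scale l e c u :
  divides l e (add c (scale l e u)) = divides l e c.
Proof. by rewrite -[LHS]divides_residue residue_scale divides_residue. Qed.

Lemma add0v z : add zero z = z.
Proof. by apply/funext => i; rewrite /add /zero; lia. Qed.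

Lemma addv0 z : add z zero = z.
Proof. by apply/funext => i; rewrite /add /zero; lia. Qed.

Lemma addvA z y u : add z (add y u) = add (add z y) u.
Proof. by apply/funext => i; rewrite /add; lia. Qed.

Lemma addvC z y : add z y = add y z.
Proof. by apply/funext => i; rewrite /add; lia. Qed.

Definition xletter (a : I * bool) : (I + L) * bool := (inl a.1, a.2).
Definition tletter l e : (I + L) * bool := (inr l, e).
Definition block i (a : Z) : seq ((I + L) * bool) :=
  nseq (Z.abs_nat a) (xletter (i, (a <? 0)%Z)).
Definition xword z : seq ((I + L) * bool) := flatten [seq block i (z i) | i <- enum I].

(* All sign patterns are listed, so that every shift of a relator that is
   needed below is itself a relator. *)
Definition tower_group : presentation :=
  @Presentation (I + L)%type
    ([seq [:: xletter a.1; xletter a.2; xletter (a.1.1, ~~ a.1.2); xletter (a.2.1, ~~ a.2.2)]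
        | a <- enum {: (I * bool) * (I * bool)}] ++
     [seq let: (l, e, i, d) := a in
        block i (if d then - M l e i else M l e i)%Z ++ tletter l e ::
        block i (if d then M l (~~ e) i else - M l (~~ e) i)%Z ++ [:: tletter l (~~ e)]
        | a <- enum {: L * bool * I * bool}]).

Local Notation D := tower_group.
Implicit Types w : word D.

(* The pair [(st, z)] stands for the word [stack_word st ++ x^z]; the group acts by
   multiplication on the right. *)
Definition nf : Type := (seq (vec * L * bool) * vec)%type.

(** With z = c + M u and c the residue, x^z l = x^c l x^(M' u), where M and M' are the two moduli of
    l. The letter cancels against the top of the stack exactly when that is the inverse letter and c
    = 0. *)
Definition act (st : nf) (a : signed_letter D) : nf :=
  match a with
  | (inl i, b) => (st.1, add st.2 (unit i (if b then -1 else 1)%Z))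
  | (inr l, e) =>
    let push := ((residue l e st.2, l, e) :: st.1, scale l (~~ e) (quotient l e st.2)) in
    if st.1 is (c, l', e') :: st' then
      if [&& l' == l, e' == ~~ e & divides l e st.2]
      then (st', add c (scale l (~~ e) (quotient l e st.2)))
      else push
    else push
  end.

Definition acts (st : nf) w : nf := foldl act st w.

Lemma acts_cat st w w' : acts st (w ++ w') = acts (acts st w) w'.
Proof. exact: foldl_cat. Qed.

Lemma acts1 st a : acts st [:: a] = act st a.
Proof. by []. Qed.

Fixpoint normal (st : seq (vec * L * bool)) : Prop :=
  if st is (c, l, e) :: st' then
    [/\ residue l e c = c,
        (if st' is (_, l', e') :: _
         then ~~ [&& l' == l, e' == ~~ e & divides l e c] else true) & normal st']
  else True.

Lemma act_normal st a : normal st.1 -> normal (act st a).1.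
Proof.
case: st => st z; case: a => [[i|l] e] //=.
case: st => [|[[c l'] e'] st] //=; first by rewrite residue_id.
case: ifPn => [_ []//|ne nst] /=; split=> //; first exact: residue_id.
by rewrite divides_residue.
Qed.

Lemma acts_normal st w : normal st.1 -> normal (acts st w).1.
Proof. by elim: w st => //= a w IH st nst; apply: IH; exact: act_normal. Qed.

(** As for free groups, letters permute the normal forms and, by [acts_relator], relators act
    trivially; this gives an invariant of group elements without a confluence argument. *)
Lemma act_inv st a : normal st.1 -> act (act st a) (inv_letter a) = st.
Proof.
case: st => st z; case: a => [[i|l] e]; rewrite /inv_letter.
  move=> _ /=; congr pair; apply/funext => j; rewrite /add /unit.
  by case: (j == i); case: e => /=; lia.
have push : act ((residue l e z, l, e) :: st, scale l (~~ e) (quotient l e z))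
    (inr l, ~~ e) = (st, z).
  rewrite /= eqxx negbK eqxx divides_scale /=; congr pair.
  have -> : quotient l (~~ e) (scale l (~~ e) (quotient l e z)) = quotient l e z.
    by rewrite -[scale _ _ _]add0v quotient_scale //; apply/funext.
  by rewrite -residue_quotient.
case: st push => [|[[c l'] e'] st] push nst; first exact: push.
rewrite [act _ (inr l, e)]/=; case: ifPn => [/and3P[/eqP El /eqP Ee dz]|_]; last exact: push.
subst l' e'; case: nst => rc top nst.
have E : scale l (~~ ~~ e) (quotient l e z) = z by rewrite negbK divides_quotient.
rewrite /= quotient_scale // residue_scale rc E divides_add_scale.
by case: st {push nst} top => [|[[c2 l2] e2] st] //= /negbTE->.
Qed.

Lemma acts_inv st w : normal st.1 -> acts st (w ++ inv_word w) = st.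
Proof.
elim: w st => [//|a w IH] st nst.
rewrite inv_cons -cat1s -catA [w ++ _]catA acts_cat acts_cat IH; last exact: act_normal.
exact: act_inv.
Qed.

Lemma acts_nseq st i b n : acts st (nseq n (xletter (i, b))) =
  (st.1, add st.2 (unit i (Z.of_nat n * if b then -1 else 1)%Z)).
Proof.
elim: n st => [|n IH] st.
  by case: st => st z /=; congr pair; apply/funext => j; rewrite /add /unit; case: (j == i); lia.
rewrite [LHS]IH /=; congr pair; apply/funext => j; rewrite /add /unit.
by case: (j == i); case: b {IH} => /=; lia.
Qed.

Lemma acts_block st i a : acts st (block i a) = (st.1, add st.2 (unit i a)).
Proof.
rewrite acts_nseq; congr (_, add _ (unit _ _)).
by case: Z.ltb_spec; lia.
Qed.

Lemma acts_xword st z : acts st (xword z) = (st.1, add st.2 z).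
Proof.
have E : forall (s : seq I) st', uniq s ->
    acts st' (flatten [seq block i (z i) | i <- s]) =
    (st'.1, add st'.2 (fun j => if j \in s then z j else 0%Z)).
  elim=> [|i s IH] st' /=.
    by case: st' => a b _; congr pair; apply/funext => j; rewrite /add /=; lia.
  case/andP=> ins us; rewrite acts_cat acts_block IH //=; congr pair.
  apply/funext => j; rewrite /add /unit inE; case: eqP => [->|_] /=; last by lia.
  by rewrite (negbTE ins); lia.
rewrite /xword E ?enum_uniq //; congr pair; apply/funext => j.
by rewrite /add mem_enum.
Qed.

Lemma inv_block i a : inv_word (block i a : word D) = block i (- a).
Proof.
rewrite /inv_word /block map_nseq; have -> : Z.abs_nat (- a) = Z.abs_nat a by lia.
rewrite rev_nseq; case: (Z.eq_dec a 0) => [->//|a0].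
by congr (nseq _ (_, _)); apply/idP/idP; do 2!case: Z.ltb_spec => //; lia.
Qed.

Lemma act_shift st l e (d : bool) i : normal st.1 ->
  act (acts st (block i (if d then - M l e i else M l e i)%Z)) (tletter l e) =
  acts (act st (tletter l e)) (block i (if d then - M l (~~ e) i else M l (~~ e) i)%Z).
Proof.
move=> _; pose u := unit i (if d then -1 else 1)%Z.
have H e' : unit i (if d then - M l e' i else M l e' i)%Z = scale l e' u.
  apply/funext => j; rewrite /scale /u /unit; case: eqP => [->|_]; last by lia.
  by case: (d); lia.
rewrite !acts_block !H; case: st => st z /=.
have Eq : quotient l e (add z (scale l e u)) = add (quotient l e z) u.
  apply/funext => j; rewrite /quotient /add /scale Z.mul_comm Z.div_add //.
  by have := M_gt0 l e j; lia.
have Es y : scale l (~~ e) (add y u) = add (scale l (~~ e) y) (scale l (~~ e) u).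
  by apply/funext => j; rewrite /scale /add; lia.
rewrite residue_scale divides_add_scale Eq Es.
by case: st => [|[[c l'] e'] st] //=; case: ifP => //=; rewrite addvA.
Qed.

Lemma acts_relator st r : r \in relators D -> normal st.1 -> acts st r = st.
Proof.
rewrite mem_cat => /orP[/mapP[[[i b] [j b']] _ ->] nst|/mapP[[[[l e] i] d] _ ->] nst].
  case: st nst => st z nst /=; congr pair.
  apply/funext => k; rewrite /add /unit.
  by case: (k == i); case: (k == j); case: b; case: b' => /=; lia.
set a := (if d then M l (~~ e) i else - M l (~~ e) i)%Z.
set a' := (if d then - M l (~~ e) i else M l (~~ e) i)%Z.
rewrite -[LHS]/(acts st (block i (if d then - M l e i else M l e i)%Z ++
  [:: tletter l e] ++ block i a ++ [:: tletter l (~~ e)])).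
rewrite !acts_cat !acts1 act_shift // (_ : a = - a')%Z; last by rewrite /a /a'; case: (d); lia.
rewrite -inv_block -acts_cat acts_inv; last exact: act_normal.
exact: act_inv.
Qed.

Lemma acts_group_eq w w' :
  group_eq w w' -> forall st, normal st.1 -> acts st w = acts st w'.
Proof.
elim=> {w w'} [u|u v _ IH|u v w _ IH1 _ IH2|u u' v v' _ IH1 _ IH2|a|r rP] st nst.
- by [].
- by rewrite IH.
- by rewrite IH1 // IH2.
- by rewrite !acts_cat IH1 // IH2 //; exact: acts_normal.
- exact: act_inv.
- exact: acts_relator.
Qed.

Definition value w : nf := acts ([::], zero) w.

Lemma value_group_eq w w' : group_eq w w' -> value w = value w'.
Proof. by move/acts_group_eq; apply. Qed.

Lemma value_xword z : value (xword z) = ([::], z).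
Proof. by rewrite /value acts_xword add0v. Qed.

Lemma size_value w : size (value w).1 <= size w.
Proof.
suff H st : size (acts st w).1 <= size st.1 + size w by have := H ([::], zero).
elim: w st => [|a w IH] st /=; first by rewrite addn0.
apply: leq_trans (IH _) _; rewrite addnS -addSn leq_add2r.
case: a st => [[i|l] e] [[|[[c l'] e'] st] z] //=.
by case: ifP => _ //=; rewrite ltnW.
Qed.

Definition syllables (s : seq (vec * L * bool)) : seq ((I + L) * bool) :=
  flatten [seq xword a.1.1 ++ [:: tletter a.1.2 a.2] | a <- s].

Definition britton (s : seq (vec * L * bool)) : bool :=
  sorted (fun p q : vec * L * bool =>
    ~~ [&& q.1.2 == p.1.2, q.2 == ~~ p.2 & divides q.1.2 q.2 q.1.1]) s.

Lemma syllables_rcons s a : syllables (rcons s a) =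
  syllables s ++ xword a.1.1 ++ [:: tletter a.1.2 a.2].
Proof. by rewrite /syllables map_rcons flatten_rcons. Qed.

(** Britton's lemma in the form that no stable letter cancels. After l^e has been pushed, the vector
    is a multiple of the modulus of the inverse letter, so whether the next letter cancels depends
    on its own exponent y alone. *)
Lemma value_syllables s z : britton s ->
  size (value (syllables s ++ xword z)).1 = size s.
Proof.
move=> bs; rewrite /value acts_cat acts_xword -/(value _) /=.
suff: size (value (syllables s)).1 = size s /\
    (forall a s', s = rcons s' a -> exists c st u,
       value (syllables s) = ((c, a.1.2, a.2) :: st, scale a.1.2 (~~ a.2) u)) by case.
elim/last_ind: s bs => [_|s [[y l] e] IH]; first by split=> // a [].
move=> bs; have bs' : britton s.
  by move: bs; rewrite /britton -cats1; case: (s) => // a s' /=; rewrite cat_path => /andP[].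
have [IH1 IH2] := IH bs'.
have [st [z' [E [Ez' nd]]]] : exists st z', [/\ value (syllables s) = (st, z'), size st = size s &
    (if st is (_, l', e') :: _ then
       ~~ [&& l' == l, e' == ~~ e & divides l e (add z' y)] else true)].
  case/lastP: s bs bs' {IH} IH1 IH2 => [|s [[y' l'] e']] bs bs' IH1 IH2.
    by exists [::], zero.
  have [c [st [u E]]] := IH2 _ _ erefl.
  exists ((c, l', e') :: st), (scale l' (~~ e') u); split=> //; first by rewrite -IH1 E.
  have : ~~ [&& l == l', e == ~~ e' & divides l e y].
    move: bs; rewrite /britton -!cats1 -catA; case: (s) => [|a s'] /=.
      by rewrite andbT.
    by rewrite cat_path /= andbT => /andP[_ /andP[]].
  apply: contra => /and3P[/eqP -> /eqP ->]; rewrite negbK !eqxx /=.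
  by rewrite addvC divides_add_scale.
have E' : value (syllables (rcons s (y, l, e))) = act (st, add z' y) (tletter l e).
  by rewrite syllables_rcons catA /value !acts_cat -/(value _) E acts_xword.
rewrite E' size_rcons; split=> [|a s'].
  by case: st Ez' nd {E E'} => [|[[c l'] e'] st] /= <- // /negbTE->.
move=> /rcons_inj[_ <-] /=.
case: st nd {Ez' E E'} => [|[[c l'] e'] st] /=; first by do 3!eexists.
by move/negbTE->; do 3!eexists.
Qed.

End Tower.

(** * Linear space for the tower *)

Section TowerSpace.

Variables (I L : finType) (M : L -> bool -> I -> Z).
Hypothesis M_gt0 : forall l e i, (0 < M l e i)%Z.
Variables (kappa : nat) (s0 : L).
Hypothesis M_le : forall l e i, (M l e i <= 2 ^ Z.of_nat kappa)%Z.
Hypothesis M_s0 : forall i, M s0 false i = 1%Z /\ M s0 true i = 2%Z.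

Local Notation D := (tower_group M).
Local Notation vec := (vec I).
Local Notation zero := (@zero I).
Local Notation unit := (@unit I).
Local Notation tl := (@tletter I L).
Local Notation xl := (@xletter I L).
Local Notation xw := (@xword I L).
Implicit Types (y z c : vec) (l : L) (e b : bool) (i : I) (u w : word D).

Definition bounded (k : nat) z : Prop := forall i, (Z.abs (z i) <= 2 ^ Z.of_nat k)%Z.

(** A letter scales the vector by at most [2 ^ kappa] and may add a bounded residue; the summand 1
    turns both into a single factor per letter, hence linearly many bits for a word. *)
Lemma act_bound st (a : signed_letter D) K : normal M st.1 ->
  (forall i, Z.abs (st.2 i) + 1 <= K)%Z ->
  forall i, (Z.abs ((act (M := M) st a).2 i) + 1 <= 2 ^ Z.of_nat kappa * 2 * K)%Z.
Proof.
case: st => st z /= nst bz i; have bzi := bz i.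
have k0 : (1 <= 2 ^ Z.of_nat kappa)%Z by have := Z.pow_pos_nonneg 2 (Z.of_nat kappa); lia.
have quo l e : (Z.abs (scale M l (~~ e) (quotient M l e z) i) <= 2 ^ Z.of_nat kappa * (K - 1))%Z.
  rewrite /scale /quotient; have M0 := M_gt0 l e i; have M1 := M_gt0 l (~~ e) i.
  have M2 := @M_le l (~~ e) i.
  have q : (Z.abs (z i / M l e i) <= K - 1)%Z.
    have := Z.div_mod (z i) (M l e i); have := Z.mod_pos_bound (z i) (M l e i).
    by nia.
  by rewrite Z.abs_mul; nia.
case: a => [[j|l] e] /=.
  by rewrite /add /unit; case: (i == j); case: e; nia.
have push : (Z.abs (scale M l (~~ e) (quotient M l e z) i) + 1 <= 2 ^ Z.of_nat kappa * 2 * K)%Z.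
  by have := quo l e; nia.
case: st nst => [|[[c l'] e'] st] nst //=; case: ifP => // /and3P[/eqP El /eqP Ee _] /=.
case: nst => rc _ _; have := quo l e; rewrite /add.
have : (0 <= c i < 2 ^ Z.of_nat kappa)%Z.
  rewrite -rc /residue; have := Z.mod_pos_bound (c i) (M l' e' i).
  by have := @M_le l' e' i; have := M_gt0 l' e' i; lia.
by nia.
Qed.

Lemma value_bounded w : bounded ((kappa + 1) * size w) (value w).2.
Proof.
suff H st K : normal M st.1 -> (forall i, Z.abs (st.2 i) + 1 <= K)%Z ->
    forall i, (Z.abs ((acts st w).2 i) + 1 <= 2 ^ Z.of_nat ((kappa + 1) * size w) * K)%Z.
  by move=> i; have := H ([::], zero) 1%Z Logic.I (fun _ => Z.le_refl 1) i; rewrite /value; lia.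
elim: w st K => [|a w IH] st K nst bst i.
  by rewrite muln0; have := bst i; rewrite -[(2 ^ _)%Z]/1%Z; case: (K).
have := IH _ _ (act_normal a nst) (@act_bound st a K nst bst) i.
rewrite /= mulnS Nat2Z.inj_add Z.pow_add_r; try lia.
have -> : (2 ^ Z.of_nat (kappa + 1) = 2 ^ Z.of_nat kappa * 2)%Z.
  by rewrite Nat2Z.inj_add Z.pow_add_r; lia.
by lia.
Qed.

Definition relator_bound : nat := \max_(r <- relators D) size r.

Lemma kill_relator r : r \in relators D -> kill relator_bound r.
Proof.
move=> rP; apply: (@kill_leq _ (size r)); last exact/kill_conv0/conv_rel.
by rewrite /relator_bound (big_rem r) //= leq_maxl.
Qed.

Definition is_x (a : signed_letter D) : bool := if a.1 is inl _ then true else false.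

Lemma conv_commute (a a' : signed_letter D) : is_x a -> is_x a' ->
  conv 10 [:: a; a'] [:: a'; a].
Proof.
case: a a' => [[i|//] b] [[i'|//] b'] _ _.
apply: (@conv_of_kill _ 4) => //; apply: (@kill_conv0 D 4).
apply: (@conv_rel D [:: (inl i, b); (inl i', b'); (inl i, ~~ b); (inl i', ~~ b')]).
rewrite mem_cat; apply/orP; left; apply/mapP.
by exists ((i, b), (i', b')); rewrite ?mem_enum.
Qed.

Lemma conv_move (u : word D) (a : signed_letter D) : is_x a -> all is_x u ->
  conv (10 + size u) (u ++ [:: a]) (a :: u).
Proof.
move=> xa; elim: u => [_|a' u IH /= /andP[xa' xu]]; first exact: conv_refl.
apply: (@conv_trans _ _ _ (a' :: a :: u)).
  by apply: (@conv_catl _ _ _ [:: a']) (IH xu) _ => /=; slia.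
by apply: (@conv_catr D _ _ u _ _ (conv_commute xa' xa)); slia.
Qed.

(** The inverse of the first letter must occur, since otherwise one coordinate would only move in
    one direction; it is brought to the front and cancelled. *)
Lemma conv_is_x_nil (u : word D) :
  all is_x u -> value u = ([::], zero) -> conv (size u + 12) u [::].
Proof.
have [n] := ubnP (size u); elim: n u => // n IH [|a u] /ltnSE leu xu vu.
  exact: conv_refl.
have inu : inv_letter a \in u.
  apply/negPn/negP => nin; case: a xu vu nin {leu} => [[i|//] b] /= xu vu nin.
  have H : forall (v : word D) st, all is_x v -> @inv_letter D (inl i, b) \notin v ->
      if b then ((acts (M := M) st v).2 i <= st.2 i)%Z else (st.2 i <= (acts (M := M) st v).2 i)%Z.
    elim=> [|[[j|//] b'] v IHv] st /=; first by case: (b); lia.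
    rewrite inE negb_or => xv /andP[ne nv]; have := IHv (act (M := M) st (inl j, b')) xv nv.
    move: ne; rewrite /= /add /unit /inv_letter xpair_eqE /=.
    rewrite (inj_eq (@inl_inj _ _)); case: (i =P j) => [_|_ _] /=; last by case: (b); lia.
    by case: (b); case: (b') => //=; lia.
  have := H u (act (M := M) ([::], zero) (inl i, b)) xu nin.
  have -> : acts (act (M := M) ([::], zero) (inl i, b)) u = ([::], zero) by exact: vu.
  by rewrite /= /add /unit /zero eqxx; case: (b); lia.
case/splitPr: inu leu xu vu => u1 u2 leu xu vu.
move: xu; rewrite /= all_cat /= => /and4P[xa x1 _ x2]; rewrite /= size_cat /= in leu *.
have c1 : conv (10 + size u1) (u1 ++ [:: inv_letter a]) (inv_letter a :: u1).
  by apply: conv_move => //; case: (a) xa => [[]].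
apply: (@conv_trans _ _ _ (a :: inv_letter a :: u1 ++ u2)).
  rewrite -[u1 ++ _ :: u2]/(u1 ++ [:: inv_letter a] ++ u2) catA.
  by apply: (@conv_cat _ _ _ [:: a] u2 _ _ c1) => /=; slia.
apply: (@conv_trans _ _ _ (u1 ++ u2)).
  by apply: (@conv_catr _ _ _ (u1 ++ u2) _ _ (conv_remove (elementary_inv a))) => /=;
     rewrite size_cat; slia.
apply: (@conv_leq _ (size (u1 ++ u2) + 12)); last by rewrite size_cat; slia.
apply: IH; [by rewrite size_cat; slia|by rewrite all_cat x1|].
rewrite -vu; apply: value_group_eq => //; apply: group_eq_sym.
apply: (@group_eq_trans _ _ ((a :: inv_letter a :: u1) ++ u2)).
  rewrite -[a :: u1 ++ _]/([:: a] ++ u1 ++ [:: inv_letter a] ++ u2).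
  rewrite -[X in group_eq _ X]/([:: a] ++ (inv_letter a :: u1) ++ u2).
  by apply: group_eq_catl; rewrite catA; apply: group_eq_catr; exact: conv_group_eq c1.
by apply: (@group_eq_catr _ (u1 ++ u2) [:: a; inv_letter a] [::]); exact: group_eq_inv.
Qed.

Lemma conv_is_x (u v : word D) : all is_x u -> all is_x v ->
  value u = value v -> conv ((size u + size v) * 3 + 12) u v.
Proof.
move=> xu xv e; apply: (@conv_of_kill _ (size u + size v + 12)); last by slia.
apply: kill_conv0; have := @conv_is_x_nil (u ++ inv_word v).
rewrite size_cat size_inv; apply.
  by rewrite all_cat xu all_rev all_map; apply: sub_all xv => -[[]].
rewrite /value acts_cat -/(value u) e -acts_cat; exact: acts_inv.
Qed.

Lemma is_x_xword z : all is_x (xw z).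
Proof.
rewrite /xword; elim: (enum I) => //= i s IH.
by rewrite all_cat IH all_nseq orbT.
Qed.

Lemma is_x_block i a : all is_x (block L i a).
Proof. by rewrite all_nseq orbT. Qed.

Definition rank : nat := #|I|.

Lemma size_xword z K : (forall i, Z.abs (z i) <= Z.of_nat K)%Z ->
  size (xw z) <= rank * K.
Proof.
move=> bz; rewrite /xword /rank cardE; elim: (enum I) => //= i s IH.
rewrite size_cat size_nseq mulSn leq_add //.
by have := bz i; lia.
Qed.

(* The binary expansion of [z], since s^-1 x^h s = x^(2h). *)
Fixpoint zeta (k : nat) z : word D :=
  if k is k'.+1 then
    tl s0 true :: zeta k' (fun i => (z i / 2)%Z) ++
    tl s0 false :: xw (fun i => (z i mod 2)%Z)
  else xw z.

Lemma bounded_half k z : bounded k.+1 z -> bounded k (fun i => (z i / 2)%Z).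
Proof.
move=> bz i; have := bz i; rewrite Nat2Z.inj_succ Z.pow_succ_r; last lia.
by have := Z.div_mod (z i) 2; have := Z.mod_pos_bound (z i) 2; lia.
Qed.

Lemma size_parity z : size (xw (fun i => (z i mod 2)%Z)) <= rank.
Proof.
rewrite -[X in _ <= X]muln1; apply: size_xword => i.
by have := Z.mod_pos_bound (z i) 2; lia.
Qed.

Lemma size_zeta k z : bounded k z -> size (zeta k z) <= (rank + 2) * k.+1.
Proof.
elim: k z => [|k IH] z bz /=.
  rewrite muln1; apply: leq_trans (leq_addr _ _); rewrite -[X in _ <= X]muln1.
  by apply: size_xword => i; have := bz i.
rewrite size_cat /=; have := IH _ (bounded_half bz); have := size_parity z.
rewrite [_ * k.+2]mulnS; slia.
Qed.

Definition sign b : Z := if b then (-1)%Z else 1%Z.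

(** Induction towards 0 on the sum of the absolute values, arranged so that bounds on the
    coordinates are inherited by the smaller vector. *)
Lemma vec_ind (R : vec -> Prop) : R zero ->
  (forall z i b, (forall j, Z.abs (z j) <= Z.abs (add z (unit i (sign b)) j))%Z ->
     R z -> R (add z (unit i (sign b)))) ->
  forall z, R z.
Proof.
move=> R0 RS z; have [n] := ubnP (\sum_i Z.abs_nat (z i)).
elim: n z => // n IH z /ltnSE lez.
have [/forallP z0|] := boolP [forall i, (z i =? 0)%Z].
  have -> : z = zero by apply/funext => i; apply/Z.eqb_eq; exact: z0.
  exact: R0.
rewrite negb_forall => /existsP[i /negP zi].
have {zi}zi : z i <> 0%Z by move=> E; apply: zi; rewrite E.
pose b := (z i <? 0)%Z; pose z0 := add z (unit i (- sign b)).
have E : z = add z0 (unit i (sign b)).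
  by apply/funext => j; rewrite /z0 /add /unit; case: (j == i); lia.
have z0i : (Z.abs (z0 i) + 1 = Z.abs (z i))%Z.
  by rewrite /z0 /add /unit eqxx /sign /b; case: Z.ltb_spec; lia.
have z0j j : j != i -> z0 j = z j.
  by move=> /negbTE ji; rewrite /z0 /add /unit ji; lia.
rewrite E; apply: RS => [j|]; first rewrite -E.
  by have [->|/z0j->] := eqVneq j i; lia.
apply: IH; apply: leq_trans lez; rewrite (bigD1 i) //= [X in _ < X](bigD1 i) //=.
rewrite (eq_bigr (fun j => Z.abs_nat (z j))) => [|j /z0j -> //].
by rewrite ltn_add2r; lia.
Qed.

(** Absorbs the lengths that do not depend on the vector at hand: relators, single digits and,
    through [rank * 2 ^ kappa], the words of residues. *)
Definition unit_cost : nat := rank * 30 + relator_bound * 10 + 60 + rank * 2 ^ kappa.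

Lemma size_zeta_cost k z : bounded k z -> size (zeta k z) <= unit_cost * k.+1.
Proof.
move=> /size_zeta; move/leq_trans; apply; rewrite leq_mul2r; apply/orP; right.
by rewrite /unit_cost; lia.
Qed.

Lemma value_is_x_rcons z i b : value (xw z ++ [:: xl (i, b)] : word D) =
  ([::], add z (unit i (sign b))).
Proof. by rewrite /value acts_cat acts_xword /= add0v. Qed.

Lemma conv_letter l e i b :
  let u : word D := block L i (sign b * M l e i) ++ [:: tl l e] in
  let v : word D := tl l e :: block L i (sign b * M l (~~ e) i) in
  [/\ conv (relator_bound * 4) u v, conv (relator_bound * 4) v u,
      size u <= relator_bound & size v <= relator_bound].
Proof.
move=> u v; have rP : u ++ inv_word v \in relators D.
  rewrite mem_cat; apply/orP; right; apply/mapP; exists (l, e, i, b).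
    by rewrite mem_enum.
  rewrite /u /v inv_cons inv_block -catA; congr (block _ _ _ ++ _ :: block _ _ _ ++ _);
    by rewrite /sign; case: (b); lia.
have k := kill_relator rP; have := kill_size k; rewrite size_cat size_inv => les.
split; [|apply: (conv_of_kill (kill_sym k (leqnn _)))| |]; try by slia.
by apply: (conv_of_kill k); slia.
Qed.

Lemma conv_double i b :
  @conv D (relator_bound * 4) [:: tl s0 false; xl (i, b); xl (i, b)]
    [:: xl (i, b); tl s0 false].
Proof.
have [_ + _ _] := conv_letter s0 false i b; have [-> ->] := M_s0 i.
by case: b.
Qed.

Lemma conv_zeta_step k z i b : bounded k z -> @conv D (unit_cost * k.+1)
  (zeta k z ++ [:: xl (i, b)]) (zeta k (add z (unit i (sign b)))).
Proof.
elim: k z => [|k IH] z bz.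
  have sz : size (xw z) <= rank * 1 by apply: size_xword => j; have := bz j.
  have sz' : size (xw (add z (unit i (sign b)))) <= rank * 2.
    apply: size_xword => j; have := bz j; rewrite -[(2 ^ _)%Z]/1%Z /add /unit /sign.
    by case: (j == i); case: (b); lia.
  apply: (conv_leq (conv_is_x _ (is_x_xword _) _)).
  - by rewrite all_cat is_x_xword.
  - by rewrite value_is_x_rcons value_xword.
  - by rewrite size_cat /= /unit_cost; slia.
have bh := bounded_half bz; have IHz := IH _ bh; have szh := size_zeta bh.
rewrite [zeta k.+1 _]/= [zeta k.+1 (add _ _)]/=.
set h := fun i => (z i / 2)%Z in IHz szh bh *; set p := fun i => (z i mod 2)%Z.
set z' := add z _; set h' := fun i => (z' i / 2)%Z; set p' := fun i => (z' i mod 2)%Z.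
have sp : size (xw p) <= rank := size_parity z.
have sp' : size (xw p') <= rank := size_parity z'.
have xp : all is_x (xw p ++ [:: xl (i, b)]) by rewrite all_cat is_x_xword.
have E j : (z' j = z j + if j == i then sign b else 0)%Z by [].
have dz j := Z.div_mod (z j) 2; have dz' j := Z.div_mod (z' j) 2.
have mz j := Z.mod_pos_bound (z j) 2; have mz' j := Z.mod_pos_bound (z' j) 2.
(* The case treated first is the one in which the half changes at i, that is, the last digit
   overflows or borrows: two surplus letters then cross s and become one unit, which is added to the
   half by induction. *)
have [carry|nocarry] := Z.eq_dec (h' i) (h i); last first.
  have hE : h' = add h (unit i (sign b)).
    apply/funext => j; move: (E j) (dz j) (dz' j) (mz j) (mz' j) nocarry.
    rewrite /h' /h /add /unit; have [->|_] := eqVneq j i; rewrite /sign; case: (b); lia.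
  have pE : add p (unit i (sign b)) = add (unit i (sign b * 2)) p'.
    apply/funext => j; move: (E j) (dz j) (dz' j) (mz j) (mz' j) (congr1 (fun f => f j) hE).
    rewrite /h' /h /p /p' /add /unit; have [->|_] := eqVneq j i; rewrite /sign; case: (b); lia.
  rewrite hE; apply: (@conv_trans D _ _ (tl s0 true :: zeta k h ++
      [:: tl s0 false; xl (i, b); xl (i, b)] ++ xw p')).
    have xp' : all is_x ([:: xl (i, b); xl (i, b)] ++ xw p').
      by rewrite all_cat is_x_xword.
    have vp : value (xw p ++ [:: xl (i, b)] : word D) =
        value ([:: xl (i, b); xl (i, b)] ++ xw p' : word D).
      rewrite value_is_x_rcons pE -[RHS]/(acts (M := M) (acts ([::], zero)
        [:: xl (i, b); xl (i, b)]) (xw p')) acts_xword /=; congr pair.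
      by apply/funext => j; rewrite /add /unit /zero /sign; case: (j == i); case: (b); lia.
    apply: (@conv_at D _ _ (tl s0 true :: zeta k h ++ [:: tl s0 false]) [::]
      _ _ _ _ (conv_is_x xp xp' vp)).
    - by rewrite cats0 /= -!catA.
    - by rewrite cats0 /= -!catA.
    - by rewrite !size_cat /= !size_cat /= /unit_cost; slia.
  apply: (@conv_trans D _ _ (tl s0 true :: zeta k h ++
      [:: xl (i, b); tl s0 false] ++ xw p')).
    apply: (@conv_at D _ _ (tl s0 true :: zeta k h) (xw p') _ _ _ _ (@conv_double i b)) => //.
    by rewrite /= /unit_cost; slia.
  apply: (@conv_at D _ _ [:: tl s0 true] (tl s0 false :: xw p') _ _ _ _ IHz) => //.
    by rewrite /= -!catA.
  by rewrite /= /unit_cost; slia.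
have hE : h' = h.
  apply/funext => j; move: (E j) (dz j) (dz' j) (mz j) (mz' j) carry.
  by rewrite /h' /h; have [->|_] := eqVneq j i; lia.
have pE : add p (unit i (sign b)) = p'.
  apply/funext => j; move: (E j) (dz j) (dz' j) (mz j) (mz' j) (congr1 (fun f => f j) hE).
  by rewrite /h' /h /p /p' /add /unit; have [->|_] := eqVneq j i; lia.
have vp : value (xw p ++ [:: xl (i, b)] : word D) = value (xw p' : word D).
  by rewrite value_is_x_rcons pE value_xword.
rewrite hE; apply: (@conv_at D _ _ (tl s0 true :: zeta k h ++ [:: tl s0 false]) [::]
  _ _ _ _ (conv_is_x xp (is_x_xword p') vp)).
- by rewrite cats0 /= -!catA.
- by rewrite cats0 /= -!catA.
- by rewrite !size_cat /= !size_cat /= /unit_cost; slia.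
Qed.

Definition exponent (u : word D) z : vec := (acts (M := M) ([::], z) u).2.

(** A margin of [n] units, so that all intermediate vectors keep within [k] bits while [n] letters
    are appended. *)
Definition roomy k (n : nat) z : Prop :=
  forall i, (Z.abs (z i) + Z.of_nat n <= 2 ^ Z.of_nat k)%Z.

Lemma roomy_bounded k n z : roomy k n z -> bounded k z.
Proof. by move=> rz i; have := rz i; lia. Qed.

Lemma exponent_roomy k u z : all is_x u -> roomy k (size u) z ->
  bounded k (exponent u z).
Proof.
elim: u z => [|[[i|//] b] u IH] z /= xu rz; first exact: roomy_bounded rz.
apply: IH => // j; have := rz j; rewrite /= /add /unit.
by case: (j == i); case: b; lia.
Qed.

Lemma conv_zeta k u z : all is_x u -> roomy k (size u) z -> size u <= unit_cost ->
  @conv D (unit_cost * k.+1 * 2) (zeta k z ++ u) (zeta k (exponent u z)) /\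
  @conv D (unit_cost * k.+1 * 12) (zeta k (exponent u z)) (zeta k z ++ u).
Proof.
move=> xu rz leu; have su := size_zeta_cost (exponent_roomy xu rz).
have sz := size_zeta_cost (roomy_bounded rz).
have c : @conv D (unit_cost * k.+1 + size u) (zeta k z ++ u) (zeta k (exponent u z)).
  elim: u z xu rz {leu su sz} => [|[[i|//] b] u IH] z /= xu rz.
    by rewrite cats0; exact: conv_refl.
  pose z1 := add z (unit i (sign b)); apply: (@conv_trans D _ _ (zeta k z1 ++ u)).
    have cz := @conv_zeta_step k z i b (roomy_bounded rz).
    apply: (@conv_at D _ _ [::] u _ _ _ _ cz) => //=; last by slia.
    by rewrite -catA.
  apply: (conv_leq (IH z1 xu _)); last by slia.
  by move=> j; have := rz j; rewrite /= /z1 /add /unit /sign; case: (j == i); case: (b); lia.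
have le1 : unit_cost <= unit_cost * k.+1 by rewrite leq_pmulr.
split; first by apply: (conv_leq c); slia.
by apply: (conv_sym c); rewrite size_cat; slia.
Qed.

Lemma xword_zero : xw zero = [::].
Proof. by rewrite /xword; elim: (enum I). Qed.

Lemma conv_zeta_zero k : @conv D (unit_cost * k.+1) (zeta k zero) [::] /\
  @conv D (unit_cost * k.+1 * 4) [::] (zeta k zero).
Proof.
have c : @conv D (unit_cost * k.+1) (zeta k zero) [::].
  elim: k => [|k IH]; first by rewrite /= xword_zero; exact: conv_refl.
  have -> : zeta k.+1 zero = tl s0 true :: zeta k zero ++ [:: tl s0 false].
    by rewrite -[LHS]/(_ :: zeta k zero ++ _ :: xw zero) xword_zero.
  apply: (@conv_trans D _ _ [:: tl s0 true; tl s0 false]).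
    apply: (@conv_at D _ _ [:: tl s0 true] [:: tl s0 false] _ _ _ _ IH) => //=.
    by rewrite /unit_cost; slia.
  apply: (conv_leq (conv_remove (elementary_inv (tl s0 true : signed_letter D)))).
  by rewrite /= /unit_cost; slia.
split=> //; apply: (conv_sym c) => /=.
have bz : bounded k zero by move=> i /=; lia.
by have := size_zeta_cost bz; slia.
Qed.

(** Induction on z with the space kept fixed: inside the word to be removed, [zeta k z'] is
    exchanged for [zeta k z] and one more letter. There are exponentially many exchanges, but only
    the most expensive one counts. *)
Lemma conv_zeta_comm k (a : signed_letter D) z : is_x a -> roomy k 1 z ->
  @conv D (unit_cost * k.+1 * 60) (a :: zeta k z) (zeta k z ++ [:: a]).
Proof.
set n := unit_cost * k.+1 => xa rz.
have n60 : 60 <= n by rewrite /n /unit_cost; slia.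
suff kz : @kill D (n * 50) ((a :: zeta k z) ++ inv_word (zeta k z ++ [:: a])).
  apply: (conv_of_kill kz); have := size_zeta_cost (roomy_bounded rz).
  by rewrite size_cat /= -/n; slia.
elim/vec_ind: z rz => [_|z i b mono IH rz'].
  have [c1 _] := conv_zeta_zero k.
  have b0 : bounded k zero by move=> i /=; lia.
  have := size_zeta_cost b0; rewrite -/n => s0'.
  have c2 := conv_inv_word c1 (leqnn _).
  rewrite inv_cat; apply: kill_conv0.
  apply: (@conv_trans D _ _ ([:: a; inv_letter a] ++ inv_word (zeta k zero))).
    apply: (@conv_at D _ _ [:: a] (inv_word [:: a] ++ inv_word (zeta k zero)) _ _ _ _ c1) => //.
    by rewrite size_cat !size_inv -/n /=; slia.
  apply: (@conv_trans D _ _ [:: a; inv_letter a]).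
    apply: (@conv_at D _ _ [:: a; inv_letter a] [::] _ _ _ _ c2) => //=; first by rewrite cats0.
    by rewrite -/n; slia.
  by apply: (conv_leq (conv_remove (elementary_inv a))) => /=; slia.
set z' := add z _ in mono rz' *.
have rz : roomy k 1 z by move=> j; have := rz' j; have := mono j; lia.
have {IH} kz := IH rz.
have [_ c1] := @conv_zeta k [:: xl (i, b)] z isT rz ltac:(rewrite /unit_cost /=; slia).
have Ez : exponent [:: xl (i, b)] z = z' by rewrite /exponent /= /z'; case: (b).
rewrite Ez -/n in c1.
have sz := size_zeta_cost (roomy_bounded rz); have sz' := size_zeta_cost (roomy_bounded rz').
rewrite -/n in sz sz'.
have c2 : @conv D (n * 20) (inv_word (zeta k z')) (inv_word (zeta k z ++ [:: xl (i, b)])).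
  by apply: (conv_inv_word c1); rewrite size_cat /=; slia.
apply: (kill_convW _ kz).
rewrite !inv_cat /=.
set x : signed_letter D := xl (i, b) in c1 c2 *.
apply: (@conv_trans D _ _ (a :: (zeta k z ++ [:: x]) ++ [:: inv_letter a] ++ inv_word (zeta k z'))).
  apply: (@conv_at D _ _ [:: a] ([:: inv_letter a] ++ inv_word (zeta k z')) _ _ _ _ c1) => //.
  by rewrite size_cat size_inv /=; slia.
apply: (@conv_trans D _ _ 
  (a :: (zeta k z ++ [:: x]) ++ [:: inv_letter a; inv_letter x] ++ inv_word (zeta k z))).
  apply: (@conv_at D _ _ (a :: (zeta k z ++ [:: x]) ++ [:: inv_letter a]) [::] _ _ _ _ c2).
  - by rewrite cats0 /= -!catA.
  - by rewrite cats0 inv_cat /= -!catA.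
  - by rewrite /= !size_cat /=; slia.
apply: (@conv_trans D _ _ 
  (a :: (zeta k z ++ [:: inv_letter a]) ++ [:: x; inv_letter x] ++ inv_word (zeta k z))).
  have xa' : is_x (inv_letter a) by case: (a) xa => [[]].
  apply: (@conv_at D _ _ (a :: zeta k z) (inv_letter x :: inv_word (zeta k z)) _ _ _ _
    (@conv_commute x (inv_letter a) isT xa')).
  - by rewrite /= -!catA.
  - by rewrite /= -!catA.
  - by have := size_inv (zeta k z); rewrite /=; slia.
apply: (@conv_at D _ _ (a :: zeta k z ++ [:: inv_letter a]) (inv_word (zeta k z)) _ _ _ _
  (conv_remove (elementary_inv x))).
- by rewrite /= -!catA.
- by rewrite /= -!catA.
- by have := size_inv (zeta k z); rewrite /= !size_cat /=; slia.
Qed.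

Lemma conv_zeta_comm_word k u z : all is_x u -> roomy k 1 z ->
  @conv D (unit_cost * k.+1 * 60 + size u) (u ++ zeta k z) (zeta k z ++ u).
Proof.
move=> + rz; elim: u => [_|a u IH /= /andP[xa xu]]; first by rewrite cats0; exact: conv_refl.
apply: (@conv_trans D _ _ (a :: zeta k z ++ u)).
  apply: (@conv_at D _ _ [:: a] [::] _ _ _ _ (IH xu)) => //=; try by rewrite cats0.
  by slia.
apply: (@conv_at D _ _ [::] u _ _ _ _ (conv_zeta_comm xa rz)) => //=; last by slia.
by rewrite -catA.
Qed.

Lemma conv_xword_zeta k c z : size (xw c) <= unit_cost ->
  roomy k unit_cost z -> unit_cost > 0 ->
  @conv D (unit_cost * k.+1 * 70) (xw c ++ zeta k z) (zeta k (add z c)) /\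
  @conv D (unit_cost * k.+1 * 90) (zeta k (add z c)) (xw c ++ zeta k z).
Proof.
move=> sc rz u0; have le1 : unit_cost <= unit_cost * k.+1 by rewrite leq_pmulr.
have r1 : roomy k 1 z by move=> j; have := rz j; lia.
have rs : roomy k (size (xw c)) z by move=> j; have := rz j; slia.
have Ec : exponent (xw c) z = add z c by rewrite /exponent acts_xword.
have [c1 _] := conv_zeta (is_x_xword c) rs sc; rewrite Ec in c1.
have c2 := conv_zeta_comm_word (is_x_xword c) r1.
have ce : @conv D (unit_cost * k.+1 * 70) (xw c ++ zeta k z) (zeta k (add z c)).
  by apply: conv_trans (conv_leq c2 _) (conv_leq c1 _); slia.
split=> //; apply: (conv_sym ce); rewrite size_cat.
have bz := exponent_roomy (is_x_xword c) rs; rewrite Ec in bz.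
have := size_zeta_cost bz; have := size_zeta_cost (roomy_bounded rz).
by slia.
Qed.

Lemma size_block l e i b : size (block L i (sign b * M l e i)) <= unit_cost /\
  size (block L i (sign b * M l e i)) <= 2 ^ kappa.
Proof.
have H : size (block L i (sign b * M l e i)) <= 2 ^ kappa.
  rewrite size_nseq; have := @M_le l e i; have := M_gt0 l e i.
  have -> : (2 ^ Z.of_nat kappa = Z.of_nat (2 ^ kappa))%Z.
    elim: kappa => // n IH; rewrite Nat2Z.inj_succ Z.pow_succ_r; last by lia.
    by rewrite IH expnS; lia.
  by rewrite /sign; case: b; lia.
split=> //; apply: leq_trans H _; rewrite /unit_cost.
have : 0 < rank by apply/card_gt0P; exists i.
by case: (rank) => // r _; rewrite mulSn; lia.
Qed.

Lemma exponent_block l e i b z : exponent (block L i (sign b * M l e i)) (scale M l e z) =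
  scale M l e (add z (unit i (sign b))).
Proof.
rewrite /exponent acts_block /=; apply/funext => j; rewrite /add /unit /scale.
by case: eqP => [->|_]; lia.
Qed.

(** The same device: the relation between l and a single unit is applied once for each unit of z,
    and [kill_convW] keeps the space at that of one application. *)
Lemma conv_zeta_letter k l e z :
  roomy k (2 ^ kappa) (scale M l e z) -> roomy k (2 ^ kappa) (scale M l (~~ e) z) ->
  @conv D (unit_cost * k.+1 * 60) (zeta k (scale M l e z) ++ [:: tl l e])
    (tl l e :: zeta k (scale M l (~~ e) z)).
Proof.
set n := unit_cost * k.+1 => r1 r2; pose a : signed_letter D := tl l e.
have n60 : 60 + relator_bound * 10 <= n by rewrite /n /unit_cost; slia.
suff kz : @kill D (n * 50) ((zeta k (scale M l e z) ++ [:: a]) ++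
    inv_word (a :: zeta k (scale M l (~~ e) z))).
  apply: (conv_of_kill kz); have := size_zeta_cost (roomy_bounded r1).
  have := size_zeta_cost (roomy_bounded r2).
  by rewrite size_cat /= -/n; slia.
elim/vec_ind: z r1 r2 => [_ _|z i b mono IH r1' r2'].
  have sz e' : scale M l e' zero = zero by apply/funext => i; rewrite /scale /zero; lia.
  have [c1 _] := conv_zeta_zero k.
  have b0 : bounded k zero by move=> i /=; lia.
  have := size_zeta_cost b0; rewrite -/n => s0'.
  have c2 := conv_inv_word c1 (leqnn _).
  rewrite !sz inv_cons; apply: kill_conv0.
  apply: (@conv_trans D _ _ ([:: a] ++ inv_word (zeta k zero) ++ [:: inv_letter a])).
    apply: (@conv_at D _ _ [::] ([:: a] ++ inv_word (zeta k zero) ++ [:: inv_letter a])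
      _ _ _ _ c1) => //.
      by rewrite -!catA.
    by have := size_inv (zeta k zero); rewrite /= !size_cat -/n /=; slia.
  apply: (@conv_trans D _ _ [:: a; inv_letter a]).
    apply: (@conv_at D _ _ [:: a] [:: inv_letter a] _ _ _ _ c2) => //=.
    by rewrite -/n; slia.
  by apply: (conv_leq (conv_remove (elementary_inv a))) => /=; slia.
set z' := add z _ in mono r1' r2' *.
have room e' : roomy k (2 ^ kappa) (scale M l e' z') -> roomy k (2 ^ kappa) (scale M l e' z).
  move=> r j; have := r j; have := mono j; rewrite /scale !Z.abs_mul.
  by have := M_gt0 l e' j; nia.
have r1 := room _ r1'; have r2 := room _ r2'.
have {IH} kz := IH r1 r2.
have back e' : roomy k (2 ^ kappa) (scale M l e' z) ->
    @conv D (n * 12) (zeta k (scale M l e' z'))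
      (zeta k (scale M l e' z) ++ block L i (sign b * M l e' i)).
  move=> r; have [sb1 sb2] := size_block l e' i b.
  have [|_] := @conv_zeta k (block L i (sign b * M l e' i)) (scale M l e' z) (is_x_block _ _) _ sb1.
    by move=> j; have := r j; slia.
  by rewrite exponent_block.
have c1 := back _ r1; have c2 := back _ r2.
have sz1 := size_zeta_cost (roomy_bounded r1); have sz2 := size_zeta_cost (roomy_bounded r2).
have sz1' := size_zeta_cost (roomy_bounded r1'); have sz2' := size_zeta_cost (roomy_bounded r2').
rewrite -/n in sz1 sz1' sz2 sz2'.
have [cl _ sl1 sl2] := conv_letter l e i b; rewrite !size_cat /= in sl1 sl2.
set B1 : word D := block L i (sign b * M l e i) in c1 cl sl1.
set B2 : word D := block L i (sign b * M l (~~ e) i) in c2 cl sl2.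
have c3 : conv (n * 26) (inv_word (zeta k (scale M l (~~ e) z')))
    (inv_word (zeta k (scale M l (~~ e) z) ++ B2)).
  by apply: (conv_inv_word c2); rewrite size_cat; slia.
apply: (kill_convW _ kz); rewrite !inv_cons inv_cat in c3 *.
set A := zeta k (scale M l e z) in c1 sz1 *; set A' := zeta k (scale M l e z') in c1 sz1' *.
set C := zeta k (scale M l (~~ e) z) in c2 c3 sz2 *.
set C' := zeta k (scale M l (~~ e) z') in c2 c3 sz2' *.
have iC := size_inv C; have iC' := size_inv C'; have iB := size_inv B2.
apply: (@conv_trans D _ _ (A ++ B1 ++ [:: a] ++ inv_word C' ++ [:: inv_letter a])).
  apply: (@conv_at D _ _ [::] ([:: a] ++ inv_word C' ++ [:: inv_letter a]) _ _ _ _ c1).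
  - by rewrite -?catA.
  - by rewrite -?catA.
  - by rewrite !size_cat /=; slia.
apply: (@conv_trans D _ _ (A ++ B1 ++ [:: a] ++ inv_word B2 ++ inv_word C ++ [:: inv_letter a])).
  apply: (@conv_at D _ _ (A ++ B1 ++ [:: a]) [:: inv_letter a] _ _ _ _ c3).
  - by rewrite -?catA.
  - by rewrite -?catA.
  - by rewrite !size_cat /=; slia.
apply: (@conv_trans D _ _ (A ++ [:: a] ++ B2 ++ inv_word B2 ++ inv_word C ++ [:: inv_letter a])).
  apply: (@conv_at D _ _ A (inv_word B2 ++ inv_word C ++ [:: inv_letter a]) _ _ _ _ cl).
  - by rewrite -?catA.
  - by rewrite -?catA.
  - by rewrite !size_cat /=; slia.
apply: (@conv_at D _ _ (A ++ [:: a]) (inv_word C ++ [:: inv_letter a]) _ _ _ _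
  (conv_inv (leqnn (size B2 * 2))).1).
- by rewrite -?catA.
- by rewrite -?catA.
- by rewrite !size_cat /=; slia.
Qed.

Fixpoint stack_word (st : seq (vec * L * bool)) : word D :=
  if st is (c, l, e) :: st' then stack_word st' ++ xw c ++ [:: tl l e]
  else [::].

Definition nf_word k (st : nf I L) : word D := stack_word st.1 ++ zeta k st.2.

Lemma size_residue l e z : size (xw (residue M l e z)) <= unit_cost.
Proof.
apply: (@leq_trans (rank * 2 ^ kappa)); last by rewrite /unit_cost; lia.
apply: size_xword => i; rewrite /residue.
have -> : (Z.of_nat (2 ^ kappa) = 2 ^ Z.of_nat kappa)%Z.
  elim: kappa => // n IH; rewrite Nat2Z.inj_succ Z.pow_succ_r; last by lia.
  by rewrite -IH expnS; lia.
by have := Z.mod_pos_bound (z i) (M l e i) (M_gt0 l e i); have := @M_le l e i; lia.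
Qed.

Lemma size_stack_word st : normal M st -> size (stack_word st) <= (unit_cost + 1) * size st.
Proof.
elim: st => [|[[c l] e] st IH] //= [rc _ nst]; rewrite !size_cat mulnS.
have := size_residue l e c; rewrite rc; have := IH nst.
by rewrite /=; slia.
Qed.

(** Room for scaling by a modulus and for adding a residue afterwards. *)
Definition spacious k z : Prop := forall i,
  (2 ^ Z.of_nat kappa * (Z.abs (z i) + 1) + Z.of_nat unit_cost <= 2 ^ Z.of_nat k)%Z.

Lemma pow_kappa_unit_cost i : 2 ^ kappa <= unit_cost.
Proof.
have : 0 < rank by apply/card_gt0P; exists i.
by rewrite /unit_cost; case: (rank) => // r _; rewrite !mulSn; lia.
Qed.

Lemma roomy_unit_cost k z : roomy k unit_cost z -> roomy k (2 ^ kappa) z.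
Proof. by move=> r i; have := r i; have := pow_kappa_unit_cost i; lia. Qed.

Lemma spacious_roomy k l e z : spacious k z ->
  [/\ bounded k z, roomy k unit_cost (scale M l e (quotient M l e z)) &
      roomy k unit_cost (scale M l (~~ e) (quotient M l e z))].
Proof.
move=> sz; have k0 : (1 <= 2 ^ Z.of_nat kappa)%Z.
  by have := Z.pow_pos_nonneg 2 (Z.of_nat kappa); lia.
have H i : [/\ (Z.abs (z i) <= 2 ^ Z.of_nat k)%Z,
    (Z.abs (scale M l e (quotient M l e z) i) + Z.of_nat unit_cost <= 2 ^ Z.of_nat k)%Z &
    (Z.abs (scale M l (~~ e) (quotient M l e z) i) + Z.of_nat unit_cost <= 2 ^ Z.of_nat k)%Z].
  have := sz i; rewrite /scale /quotient.
  have := Z.div_mod (z i) (M l e i); have := Z.mod_pos_bound (z i) (M l e i) (M_gt0 l e i).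
  have M1 := M_gt0 l e i; have M2 := @M_le l e i.
  have M3 := M_gt0 l (~~ e) i; have M4 := @M_le l (~~ e) i.
  set q := (z i / M l e i)%Z => mb dm h.
  have qz : (Z.abs q <= Z.abs (z i))%Z by nia.
  have h1 : (Z.abs (M l e i * q) <= Z.abs (z i) + 2 ^ Z.of_nat kappa)%Z by nia.
  have h2 : (Z.abs (M l (~~ e) i * q) <= 2 ^ Z.of_nat kappa * Z.abs (z i))%Z.
    by rewrite Z.abs_mul; nia.
  by split; nia.
by split=> i; have [] := H i.
Qed.

Lemma conv_act k (st : nf I L) (a : signed_letter D) : normal M st.1 -> spacious k st.2 ->
  conv (unit_cost * k.+1 * 100 + size (stack_word st.1))
    (nf_word k st ++ [:: a]) (nf_word k (act (M := M) st a)).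
Proof.
set n := unit_cost * k.+1; case: st => st z /= nst sz.
have n1 : unit_cost <= n by rewrite leq_pmulr.
have n60 : 60 <= unit_cost by rewrite /unit_cost; slia.
case: a => [[i|l] e].
  rewrite /nf_word /=.
  apply: (@conv_at D _ _ (stack_word st) [::] _ _ _ _ (@conv_zeta_step k z i e _)).
  - by move=> j; have := sz j; have := Z.pow_pos_nonneg 2 (Z.of_nat kappa); nia.
  - by rewrite cats0 -catA.
  - by rewrite cats0.
  - by rewrite -/n /=; slia.
have [bz r1 r3] := spacious_roomy l e sz.
have u0 : 0 < unit_cost by rewrite /unit_cost; slia.
have cl := conv_zeta_letter (roomy_unit_cost r1) (roomy_unit_cost r3); rewrite -/n in cl.
have cpush : conv (n * 100 + size (stack_word st)) ((stack_word st ++ zeta k z) ++ [:: tl l e])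
    (nf_word k ((residue M l e z, l, e) :: st, scale M l (~~ e) (quotient M l e z))).
  have [_ c1] := @conv_xword_zeta k _ _ (size_residue l e z) r1 u0.
  rewrite addvC -(residue_quotient M_gt0) -/n in c1.
  have sr := size_residue l e z.
  apply: (@conv_trans D _ _ (stack_word st ++ xw (residue M l e z) ++
      zeta k (scale M l e (quotient M l e z)) ++ [:: tl l e])).
    apply: (@conv_at D _ _ (stack_word st) [:: tl l e] _ _ _ _ c1).
    - by rewrite -?catA.
    - by rewrite -?catA.
    - by rewrite /=; slia.
  apply: (@conv_at D _ _ (stack_word st ++ xw (residue M l e z)) [::] _ _ _ _ cl).
  - by rewrite cats0 -?catA.
  - by rewrite cats0 /nf_word /= -?catA.
  - by rewrite size_cat /=; slia.
case: st cpush nst => [|[[c l'] e'] st] cpush nst; first exact: cpush.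
have [C|/negbTE C] := boolP [&& l' == l, e' == ~~ e & divides M l e z]; last first.
  rewrite (_ : act _ _ = ((residue M l e z, l, e) :: (c, l', e') :: st,
    scale M l (~~ e) (quotient M l e z))); first exact: cpush.
  by rewrite /= C.
rewrite (_ : act _ _ = (st, add c (scale M l (~~ e) (quotient M l e z)))); last by rewrite /= C.
move: C => /and3P[/eqP El /eqP Ee dz]; subst l' e'.
case: nst => rc _ nst; have Ez := divides_quotient M_gt0 dz.
rewrite Ez in cl; have sr := size_residue l (~~ e) c; rewrite rc in sr.
have [c1 _] := @conv_xword_zeta k c _ sr r3 u0; rewrite addvC -/n in c1.
rewrite /nf_word [stack_word _]/=; set Y := zeta k (scale _ _ _ _) in cl c1.
pose b : signed_letter D := tl l (~~ e); pose b' : signed_letter D := tl l e.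
apply: (@conv_trans D _ _ (stack_word st ++ xw c ++ [:: b] ++ [:: b'] ++ Y)).
  apply: (@conv_at D _ _ (stack_word st ++ xw c ++ [:: b]) [::] _ _ _ _ cl).
  - by rewrite cats0 -?catA.
  - by rewrite cats0 -?catA.
  - by rewrite /= !size_cat /=; slia.
apply: (@conv_trans D _ _ (stack_word st ++ xw c ++ Y)).
  have bb : conv 2 [:: b; b'] [::].
    by have := conv_remove (elementary_inv b); rewrite {2}/b /inv_letter /= negbK.
  apply: (@conv_at D _ _ (stack_word st ++ xw c) Y _ _ _ _ bb).
  - by rewrite -?catA.
  - by rewrite -?catA.
  - rewrite /= !size_cat /=; have := size_zeta_cost (roomy_bounded r3).
    by rewrite -/n -/Y; slia.
apply: (@conv_at D _ _ (stack_word st) [::] _ _ _ _ c1).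
- by rewrite cats0.
- by rewrite cats0.
- by rewrite /= !size_cat /=; slia.
Qed.

(** Enough digits for all prefixes of a word of length n: the first summand comes from
    [value_bounded], [kappa + 1] allows for one scaling, and [unit_cost] for the additive margin in
    [spacious]. *)
Definition precision (n : nat) : nat := (kappa + 1) * n + kappa + 1 + unit_cost.

Lemma spacious_value n w : size w <= n -> spacious (precision n) (value w).2.
Proof.
move=> lew i; have := @value_bounded w i.
set X := Z.abs _ => hX.
have X1 : (X <= 2 ^ Z.of_nat ((kappa + 1) * n))%Z.
  apply: (Z.le_trans _ _ _ hX); apply: Z.pow_le_mono_r; first by lia.
  by apply: inj_le; apply/leP; rewrite leq_mul2l lew orbT.
have u1 : (Z.of_nat unit_cost + 1 <= 2 ^ Z.of_nat unit_cost)%Z.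
  elim: unit_cost => // m IH; rewrite Nat2Z.inj_succ Z.pow_succ_r; lia.
have -> : (2 ^ Z.of_nat (precision n) =
    2 ^ Z.of_nat ((kappa + 1) * n) * (2 ^ Z.of_nat kappa * 2) * 2 ^ Z.of_nat unit_cost)%Z.
  rewrite /precision !Nat2Z.inj_add !Z.pow_add_r; lia.
have p1 := Z.pow_pos_nonneg 2 (Z.of_nat kappa).
have p2 := Z.pow_pos_nonneg 2 (Z.of_nat ((kappa + 1) * n)).
set A := (2 ^ Z.of_nat kappa)%Z in p1 *; set B := (2 ^ Z.of_nat ((kappa + 1) * n))%Z in p2 X1 *.
set U := (2 ^ Z.of_nat unit_cost)%Z in u1 *.
have le1 : (A * (X + 1) <= B * (A * 2))%Z by nia.
have le2 : (1 <= B * (A * 2))%Z by nia.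
nia.
Qed.

Definition tower_cost : nat := unit_cost * (kappa + 1) * 2000 + unit_cost * unit_cost * 2000 +
  unit_cost * kappa * 2000 + unit_cost * 4000.

Lemma precision_cost n :
  unit_cost * (precision n).+1 * 200 + (unit_cost + 1) * n + n <= tower_cost * n.+1.
Proof. rewrite /tower_cost /precision; have : 0 < unit_cost by rewrite /unit_cost; lia. nia. Qed.

Lemma conv_value n w : size w <= n ->
  conv (tower_cost * n.+1) w (nf_word (precision n) (value w)).
Proof.
move=> lew; pose cost := unit_cost * (precision n).+1 * 100 + (unit_cost + 1) * n + size w.
apply: (@conv_leq _ cost); last by have := precision_cost n; rewrite /cost; slia.
rewrite {}/cost.
elim/last_ind: w lew => [|w a IH] lew.
  apply: (conv_leq (conv_zeta_zero (precision n)).2).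
  by rewrite /=; slia.
rewrite -cats1 size_cat /= in lew *.
have lew' : size w <= n by slia.
apply: (@conv_trans D _ _ (nf_word (precision n) (value w) ++ [:: a])).
  by apply: conv_catr (IH lew') _ => /=; slia.
have -> : value (w ++ [:: a]) = act (M := M) (value w) a by rewrite /value acts_cat.
have nv : normal M (value w).1 by exact: acts_normal.
apply: (conv_leq (@conv_act (precision n) (value w) a nv (spacious_value lew'))).
have := size_stack_word nv; have := size_value w.
set x := size (value w).1 => h1 h2.
have : (unit_cost + 1) * x <= (unit_cost + 1) * n by rewrite leq_mul2l; apply/orP; right; slia.
by slia.
Qed.

(** The action is faithful because the rewriting to the normal form is itself a proof of equality in
    the group. *)
Lemma value_eq w w' : value w = value w' -> group_eq w w'.
Proof.
have lew := leq_maxl (size w) (size w'); have lew' := leq_maxr (size w) (size w').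
move=> e; apply: group_eq_trans (conv_group_eq (conv_value lew)) _.
by rewrite e; apply/group_eq_sym/(conv_group_eq (conv_value lew')).
Qed.

Theorem tower_kill n w : size w <= n -> group_eq w [::] -> kill (tower_cost * n.+1) w.
Proof.
move=> lew ew; apply: (kill_convW (conv_value lew)).
rewrite (value_group_eq M_gt0 ew) /nf_word /=.
apply: (@kill_leq _ (unit_cost * (precision n).+1)).
  by have := precision_cost n; slia.
exact: kill_conv0 (conv_zeta_zero _).1.
Qed.

End TowerSpace.

(** * Affine machines *)

Section Substitution.

Variables (P P' : presentation) (f : generator P -> word P').
Implicit Types w : word P.

Definition subst_letter (a : signed_letter P) : word P' :=
  if a.2 then inv_word (f a.1) else f a.1.

Definition subst w : word P' := flatten (map subst_letter w).

Lemma subst_cat w w' : subst (w ++ w') = subst w ++ subst w'.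
Proof. by rewrite /subst map_cat flatten_cat. Qed.

Lemma subst_cons a w : subst (a :: w) = subst_letter a ++ subst w.
Proof. by []. Qed.

Lemma subst_inv w : subst (inv_word w) = inv_word (subst w).
Proof.
elim: w => // a w IH; rewrite inv_cons subst_cat IH subst_cons inv_cat; congr (_ ++ _).
by rewrite /subst /= cats0; case: a => x [] //=; rewrite /subst_letter /= inv_wordK.
Qed.

Lemma size_subst K w : (forall x, size (f x) <= K) -> size (subst w) <= K * size w.
Proof.
move=> fK; elim: w => // a w IH; rewrite subst_cons size_cat.
have : size (subst_letter a) <= K by rewrite /subst_letter; case: ifP; rewrite ?size_inv.
by rewrite [size (_ :: _)]/= mulnS; slia.
Qed.

Lemma subst_group_eq w w' :
  (forall r, r \in relators P -> group_eq (subst r) [::]) ->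
  group_eq w w' -> group_eq (subst w) (subst w').
Proof.
move=> fr; elim=> {w w'} [u|u v _ IH|u v w _ IH1 _ IH2|u u' v v' _ IH1 _ IH2|a|r rP].
- exact: group_eq_refl.
- exact: group_eq_sym.
- exact: group_eq_trans IH2.
- by rewrite !subst_cat; exact: group_eq_cat.
- case: a => x b; rewrite /inv_letter !subst_cons cats0.
  by case: b; [exact: group_eq_invl|exact: group_eq_invr].
- exact: fr.
Qed.

End Substitution.

Section AffineMachine.

Variables (I C : finType) (a b : C -> I -> Z) (P Q : C -> I -> Z) (kappa : nat).

Local Notation vec := (vec I).
Implicit Types (z u : vec) (c : C) (e : bool).

Definition affine_step c z z' : Prop := exists u : vec,
  z = (fun i => (a c i + P c i * u i)%Z) /\ z' = (fun i => (b c i + Q c i * u i)%Z).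

Definition affine_move c e z z' : Prop :=
  if e then affine_step c z' z else affine_step c z z'.

Inductive affine_conn (k : nat) : vec -> Prop :=
| affine_conn0 : affine_conn k (@zero I)
| affine_conn_step c e z z' : affine_conn k z -> bounded k z' ->
    affine_move c e z z' -> affine_conn k z'.

(* [None] is the letter [s]. *)
Definition modulus (l : option C) (e : bool) (i : I) : Z :=
  match l with
  | None => if e then 2%Z else 1%Z
  | Some c => if e then P c i else Q c i
  end.

Hypothesis P_gt0 : forall c i, (0 < P c i)%Z.
Hypothesis Q_gt0 : forall c i, (0 < Q c i)%Z.
Hypothesis P_le : forall c i, (P c i <= 2 ^ Z.of_nat kappa.+1)%Z.
Hypothesis Q_le : forall c i, (Q c i <= 2 ^ Z.of_nat kappa.+1)%Z.

Lemma modulus_gt0 l e i : (0 < modulus l e i)%Z.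
Proof. by case: l => [c|]; case: e => //=. Qed.

(** The exponent [kappa.+1] is positive, which makes room for the modulus 2 of the letter s. *)
Lemma modulus_le l e i : (modulus l e i <= 2 ^ Z.of_nat kappa.+1)%Z.
Proof.
have p := Z.pow_pos_nonneg 2 (Z.of_nat kappa).
case: l => [c|]; case: e; rewrite /modulus; [exact: P_le|exact: Q_le| |];
  by rewrite Nat2Z.inj_succ Z.pow_succ_r; lia.
Qed.

Lemma modulus_None i : modulus None false i = 1%Z /\ modulus None true i = 2%Z.
Proof. by []. Qed.

Definition base_group : presentation := tower_group modulus.
Local Notation D := base_group.
Implicit Types w g : word D.

Definition xw z : word D := xword (option C) z.
Definition rl (x : C * bool) : signed_letter D := (inr (Some x.1), x.2).
Definition rw (s : seq (C * bool)) : word D := map rl s.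

(* r_c x^(a + P u) = x^(b + Q u) e_c, hence the cosets of the subgroup generated by
   the [edge c] follow the moves of the machine. *)
Definition edge c : word D :=
  xw (opp (b c)) ++ [:: rl (c, false)] ++ xw (a c).

(* The endomorphism [theta] is the identity on the subgroup generated by the edges,
   and [phi] is a retraction onto the subgroup generated by the letters r_c. *)
Definition to_edges (x : I + option C) : word D := if x is inr (Some c) then edge c else [::].
Definition to_rules (x : I + option C) : word D :=
  if x is inr (Some c) then [:: rl (c, false)] else [::].

Definition theta : word D -> word D := @subst D D to_edges.
Definition phi : word D -> word D := @subst D D to_rules.

Lemma subst_block (f : I + option C -> word D) i n :
  (forall j, f (inl j) = [::]) -> @subst D D f (block (option C) i n) = [::].
Proof.
move=> f0; rewrite /block; elim: (Z.abs_nat n) => // m IH.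
by rewrite -addn1 nseqD subst_cat IH /subst /= /subst_letter /= f0 /=; case: ifP.
Qed.

Lemma subst_xw (f : I + option C -> word D) z :
  (forall j, f (inl j) = [::]) -> @subst D D f (xw z) = [::].
Proof.
move=> f0; rewrite /xw /xword; elim: (enum I) => // i s IH.
by rewrite [flatten _]/= subst_cat IH subst_block.
Qed.

Lemma subst_relator (f : I + option C -> word D) r : (forall j, f (inl j) = [::]) ->
  r \in relators D -> group_eq (@subst D D f r) [::].
Proof.
move=> f0; rewrite mem_cat => /orP[/mapP[[[i d] [j d']] _ ->]|/mapP[[[[l e] i] d] _ ->]].
  rewrite /subst /= /subst_letter /= !f0 /inv_word /=.
  by case: d; case: d' => /=; exact: group_eq_refl.
rewrite subst_cat subst_block // subst_cons subst_cat subst_block // cat0s.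
rewrite /subst /= cats0 /subst_letter /=.
by case: (e) => /=; [exact: group_eq_invl|exact: group_eq_invr].
Qed.

Lemma theta_group_eq w w' : group_eq w w' -> group_eq (theta w) (theta w').
Proof. by apply: subst_group_eq => r; exact: subst_relator. Qed.

Lemma phi_group_eq w w' : group_eq w w' -> group_eq (phi w) (phi w').
Proof. by apply: subst_group_eq => r; exact: subst_relator. Qed.

Lemma theta_cat w w' : theta (w ++ w') = theta w ++ theta w'.
Proof. exact: subst_cat. Qed.

Lemma phi_cat w w' : phi (w ++ w') = phi w ++ phi w'.
Proof. exact: subst_cat. Qed.

Lemma theta_inv w : theta (inv_word w) = inv_word (theta w).
Proof. exact: subst_inv. Qed.

Lemma phi_inv w : phi (inv_word w) = inv_word (phi w).
Proof. exact: subst_inv. Qed.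

Lemma theta_xw z : theta (xw z) = [::].
Proof. exact: subst_xw. Qed.

Definition edges : seq (word D) := [seq edge c | c <- enum C].

Definition ew (s : seq (C * bool)) : word D := theta (rw s).

Lemma ew_cons x s :
  ew (x :: s) = (if x.2 then inv_word (edge x.1) else edge x.1) ++ ew s.
Proof. by case: x => c []. Qed.

Lemma theta_edge c : theta (edge c) = edge c.
Proof. by rewrite /edge !theta_cat !theta_xw /= cats0 /theta /subst /= cats0. Qed.

(** [theta] fixes every edge and hence E. Membership in E thus comes with an explicit product of
    edges whose length is linear in that of the word. *)
Lemma subgroup_theta w : subgroup edges w -> group_eq w (theta w).
Proof.
elim=> [|h u /mapP[c _ ->] _ IH|h u /mapP[c _ ->] _ IH|u u' e _ IH].
- exact: group_eq_refl.
- by rewrite theta_cat theta_edge; exact: group_eq_catl.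
- by rewrite theta_cat theta_inv theta_edge; exact: group_eq_catl.
- apply: (group_eq_trans (group_eq_sym e)); apply: (group_eq_trans IH).
  exact: theta_group_eq.
Qed.

Lemma edge_mem c : edge c \in edges.
Proof. by apply: map_f; rewrite mem_enum. Qed.

Lemma subgroup_ew s : subgroup edges (ew s).
Proof.
elim: s => [|[c e] s IH]; first exact: subgroup_nil.
by rewrite ew_cons; case: e; [apply: subgroup_genV|apply: subgroup_gen] => //; exact: edge_mem.
Qed.

Definition rules_of w : seq (C * bool) :=
  pmap (fun x : signed_letter D => if x.1 is inr (Some c) then Some (c, x.2) else None) w.

Lemma theta_rules w : theta w = ew (rules_of w).
Proof.
elim: w => // x w IH; rewrite /theta subst_cons -/(theta w) IH.
by case: x => [[i|[c|]] e] //=; case: e; rewrite /subst_letter.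
Qed.

Lemma phi_rules w : phi w = rw (rules_of w).
Proof.
elim: w => // x w IH; rewrite /phi subst_cons -/(phi w) IH.
by case: x => [[i|[c|]] e] //=; case: e; rewrite /subst_letter.
Qed.

Lemma size_rules w : size (rules_of w) <= size w.
Proof. by rewrite size_pmap count_size. Qed.

Definition edge_size : nat := \max_(c : C) size (edge c).

Lemma size_theta w : size (theta w) <= edge_size * size w.
Proof.
apply: size_subst => -[i|[c|]] //=; exact: (@leq_bigmax _ (fun c => size (edge c)) c).
Qed.

Lemma ew_cat s s' : ew (s ++ s') = ew s ++ ew s'.
Proof. by rewrite /ew /rw map_cat theta_cat. Qed.

Lemma ew_finv s : ew (finv s) = inv_word (ew s).
Proof. by rewrite /ew -theta_inv; congr theta; rewrite /finv /rw /inv_word map_rev -!map_comp. Qed.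

Lemma rw_finv s : rw (finv s) = inv_word (rw s).
Proof. by rewrite /finv /rw /inv_word map_rev -!map_comp. Qed.

Lemma ew_fred s : group_eq (ew s) (ew (fred s)).
Proof.
elim: s => [|x s IH]; first exact: group_eq_refl.
rewrite ew_cons; apply: (group_eq_trans (group_eq_catl _ IH)).
rewrite -ew_cons /= /push; case: (fred s) => [|y s']; first exact: group_eq_refl.
case: eqP => [->|_]; last exact: group_eq_refl.
rewrite 2!ew_cons catA /=; apply: (@group_eq_catr _ _ _ [::]).
by case: (x.2) => /=; [exact: group_eq_invl|exact: group_eq_invr].
Qed.

Lemma acts_xw (st : nf I (option C)) z : acts (M := modulus) st (xw z) = (st.1, add st.2 z).
Proof. exact: acts_xword. Qed.

Lemma acts_xw_inv (st : nf I (option C)) z : normal modulus st.1 ->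
  acts (M := modulus) st (inv_word (xw z)) = (st.1, add st.2 (opp z)).
Proof.
move=> nst; have {1}-> : st = acts (M := modulus) (st.1, add st.2 (opp z)) (xw z).
  case: st nst => st y nst; rewrite acts_xw /=; congr pair.
  by apply/funext => i; rewrite /add /opp; lia.
rewrite -acts_cat acts_inv //; exact: modulus_gt0.
Qed.

Lemma xw_inj z z' : group_eq (xw z) (xw z') -> z = z'.
Proof. by move/(value_group_eq modulus_gt0); rewrite !value_xword => -[]. Qed.

(** For the positive sign this is r_c x^(a + P u) = x^(b + Q u) e_c, verified on normal forms; the
    other sign follows by multiplying with the inverses of r_c and e_c. *)
Lemma move_group_eq c e z z' : affine_move c e z z' ->
  group_eq (rl (c, e) :: xw z) (xw z' ++ ew [:: (c, e)]).
Proof.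
have H u1 u2 : affine_step c u1 u2 -> group_eq (rl (c, false) :: xw u1) (xw u2 ++ edge c).
  case=> u [Eu1 Eu2]; apply: (value_eq modulus_gt0 modulus_le modulus_None).
  rewrite /value /edge !acts_cat !acts_xw.
  set st1 := (X in acts X [:: _]).
  have -> : st1 = ([::], scale modulus (Some c) false u).
    by rewrite /st1 Eu2 /=; congr pair; apply/funext => i; rewrite /add /opp /zero /scale /=; lia.
  have st y : act (M := modulus) ([::], scale modulus (Some c) false y) (rl (c, false)) =
      ([:: (@zero I, Some c, false)], scale modulus (Some c) true y).
    rewrite /=; congr ([:: (_, _, _)], _).
      apply/funext => i.
      have := congr1 (fun f => f i) (residue_scale modulus (Some c) false (@zero I) y).
      rewrite add0v => ->; rewrite /residue /zero Z.mod_0_l //=.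
      by have := Q_gt0 c i; lia.
    have -> // : quotient modulus (Some c) false (scale modulus (Some c) false y) = y.
    rewrite -[scale _ _ _ _]add0v (quotient_scale modulus_gt0) //.
  rewrite -[acts _ [:: rl (c, false)]]/(act (M := modulus) _ (rl (c, false))) st.
  have E0 : @zero I = scale modulus (Some c) false (@zero I).
    by apply/funext => i; rewrite /scale /zero; lia.
  rewrite -[acts _ (_ :: _)]/(acts (act (M := modulus) ([::], @zero I) (rl (c, false))) (xw u1)).
  have st0 := st (@zero I); rewrite -E0 in st0; rewrite st0 acts_xw /=; congr pair.
  by rewrite Eu1; apply/funext => i; rewrite /add /scale /zero /=; lia.
case: e => /= mv; last by rewrite ew_cons cats0; exact: H.
rewrite ew_cons cats0 /=; have e1 := H _ _ mv.
apply: (@group_eq_trans _ _ (rl (c, true) :: (xw z ++ edge c) ++ inv_word (edge c))).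
  apply: (@group_eq_catl _ [:: rl (c, true)]); rewrite -catA -[X in group_eq X]cats0.
  by apply: group_eq_catl; apply: group_eq_sym; exact: group_eq_invr.
rewrite -cat_cons; apply: group_eq_catr.
apply: (@group_eq_trans _ _ (rl (c, true) :: rl (c, false) :: xw z')).
  by apply: (@group_eq_catl _ [:: rl (c, true)]); exact: group_eq_sym.
by apply: (@group_eq_catr _ (xw z') [:: rl (c, true); rl (c, false)] [::]);
  exact: (group_eq_inv (rl (c, true))).
Qed.

(** The exponents of x before and after the stable letter in an edge or in its inverse. *)
Definition pre (x : C * bool) : vec := if x.2 then opp (a x.1) else opp (b x.1).
Definition post (x : C * bool) : vec := if x.2 then b x.1 else a x.1.

Definition rule_syllable (z : vec) (x : C * bool) : vec * option C * bool := (z, Some x.1, x.2).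

Fixpoint edge_syllables z (s : seq (C * bool)) : seq (vec * option C * bool) * vec :=
  if s is x :: s' then
    let: (t, y) := edge_syllables (post x) s' in
    (rule_syllable (add z (pre x)) x :: t, y)
  else ([::], z).

Lemma edge_syllables_cons z x s : edge_syllables z (x :: s) =
  (rule_syllable (add z (pre x)) x :: (edge_syllables (post x) s).1,
   (edge_syllables (post x) s).2).
Proof. by rewrite [LHS]/=; case: (edge_syllables _ _). Qed.

Definition syllable_word (s : seq (vec * option C * bool)) : word D := syllables s.

Lemma acts_edge_syllables (st : nf I (option C)) z s : normal modulus st.1 ->
  acts (M := modulus) st (xw z ++ ew s) =
  acts st (syllable_word (edge_syllables z s).1 ++ xw (edge_syllables z s).2).
Proof.
elim: s st z => [|x s IH] st z nst; first by rewrite cats0.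
have acts_edge st' : normal modulus st'.1 -> acts (M := modulus) st'
    (if x.2 then inv_word (edge x.1) else edge x.1) =
    acts (M := modulus) st' (xw (pre x) ++ [:: rl x] ++ xw (post x)).
  move=> nst'; case: x => c [].
    rewrite -[LHS]/(acts (M := modulus) st' (inv_word (edge c))).
    have -> : inv_word (edge c) =
        inv_word (xw (a c)) ++ [:: rl (c, true)] ++ inv_word (xw (opp (b c))).
      by rewrite /edge !inv_cat -catA.
    rewrite !acts_cat [LHS]acts_xw_inv; last by do 2!apply: acts_normal.
    rewrite acts_xw_inv // [RHS]acts_xw acts_xw /pre /post /=.
    by congr pair; apply/funext => i; rewrite /add /opp /=; lia.
  by [].
have sw p t : syllable_word (p :: t) =
  (xw p.1.1 ++ [:: tletter I p.1.2 p.2]) ++ syllable_word t by [].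
rewrite ew_cons acts_cat acts_xw acts_cat acts_edge // -acts_cat -!catA acts_cat acts_xw acts_cat.
have nst2 : normal modulus (act (M := modulus) (st.1, add (add st.2 z) (pre x)) (rl x)).1.
  exact: act_normal.
have := IH (act (M := modulus) (st.1, add (add st.2 z) (pre x)) (rl x)) (post x) nst2.
move=> IHs; apply: (etrans IHs).
rewrite edge_syllables_cons [_.1 in RHS]/= [_.2 in RHS]/= sw -!catA [RHS]acts_cat acts_xw.
rewrite [RHS]acts_cat addvA.
by case: (x).
Qed.

(* The coset of [rw s ++ xw z] with [s] nonempty does not represent a vector if [s]
   cannot be absorbed into [z]. *)
Definition junk (s : seq (C * bool)) z : Prop :=
  if s is x :: s' then let: (c, e) := last x s' in forall z', ~ affine_move c e z z' else True.

Lemma edge_syllables_size z s : size (edge_syllables z s).1 = size s.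
Proof. by elim: s z => //= x s IH z; case: (edge_syllables _ _) (IH (post x)) => t y /= ->. Qed.

Lemma divides_move c e z : divides modulus (Some c) (~~ e) (add z (pre (c, ~~ e))) ->
  exists z', affine_move c e z z'.
Proof.
move=> d; have E := divides_quotient modulus_gt0 d.
set u := quotient _ _ _ _ in E; case: e d u E => d u E.
  exists (fun i => (a c i + P c i * u i)%Z); exists u; split=> //.
  by apply/funext => i; have := congr1 (fun f => f i) E; rewrite /add /scale /pre /opp /=; lia.
exists (fun i => (b c i + Q c i * u i)%Z); exists u; split=> //.
by apply/funext => i; have := congr1 (fun f => f i) E; rewrite /add /scale /pre /opp /=; lia.
Qed.

Lemma britton_cons x s : britton modulus (x :: s) =
  (if s is y :: _ then ~~ [&& y.1.2 == x.1.2, y.2 == ~~ x.2 & divides modulus y.1.2 y.2 y.1.1]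
   else true) && britton modulus s.
Proof. by case: s. Qed.

(** Neighbouring stable letters with equal index and opposite signs would come from neighbouring
    inverse edges. In particular the edges generate E freely. *)
Lemma britton_edges z s : reduced s -> britton modulus (edge_syllables z s).1.
Proof.
elim: s z => [//|x s IH] z; rewrite reduced_cons => /andP[h rs].
rewrite edge_syllables_cons britton_cons IH // andbT.
case: s h {IH rs} => [//|y s] h; rewrite edge_syllables_cons /=.
apply: contra h => /and3P[/eqP Ec /eqP Ee _].
by case: x y Ec Ee => c e [c' e'] [->] /= ->.
Qed.

(** No stable letter cancels: inside [s] and [t] by reducedness, and at their junction because a
    cancellation would be a move from z, which [junk] excludes. Counting stable letters then bounds
    [s] and [t] by the length of any word for the same element. *)
Lemma core_size s z t : reduced s -> reduced t -> junk s z ->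
  size (value (rw s ++ xw z ++ ew t)).1 = size s + size t.
Proof.
move=> rs rt js.
have bs : britton modulus (map (rule_syllable (@zero I)) s ++ (edge_syllables z t).1).
  elim: s rs js => [|x s IH]; first by move=> _ _; exact: britton_edges.
  rewrite reduced_cons map_cons cat_cons britton_cons => /andP[h rs] js.
  apply/andP; split; last by apply: IH => //; case: (s) js.
  case: s h rs js {IH} => [|y s] h rs js /=.
    case: t rt => [//|y t] rt; rewrite edge_syllables_cons /=.
    apply/negP => /and3P[/eqP Ec /eqP Ee d]; case: x h js Ec Ee => c e h js Ec Ee.
    case: y Ec Ee d {rt} => c' e' [->] /= -> d.
    by have [z' mv] := divides_move d; exact: (js z').
  apply: contra h => /and3P[/eqP Ec /eqP Ee _].
  by case: x y Ec Ee {rs js} => c e [c' e'] [->] /= ->.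
have := value_syllables (edge_syllables z t).2 bs.
rewrite size_cat size_map edge_syllables_size => <-; congr (size (fst _)).
have sr st : acts (M := modulus) st (syllable_word (map (rule_syllable (@zero I)) s)) =
    acts (M := modulus) st (rw s).
  elim: s st {bs rs js} => [//|x s IH] st.
  rewrite map_cons /syllable_word /syllables /= !acts_cat acts_xword.
  by case: st => p q; rewrite addv0 /= -IH; case: x.
have -> : syllables (map (rule_syllable (@zero I)) s ++ (edge_syllables z t).1) =
    syllable_word (map (rule_syllable (@zero I)) s) ++ syllable_word (edge_syllables z t).1.
  by rewrite /syllable_word /syllables map_cat flatten_cat.
rewrite /value acts_cat acts_edge_syllables; last exact: acts_normal.
by rewrite -sr -acts_cat catA.
Qed.

Local Notation ecoset := (@coset D edges).

Inductive coset_conn (S : nat) : set (word D) -> Prop :=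
| coset_conn_nil : coset_conn S (ecoset [::])
| coset_conn_step g g' x : coset_conn S (ecoset g) -> size g' <= S ->
    ecoset g' = ecoset (rl x :: g) -> coset_conn S (ecoset g').

Lemma ecoset_move c e z z' : affine_move c e z z' -> ecoset (rl (c, e) :: xw z) = ecoset (xw z').
Proof.
move=> mv; rewrite (coset_group_eq _ (move_group_eq mv)).
exact/coset_cat/subgroup_ew.
Qed.

Lemma ecoset_consE x g g' : ecoset g = ecoset g' -> ecoset (rl x :: g) = ecoset (rl x :: g').
Proof. by move/(coset_shift _ [:: rl x]). Qed.

Lemma rl_flip (x : C * bool) : rl (flip x) = @inv_letter D (rl x).
Proof. by []. Qed.

Lemma ecoset_push x s w : ecoset (rl x :: rw s ++ w) = ecoset (rw (push x s) ++ w).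
Proof.
case: s => [//|y s] /=; case: eqP => [->|//]; apply: coset_group_eq.
apply: (@group_eq_catr _ (rw s ++ w) [:: rl x; rl (flip x)] [::]).
exact: (group_eq_inv (rl x)).
Qed.

Definition zsize (n : nat) : nat := (kappa.+1 + 1) * ((edge_size + 2) * n).

Lemma bounded_leq (k k' : nat) z : k <= k' -> bounded k z -> bounded k' z.
Proof. by move=> lek bz i; apply: Z.le_trans (bz i) _; apply: Z.pow_le_mono_r; lia. Qed.

Lemma xw_bounded w z : group_eq w (xw z) -> bounded ((kappa.+1 + 1) * size w) z.
Proof.
move=> e; have := value_bounded modulus_gt0 modulus_le (w := w).
by rewrite (value_group_eq modulus_gt0 e) value_xword.
Qed.

(** As g^-1 x^z lies in E and [theta] erases x, it equals theta(g)^-1. So x^z = g theta(g)^-1, a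
    word of length linear in that of g, and z has linearly many bits. *)
Lemma ecoset_bounded g n z : size g <= n -> ecoset g = ecoset (xw z) -> bounded (zsize n) z.
Proof.
move=> leg /coset_eq /subgroup_theta; rewrite theta_cat theta_xw cats0 theta_inv => e.
have e' : group_eq (g ++ inv_word (theta g)) (xw z).
  apply: (group_eq_trans (group_eq_catl _ (group_eq_sym e))); rewrite catA.
  by apply: (@group_eq_catr _ _ _ [::]); exact: group_eq_invr.
apply: bounded_leq (xw_bounded e'); rewrite leq_mul2l; apply/orP; right.
rewrite size_cat size_inv; have := size_theta g.
have : edge_size * size g <= edge_size * n by rewrite leq_mul2l leg orbT.
by slia.
Qed.

(** A letter that finds a matching move is absorbed into the vector; otherwise it starts a word [s],
    which from then on is only reduced freely. Such an excursion can return only through the vector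
    where it began. *)
Lemma coset_conn_core S X : coset_conn S X -> exists s z,
  [/\ reduced s, junk s z, affine_conn (zsize S) z & X = ecoset (rw s ++ xw z)].
Proof.
elim=> [|g g' [c e] _ [s [z [rs js cz E]]] leg' E'].
  exists [::], (@zero I); split=> //; first exact: affine_conn0.
  by rewrite /xw xword_zero.
rewrite (ecoset_consE _ E) in E'.
case: s rs js E E' => [|x s] rs js E E'.
  have [[z' mv]|nmv] := pselect (exists z', affine_move c e z z').
    rewrite [rw _ ++ _]/= (ecoset_move mv) in E'.
    exists [::], z'; split=> //; apply: affine_conn_step cz _ mv.
    exact: ecoset_bounded leg' E'.
  exists [:: (c, e)], z; split=> // z' mv; apply: nmv; by exists z'.
exists (push (c, e) (x :: s)), z; split=> //; last by rewrite E' ecoset_push.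
- exact: push_reduced.
- move: js; rewrite /push; case: eqP => _ //=.
  by case: s {rs E E'}.
Qed.

(** The representative of the right-hand side has no stable letters, whereas [core_size] finds at
    least those of [s] on the left. *)
Lemma core_config s z z' : reduced s -> junk s z ->
  ecoset (rw s ++ xw z) = ecoset (xw z') -> s = [::] /\ z = z'.
Proof.
move=> rs js /coset_eq /subgroup_theta.
rewrite inv_cat theta_cat theta_xw cats0 theta_cat -rw_finv -/(ew _) theta_inv theta_xw cat0s.
rewrite -catA rw_finv => e.
have e' : group_eq (rw s ++ xw z ++ ew (fred (finv s))) (xw z').
  apply: (@group_eq_trans _ _ ((rw s ++ xw z) ++ ew (finv s))).
    by rewrite catA; apply: group_eq_catl; apply: group_eq_sym; exact: ew_fred.
  apply: (group_eq_trans (group_eq_catl _ (group_eq_sym e))).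
  have -> : inv_word (xw z) ++ inv_word (rw s) ++ xw z' = inv_word (rw s ++ xw z) ++ xw z'.
    by rewrite inv_cat -catA.
  by rewrite catA; apply: (@group_eq_catr _ _ _ [::]); exact: group_eq_invr.
have := core_size rs (fred_reduced (finv s)) js.
rewrite (value_group_eq modulus_gt0 e') value_xword => /esym/eqP; rewrite addn_eq0.
case/andP => /nilP s0 _; split=> //; subst s; apply: xw_inj.
by move: e'; rewrite /= cats0.
Qed.

(** The retraction [theta] makes the factor from E explicit, [core_size] bounds the outer factors by
    the length of [g], and then x^z can be solved for by a word of linear length. *)
Lemma core_factor g s z : reduced s -> junk s z -> ecoset g = ecoset (rw s ++ xw z) ->
  exists t, [/\ group_eq g (rw s ++ xw z ++ ew t), size s <= size g, size t <= size g &
    bounded (zsize (size g)) z].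
Proof.
move=> rs js /esym/coset_eq /subgroup_theta.
have -> : theta (inv_word (rw s ++ xw z) ++ g) = ew (finv s ++ rules_of g).
  by rewrite theta_cat theta_inv theta_cat theta_xw cats0 ew_cat ew_finv (theta_rules g).
move=> e.
pose t := fred (finv s ++ rules_of g).
have e' : group_eq g (rw s ++ xw z ++ ew t).
  rewrite catA; apply: (@group_eq_trans _ _ ((rw s ++ xw z) ++ inv_word (rw s ++ xw z) ++ g)).
    by rewrite catA; apply: (@group_eq_catr _ _ [::]); apply: group_eq_sym; exact: group_eq_invr.
  by apply: group_eq_catl; exact: group_eq_trans e (ew_fred _).
have := core_size rs (fred_reduced (finv s ++ rules_of g)) js.
rewrite -/t -(value_group_eq modulus_gt0 e') => est; have := size_value g.
rewrite est => leg; have les : size s <= size g by apply: leq_trans leg; rewrite leq_addr.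
have let' : size t <= size g by apply: leq_trans leg; rewrite leq_addl.
exists t; split=> //.
have ez : group_eq (inv_word (rw s) ++ g ++ inv_word (ew t)) (xw z).
  apply: (@group_eq_trans _ _ (inv_word (rw s) ++ (rw s ++ xw z ++ ew t) ++ inv_word (ew t))).
    by apply: group_eq_catl; exact: group_eq_catr.
  rewrite !catA -[((_ ++ xw z) ++ _) ++ _]catA -[X in group_eq _ X]cats0.
  apply: group_eq_cat; last exact: group_eq_invr.
  by apply: (@group_eq_catr _ _ _ [::]); exact: group_eq_invl.
apply: bounded_leq (xw_bounded ez); rewrite leq_mul2l; apply/orP; right.
rewrite !size_cat !size_inv size_map; have := size_theta (rw t); rewrite size_map -/(ew t).
have : edge_size * size t <= edge_size * size g by rewrite leq_mul2l let' orbT.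
by slia.
Qed.

Definition base_cost : nat := @tower_cost I (option C) modulus kappa.+1.
Definition digit_cost : nat := @unit_cost I (option C) modulus kappa.+1.
Definition zt (k : nat) z : word D := @zeta I (option C) modulus None k z.

Lemma base_kill n w : size w <= n -> group_eq w [::] -> kill (base_cost * n.+1) w.
Proof. exact: (tower_kill modulus_gt0 modulus_le modulus_None). Qed.

Lemma size_zt k z : bounded k z -> size (zt k z) <= digit_cost * k.+1.
Proof. exact: size_zeta_cost. Qed.

Lemma zt_group_eq k z : bounded k z -> group_eq (zt k z) (xw z).
Proof.
elim/vec_ind: z => [_|z i e mono IH bz'].
  by rewrite /xw xword_zero; exact: conv_group_eq (conv_zeta_zero modulus kappa.+1 None k).1.
have bz : bounded k z by move=> j; apply: Z.le_trans (mono j) (bz' j).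
have c := @conv_zeta_step I (option C) modulus modulus_gt0 kappa.+1 None modulus_None k z i e bz.
apply: (group_eq_trans (group_eq_sym (conv_group_eq c))).
apply: (group_eq_trans (group_eq_catr _ (IH bz))).
apply: (value_eq modulus_gt0 modulus_le modulus_None).
by rewrite value_xword; exact: (@value_is_x_rcons I (option C) modulus z i e).
Qed.

Definition middle_group : presentation := @adjoin D edges.
Local Notation B := middle_group.
Implicit Types v : word B.

Definition up (w : word D) : word B := @lift D w.
Lemma size_up w : size (up w) = size w.
Proof. exact: size_map. Qed.

Definition tt e : word B := [:: (None, e)].

Definition middle_cost : nat := base_cost * (edge_size + 2) * 2 + edge_size * 40 + 60.

(** [h] equals the product [theta h] of edges, each of which commutes with t by a relator; only the
    change from [h] to this product uses the space bound of the base group. *)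
Lemma kill_edge_commutator n h : size h <= n -> subgroup edges h ->
  @kill B (middle_cost * n.+1) (@commutator D h).
Proof.
move=> leh sh; have lt := size_theta h.
have es : edge_size * size h <= edge_size * n by rewrite leq_mul2l leh orbT.
have k1 : kill (base_cost * ((edge_size + 1) * n).+1) (h ++ inv_word (theta h)).
  apply: base_kill; first by rewrite size_cat size_inv mulnDl mul1n; slia.
  by apply/group_eq_mulV; exact: subgroup_theta.
have k2 : @kill B ((edge_size).+1.*2 + size (theta h) * 4 + 8) (@commutator D (theta h)).
  apply: kill_commutator_flatten => u /mapP[x _ ->].
  have kc c : @kill B (edge_size).+1.*2 (@commutator D (edge c)).
    apply: (kill_leq _ (kill_commutator_gen (edge_mem c))).
    by rewrite leq_double ltnS; exact: (@leq_bigmax _ (fun c => size (edge c)) c).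
  case: x => [[i|[c|]] []]; rewrite /subst_letter /=; try (apply: (@kill_leq B 2);
    [by slia|by apply: kill_conv0; apply: (conv_remove (@elementary_inv B (None, false)))]).
    exact: kill_commutator_inv.
  exact: kc.
apply: (kill_commutator_eq k1 k2).
  by rewrite /middle_cost; nia.
rewrite /middle_cost.
have : base_cost * ((edge_size + 1) * n).+1 <= base_cost * ((edge_size + 2) * n.+1).
  by rewrite leq_mul2l; apply/orP; right; nia.
by nia.
Qed.

Lemma middle_kill n v : size v <= n -> group_eq v [::] -> kill ((middle_cost + 4) * n.+1) v.
Proof.
move=> lev ev; apply: (@kill_leq _ (middle_cost * n.+1 + n * 4)); first by nia.
apply: (adjoin_kill _ _ lev ev) => [w lew ew|h leh sh]; last exact: kill_edge_commutator.
apply: kill_leq (base_kill lew ew); rewrite leq_mul2r; apply/orP; right.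
by rewrite /middle_cost; nia.
Qed.

Definition rule_words : seq (word B) := [seq up [:: rl (c, false)] | c <- enum C].
Definition stable_words : seq (word B) := tt false :: rule_words.
Definition full_group : presentation := @adjoin B stable_words.
Local Notation G := full_group.
Definition comm v : word G := @commutator B v.

Lemma kill_comm_tt e : @kill G 4 (comm (tt e)).
Proof.
have k : @kill G 4 (comm (tt false)).
  exact: (@kill_commutator_gen B stable_words (tt false) (mem_head _ _)).
by case: e => //; exact: (kill_commutator_inv k).
Qed.

Lemma kill_comm_rule x : @kill G 4 (comm (up [:: rl x])).
Proof.
have k c : @kill G 4 (comm (up [:: rl (c, false)])).
  apply: (@kill_commutator_gen B stable_words (up [:: rl (c, false)])).
  by rewrite inE; apply/orP; right; apply: map_f; rewrite mem_enum.
by case: x => c []; [exact: (kill_commutator_inv (k c))|exact: k].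
Qed.

Definition conj_tt g e : word B := up g ++ tt e ++ up (inv_word g).

Lemma size_conj_tt g e : size (conj_tt g e) = (size g).*2.+1.
Proof. by rewrite !size_cat !size_map size_inv /=; slia. Qed.

Lemma conj_tt_edge h d : subgroup edges h ->
  group_eq (up h ++ tt d ++ up (inv_word h)) (tt d).
Proof.
move=> sh; have : group_eq (up h ++ tt false ++ up (inv_word h)) (tt false).
  apply/group_eq_mulV; rewrite -!catA.
  have := kill_group_eq (kill_commutator_inv (kill_edge_commutator (leqnn _) sh)).
  have -> : commutator (inv_word h) = (tt false ++ up (inv_word h) ++ tt true) ++ up h.
    by rewrite /commutator inv_wordK /= -catA.
  exact: group_eq_rot.
by case: d => // /group_eq_inv_word; rewrite /up !inv_cat -!lift_inv inv_wordK -catA.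
Qed.

Lemma conj_tt_coset g g' e : @coset D edges g = @coset D edges g' ->
  group_eq (conj_tt g e) (conj_tt g' e).
Proof.
move/coset_eq => sh; set h := inv_word g ++ g' in sh.
have hg : group_eq (up g') (up (g ++ h)).
  apply: lift_group_eq; rewrite /h catA; apply: (@group_eq_catr _ _ [::]).
  by apply: group_eq_sym; exact: group_eq_invr.
have := group_eq_inv_word hg; rewrite /up -!lift_inv inv_cat => hgV.
clearbody h.
apply: group_eq_sym; apply: (group_eq_trans (group_eq_cat hg (group_eq_catl _ hgV))).
rewrite /conj_tt /up !lift_cat -!catA; apply: group_eq_catl.
by rewrite !catA; apply: group_eq_catr; rewrite -catA; exact: conj_tt_edge.
Qed.

Definition path_cost : nat := (middle_cost + 4) * (digit_cost * 8 + 8) * 2 + digit_cost * 100 + 100.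

Lemma middle_commutator_eq n S v v' : size v <= n -> size v' <= n -> group_eq v v' ->
  @kill G S (comm v') -> (middle_cost + 4) * (n * 2).+1 * 2 + n * 16 + 4 <= S -> @kill G S (comm v).
Proof.
move=> lev lev' e kv' le.
have k : kill ((middle_cost + 4) * (n * 2).+1) (v ++ inv_word v').
  apply: middle_kill; first by rewrite size_cat size_inv; slia.
  exact/group_eq_mulV.
by apply: (kill_commutator_eq k kv' (leqnn _)); slia.
Qed.

Lemma affine_conn_bounded k z : affine_conn k z -> bounded k z.
Proof. by case=> // i; rewrite /zero /=; lia. Qed.

Lemma coset_zt k z : bounded k z -> @coset D edges (zt k z) = @coset D edges (xw z).
Proof. by move=> bz; apply: coset_group_eq; exact: zt_group_eq. Qed.

(** Along a move, the conjugate of t belonging to the new vector is that of the old one conjugated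
    by a letter r_c, which commutes with k. Both [kill_commutator_conj] and [middle_commutator_eq]
    take maxima, so the length of the path does not matter. *)
Lemma kill_path k z e : affine_conn k z ->
  @kill G (path_cost * k.+1) (comm (conj_tt (zt k z) e)).
Proof.
have d1 : 0 < digit_cost by rewrite /digit_cost /unit_cost; slia.
elim=> [|c d y y' cy IH by' mv].
  have b0 : bounded k (@zero I) by move=> i; rewrite /zero /=; lia.
  have sz := size_zt b0; have d2 : digit_cost <= digit_cost * k.+1 by rewrite leq_pmulr.
  apply: (@middle_commutator_eq (digit_cost * k.+1 * 2 + 1) _ _ (tt e)) => //.
  - by rewrite size_conj_tt; slia.
  - by rewrite /=; slia.
  - apply: (@conj_tt_coset (zt k (@zero I)) [::] e).
    by rewrite coset_zt // /xw xword_zero.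
  - by apply: kill_leq (kill_comm_tt e); rewrite /path_cost; nia.
  - by rewrite /path_cost; nia.
have bnd := affine_conn_bounded cy; have sz := size_zt bnd; have sz' := size_zt by'.
have d2 : digit_cost <= digit_cost * k.+1 by rewrite leq_pmulr.
apply: (@middle_commutator_eq (digit_cost * k.+1 * 2 + 3) _ _ (conj_tt (rl (c, d) :: zt k y) e)).
- by rewrite size_conj_tt; slia.
- by rewrite size_conj_tt [size (_ :: _)]/=; slia.
- apply: conj_tt_coset; rewrite coset_zt // -(ecoset_move mv).
  by apply: ecoset_consE; rewrite coset_zt.
- have -> : conj_tt (rl (c, d) :: zt k y) e =
      up [:: rl (c, d)] ++ conj_tt (zt k y) e ++ inv_word (up [:: rl (c, d)]).
    by rewrite /conj_tt inv_cons /up lift_cat -lift_inv -!catA.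
  apply: (kill_commutator_conj (kill_comm_rule (c, d)) IH) => //.
  rewrite size_conj_tt -muln2 [size (up _)]/= /path_cost.
  by move: sz; set x := size _ => sz; nia.
- by rewrite /path_cost; nia.
Qed.

Definition conj_cost : nat :=
  path_cost + (middle_cost + 4) * (digit_cost * 8 + 8) * 4 + digit_cost * 200 + 200.

Lemma kill_conj S s v : kill S (comm v) -> (size v + size s * 2) * 4 + 24 <= S ->
  kill S (comm (up (rw s) ++ v ++ inv_word (up (rw s)))).
Proof.
move=> kv; elim: s => [|x s IH] le; first by rewrite /= cats0.
have -> : up (rw (x :: s)) ++ v ++ inv_word (up (rw (x :: s))) =
    up [:: rl x] ++ (up (rw s) ++ v ++ inv_word (up (rw s))) ++ inv_word (up [:: rl x]).
  by rewrite -[rw (x :: s)]cat1s /up lift_cat inv_cat -!catA.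
apply: (kill_commutator_conj (kill_comm_rule x) (IH _)) => //.
  by move: le => /=; slia.
by move: le; rewrite !size_cat size_inv !size_map /=; slia.
Qed.

Lemma kill_conj_tt k n g s z e : size s <= n -> size g <= n -> affine_conn k z ->
  @coset D edges g = @coset D edges (rw s ++ xw z) ->
  @kill G (conj_cost * (k + n).+1) (comm (conj_tt g e)).
Proof.
move=> les leg cz E; have bz := affine_conn_bounded cz; have sz := size_zt bz.
apply: (@middle_commutator_eq (digit_cost * k.+1 * 2 + n * 2 + 1) _ _ (conj_tt (rw s ++ zt k z) e)).
- by rewrite size_conj_tt; slia.
- by rewrite size_conj_tt size_cat size_map; slia.
- apply: conj_tt_coset; rewrite E; apply: coset_group_eq; apply: group_eq_catl.
  by apply: group_eq_sym; exact: zt_group_eq.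
- have -> : conj_tt (rw s ++ zt k z) e =
      up (rw s) ++ conj_tt (zt k z) e ++ inv_word (up (rw s)).
    by rewrite /conj_tt inv_cat /up !lift_cat -lift_inv -!catA.
  apply: kill_conj; first by apply: kill_leq (kill_path e cz); rewrite /conj_cost; nia.
  by rewrite size_conj_tt -muln2 /conj_cost; nia.
- by rewrite /conj_cost; nia.
Qed.

Local Notation bcosets := (@cosets D edges).

Lemma coset_conn_leq S S' X : S <= S' -> coset_conn S X -> coset_conn S' X.
Proof.
move=> le; elim=> [|g g' x _ IH leg E]; first exact: coset_conn_nil.
by apply: coset_conn_step IH _ E; exact: leq_trans leg le.
Qed.

Definition rules_only v : Prop := group_eq (down v) (phi (down v)).

(** A description of the subgroup generated by t and the letters r_c: erasing t leaves an element
    fixed by the retraction [phi], and the cosets that survive free reduction are reachable. *)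
Definition good v : Prop := rules_only v /\
  forall X, X \in unzip1 (fred (bcosets [::] v)) -> exists S, coset_conn S X.

Lemma rules_only_eq v v' : group_eq v v' -> rules_only v -> rules_only v'.
Proof.
move=> /down_group_eq e rv; apply: (group_eq_trans (group_eq_sym e)).
exact: (group_eq_trans rv (phi_group_eq e)).
Qed.

Lemma rules_only_cat v v' : rules_only v -> rules_only v' -> rules_only (v ++ v').
Proof. by move=> r1 r2; rewrite /rules_only !down_cat phi_cat; exact: group_eq_cat. Qed.

Lemma rules_only_inv v : rules_only v -> rules_only (inv_word v).
Proof. by move=> r; rewrite /rules_only down_inv phi_inv; exact: group_eq_inv_word. Qed.

Lemma good_eq v v' : group_eq v v' -> good v -> good v'.
Proof.
move=> e [rv cv]; split; first exact: rules_only_eq rv.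
by rewrite -(cosets_group_eq e).
Qed.

Lemma stable_wordsP h : h \in stable_words ->
  h = tt false \/ exists c, h = up [:: rl (c, false)].
Proof. by rewrite inE => /orP[/eqP->|/mapP[c _ ->]]; [left|right; exists c]. Qed.

Lemma good_tt e v : good v -> good (tt e ++ v).
Proof.
case=> rv cv; split; first by apply: rules_only_cat => //; exact: group_eq_refl.
rewrite cosets_cat => X /mapP[y yP ->].
have /fred_subset_cat[] : y \in fred ([:: (@coset D edges [::], e)] ++ bcosets [::] v) := yP.
  by rewrite inE => /eqP-> /=; exists 0; exact: coset_conn_nil.
by move=> h; apply: cv; exact: map_f.
Qed.

Lemma good_rule x v : good v -> good (up [:: rl x] ++ v).
Proof.
case=> rv cv; split.
  apply: rules_only_cat => //; rewrite /rules_only liftK /phi /subst /= cats0.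
  by case: x => c []; exact: group_eq_refl.
move=> X; rewrite cosets_cat cosets_lift liftK cat0s.
rewrite (cosets_translate [:: rl x] [::]) => /mem_fred_map[Y mY ->].
have [S cY] := cv _ mY.
have {}mY : Y \in unzip1 (bcosets [::] v).
  by case/mapP: mY => y /fred_subset yP ->; exact: map_f.
have [u _ EY] := mem_cosets mY.
rewrite EY translate_coset.
rewrite EY in cY; exists (maxn S (size (down u)).+1).
by apply: coset_conn_step (coset_conn_leq (leq_maxl _ _) cY) _ _ => //; exact: leq_maxr.
Qed.

Lemma good_subgroup v : subgroup stable_words v -> good v.
Proof.
elim=> [|h u hP _ IH|h u hP _ IH|u u' e _ IH].
- by split=> //; exact: group_eq_refl.
- case/stable_wordsP: hP => [->|[c ->]]; [exact: good_tt|exact: good_rule].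
- case/stable_wordsP: hP => [->|[c ->]]; first exact: (@good_tt true).
  exact: (@good_rule (c, true)).
- exact: good_eq IH.
Qed.

(** * Upper bound: removing the words equal to 1 *)

Section UpperBound.

Variables (F : nat -> nat).
Hypothesis F_conn : forall k z, bounded k z -> (exists k', affine_conn k' z) -> affine_conn (F k) z.

Definition stable_cost : nat := conj_cost + (middle_cost + 4) * 100 + 200.
Definition bound (n : nat) : nat := stable_cost * (F (zsize n) + n).+1.

Lemma kill_factor n g e : size g <= n -> (exists S, coset_conn S (@coset D edges g)) ->
  @kill G (conj_cost * (F (zsize (size g)) + n).+1) (comm (conj_tt g e)).
Proof.
move=> leg [S cS]; have [s [z [rs js cz E]]] := coset_conn_core cS.
have [t [_ les _ bz]] := core_factor rs js E.
apply: (@kill_conj_tt _ n g s z) => //; first exact: leq_trans les leg.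
by apply: F_conn => //; exists (zsize S).
Qed.

Lemma kill_rule_word s : @kill G (12 + size s * 4) (comm (up (rw s))).
Proof.
elim: s => [|x s IH].
  apply: (@kill_leq G 2) => //; apply: kill_conv0.
  exact: (conv_remove (@elementary_inv G (None, false))).
rewrite -[rw (x :: s)]cat1s /up lift_cat.
have s1 : size (up [:: rl x]) = 1 by []; have su : size (up (rw s)) = size s.
  by rewrite size_up size_map.
by apply: (kill_commutator_cat (kill_comm_rule x) IH); rewrite ?s1 ?su /=; slia.
Qed.

(** Induction on the length. A pinch is replaced by its middle part; without pinches every coset met
    by [v] survives and is reachable, so the first conjugate of t can be removed by
    [kill_factor]. *)
Lemma kill_stable n v : (forall m, m <= n -> F (zsize m) <= F (zsize n)) -> size v <= n -> good v ->
  @kill G (bound n) (comm v).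
Proof.
move=> Fmono; have [m] := ubnP (size v); elim: m v => // m IH v /ltnSE lem len gv.
have [rc|nrc] := boolP (reduced (bcosets [::] v)); last first.
  have [w1 [h [w2 [e [Ev sh]]]]] := pinch nrc.
  have lev : size (w1 ++ up h ++ w2) < size v.
    have lh := size_lift h; rewrite Ev !size_cat size_up /= !size_cat /=; slia.
  have ev : group_eq v (w1 ++ up h ++ w2).
    rewrite Ev; apply: group_eq_catl; apply: group_eq_catr.
    apply/group_eq_mulV.
    have k1 := kill_edge_commutator (leqnn _) sh.
    have k2 := kill_edge_commutator (leqnn _) (subgroup_inv sh).
    rewrite size_inv in k2; exact: kill_group_eq (kill_pinch e k1 k2).
  apply: (middle_commutator_eq len (leq_trans (ltnW lev) len) ev (IH _ _ _ _)).
  - exact: leq_trans lev lem.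
  - exact: leq_trans (ltnW lev) len.
  - exact: good_eq ev gv.
  - by rewrite /bound /stable_cost; nia.
case: gv => rv cv; rewrite (reduced_fred rc) in cv.
case E: (bcosets [::] v) => [|[X e] s].
  have Ev := cosets_nil E; rewrite /rules_only phi_rules in rv.
  have ld : size (down v) <= n := leq_trans (size_down v) len.
  apply: (@middle_commutator_eq n _ v (up (rw (rules_of (down v))))) => //.
  - by rewrite size_lift size_map; exact: leq_trans (size_rules _) ld.
  - by rewrite {1}Ev; exact: lift_group_eq rv.
  - apply: kill_leq (kill_rule_word _).
    by have := size_rules (down v); rewrite /bound /stable_cost; nia.
  - by rewrite /bound /stable_cost; nia.
have [w1 [w2 [Ev E1 EX E2]]] := @cosets_split D edges [::] v [::] (X, e) s E.
have Ew1 := cosets_nil E1; set g := down w1 in Ew1 EX E2.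
have sv : size v = size g + (size w2).+1 by rewrite Ev size_cat Ew1 size_lift.
have leg : size g <= n by slia.
(* Here v = (g t^e g^-1)(g w2), and the second factor is one letter shorter than v. *)
pose v2 := up g ++ w2.
have ev : group_eq v (conj_tt g e ++ v2).
  rewrite Ev Ew1 /conj_tt /v2 -!catA; apply: group_eq_catl; apply: (@group_eq_catl _ (tt e)).
  rewrite catA; apply: group_eq_sym; apply: (@group_eq_catr _ _ _ [::]).
  by rewrite /up (lift_inv edges); exact: group_eq_invl.
have gv2 : good v2.
  split.
    rewrite /rules_only /v2 down_cat liftK.
    have -> // : g ++ down w2 = down v.
    by rewrite Ev Ew1 down_cat liftK.
  rewrite cosets_cat cosets_lift liftK cat0s -[_ ++ g]/g.
  have -> : bcosets g w2 = s by rewrite -E2.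
  rewrite reduced_fred => [Y mY|].
    by apply: cv; rewrite E inE mY orbT.
  by move: rc; rewrite E reduced_cons => /andP[].
have sv2 : size v2 = size g + size w2 by rewrite size_cat size_lift.
(* The second factor waits while the first one is removed; the slack for this is part of
   [stable_cost]. *)
have kX : kill (bound n - n * 20) (comm (conj_tt g e)).
  have cX : exists S, coset_conn S (@coset D edges g).
    by apply: cv; rewrite E inE -[@coset D edges g]EX eqxx.
  apply: kill_leq (kill_factor e leg cX).
  have := Fmono _ leg; rewrite /bound /stable_cost; nia.
have kv2 : @kill G (bound n) (comm v2) by apply: IH => //; rewrite sv2; slia.
apply: (@middle_commutator_eq (n * 3 + 1) _ v (conj_tt g e ++ v2)) => //.
- by slia.
- by rewrite size_cat size_conj_tt sv2; slia.
- apply: (kill_commutator_cat kX kv2); rewrite ?size_conj_tt ?sv2 //; try slia.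
  rewrite /bound /stable_cost; slia.
- by rewrite /bound /stable_cost; nia.
Qed.

Theorem full_kill n (w : word G) : (forall m m', m <= m' -> F m <= F m') ->
  size w <= n -> group_eq w [::] -> kill (bound n + n * 4) w.
Proof.
move=> Fmono lew ew; apply: (adjoin_kill _ _ lew ew) => [v lev ev|h leh sh].
  apply: kill_leq (middle_kill lev ev); rewrite /bound /stable_cost; nia.
apply: kill_stable => // [m lem|]; last exact: good_subgroup.
by apply: Fmono; rewrite /zsize !leq_mul2l lem !orbT.
Qed.

End UpperBound.

(** * Lower bound: test words *)

(* The commutator of [k] and x^z t x^(-z). *)
Definition test_word n z : word G := comm (conj_tt (zt n z) false).

Lemma size_test_word n z : bounded n z -> size (test_word n z) <= (digit_cost * 4 + 4) * n.+1.
Proof.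
move=> /size_zt; rewrite /test_word size_commutator size_conj_tt -!muln2; nia.
Qed.

Lemma test_word_group_eq n k z : bounded n z -> affine_conn k z -> group_eq (test_word n z) [::].
Proof.
move=> bz cz; apply: kill_group_eq.
apply: (@kill_conj_tt k (size (zt n z)) (zt n z) [::] z) => //.
by apply: coset_group_eq; exact: zt_group_eq.
Qed.

(* Elements of [<t, R>] all of whose surviving cosets are reached from the
   base coset by a path of short cosets. *)
Definition short_good (s : nat) v : Prop := rules_only v /\
  forall X, X \in unzip1 (fred (bcosets [::] v)) -> coset_conn (s * 2) X.

(** The suffixes of [rw r ++ p] have at most s + s letters, which is why reachability is tracked
    with the bound [s * 2]. *)
Lemma coset_conn_unwind s r p : coset_conn (s * 2) (@coset D edges (rw r ++ p)) ->
  size r <= s -> size p <= s -> coset_conn (s * 2) (@coset D edges p).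
Proof.
elim: r => [//|x r IH] cx /= ler lep; apply: IH => //; last exact: ltnW.
apply: (@coset_conn_step _ _ _ (flip x) cx); first by rewrite size_cat size_map; slia.
apply: coset_group_eq; apply: group_eq_sym.
by apply: (@group_eq_catr _ (rw r ++ p) [:: rl (flip x); rl x] [::]);
   have := group_eq_inv (rl (flip x)); rewrite -rl_flip flipK.
Qed.

(** From v = u w, the surviving cosets of [w], translated by g = [down u], occur among those of [u]
    and [v]. Since g equals its image under [phi], a product of at most s letters r_c, the
    translation is undone letter by letter. *)
Lemma short_good_div s (u v w : word B) : size u <= s -> size v <= s -> size w <= s ->
  short_good s u -> short_good s v -> group_eq w (inv_word u ++ v) -> short_good s w.
Proof.
move=> leu lev lew [ru cu] [rv cv] e; split.
  apply: rules_only_eq (group_eq_sym e) _; apply: rules_only_cat => //.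
  exact: rules_only_inv.
set g := down u; have e' : group_eq (u ++ w) v.
  apply: (group_eq_trans (group_eq_catl u e)); rewrite catA.
  by apply: (@group_eq_catr _ _ _ [::]); exact: group_eq_invr.
have := cosets_group_eq e' [::]; rewrite cosets_cat cat0s -/g => /fred_solve fs X mX.
have [p lep EX] : exists2 p : word D, size p <= s & X = @coset D edges p.
  have : X \in unzip1 (bcosets [::] w).
    by case/mapP: mX => y /fred_subset yP ->; exact: map_f.
  case/mem_cosets => q leq ->; exists (down q) => //.
  by apply: leq_trans (size_down q) _; exact: leq_trans leq lew.
move: mX; rewrite (cosets_group_eq_base _ (group_eq_sym (group_eq_invl g))) cosets_translate.
case/mem_fred_map=> Y mY EX'.
have cY : coset_conn (s * 2) Y.
  move: mY; rewrite fs => /mapP[y /fred_subset_cat[] yP ->].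
    by apply: cu; apply: mem_finv; move/fred_subset/(map_f fst): yP.
  by apply: cv; apply: map_f; move: yP; rewrite /fred foldr_push_fred.
have EY : Y = @coset D edges (g ++ p).
  have : Y \in unzip1 (bcosets g w).
    by case/mapP: mY => y /fred_subset yP ->; exact: map_f.
  case/mem_cosets => q _ EY; move: EX'; rewrite EX EY translate_coset.
  move/(coset_shift _ g) => ->; apply: coset_group_eq; rewrite catA.
  by apply: (@group_eq_catr _ _ [::]); exact/group_eq_sym/group_eq_invr.
rewrite EX; apply: (@coset_conn_unwind _ (rules_of g)) => //.
  have <- : Y = @coset D edges (rw (rules_of g) ++ p).
    by rewrite EY -phi_rules; apply: coset_group_eq; exact: group_eq_catr.
  exact: cY.
by apply: leq_trans (size_rules _) _; exact: leq_trans (size_down _) leu.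
Qed.

(** [short_good] is an admissible property for [adjoin_kill_commutator], so the only coset of the
    test word is reachable through short cosets; by [core_config] the vector found on the way is z
    itself. *)
Theorem kill_test_word s n z : bounded n z -> kill s (test_word n z) ->
  affine_conn (zsize (s * 2)) z.
Proof.
move=> bz k.
have [_] : short_good s (conj_tt (zt n z) false).
  apply: (@adjoin_kill_commutator B stable_words s (short_good s)) k.
  - by move=> v v' e [rv cv]; split; [exact: rules_only_eq rv|rewrite -(cosets_group_eq e)].
  - by split=> //; exact: group_eq_refl.
  - move=> h /stable_wordsP[->|[c ->]].
      by split; (split; [exact: group_eq_refl|
        move=> X; rewrite inE => /eqP->; exact: coset_conn_nil]).
    by split; split; [exact: group_eq_refl|move=> X /=|exact: group_eq_refl|move=> X /=].
  - exact: short_good_div.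
rewrite /conj_tt cosets_cat cosets_lift cat0s liftK cosets_cat cosets_lift cats0.
move/(_ _ (mem_head _ _)) => /coset_conn_core[r [y [rr jr cy]]].
rewrite cat0s (coset_zt bz) => /esym/core_config[] // _ <-.
exact: cy.
Qed.

End AffineMachine.

(** * Stack machines as affine machines *)

Section StackCode.

Variable T : finType.
Implicit Types (l s : seq T) (x : T).

Definition radix : Z := Z.of_nat #|T|.+1.
(** Digits start at 1, so that no list ends in an invisible zero. *)
Definition digit x : Z := Z.of_nat (enum_rank x).+1.

Fixpoint code l : Z := if l is x :: l' then (digit x + radix * code l')%Z else 0%Z.
Definition power l : Z := (radix ^ Z.of_nat (size l))%Z.

Lemma digit_bounds x : (1 <= digit x < radix)%Z.
Proof.
rewrite /digit /radix; have h : enum_rank x < #|T| := ltn_ord _; move: h.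
by set n := #|T|; lia.
Qed.

Lemma digit_inj x y : digit x = digit y -> x = y.
Proof. by rewrite /digit => /Nat2Z.inj[e]; apply: enum_rank_inj; exact: val_inj. Qed.

Lemma radix_ge1 : (1 <= radix)%Z.
Proof. by rewrite /radix; lia. Qed.

Lemma power_gt0 l : (0 < power l)%Z.
Proof. by apply: Z.pow_pos_nonneg; have := radix_ge1; lia. Qed.

Lemma power_cons x l : power (x :: l) = (radix * power l)%Z.
Proof. by rewrite /power -[size (x :: l)]/(size l).+1 Nat2Z.inj_succ Z.pow_succ_r; lia. Qed.

Lemma code_cons x l : code (x :: l) = (digit x + radix * code l)%Z.
Proof. by []. Qed.

Lemma code_cat l s : code (l ++ s) = (code l + power l * code s)%Z.
Proof.
elim: l => [|x l IH]; first by rewrite [power _]/power /=; case: (code s).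
by rewrite cat_cons power_cons !code_cons IH Z.mul_add_distr_l Z.mul_assoc Z.add_assoc.
Qed.

Lemma code_ge0 l : (0 <= code l)%Z.
Proof.
by elim: l => // x l IH; rewrite code_cons; have := digit_bounds x; have := radix_ge1; nia.
Qed.

Lemma code_lt l : (code l < power l)%Z.
Proof.
elim: l => [|x l IH]; first by [].
by rewrite power_cons code_cons; have := digit_bounds x; have := radix_ge1; nia.
Qed.

(** [u] may be any integer: remainders modulo the radix identify the letters of [s] one by one, and
    what is left of [l] forces [u] to be a code. *)
Lemma decode l s u : code l = (code s + power s * u)%Z ->
  exists2 l', l = s ++ l' & u = code l'.
Proof.
elim: s l => [|x s IH] l.
  by rewrite -[power [::]]/1%Z -[code [::]]/0%Z => e; exists l => //; lia.
rewrite power_cons code_cons -Z.mul_assoc -Z.add_assoc -Z.mul_add_distr_l => e.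
have dx := digit_bounds x.
case: l e => [|y l]; rewrite ?code_cons => e.
  have [|||_ E] := Z.div_mod_unique radix 0 (code s + power s * u) 0 (digit x); try lia.
  by rewrite Z.mul_0_r Z.add_0_l -[RHS]Z.add_comm -e.
have dy := digit_bounds y.
have [|||/IH[l' -> ->] exy] := Z.div_mod_unique radix (code l) (code s + power s * u)
    (digit y) (digit x); try lia.
 by exists l' => //; rewrite (digit_inj exy).
Qed.

Lemma code_inj : injective code.
Proof.
move=> l s e; have [|l' -> E] := @decode l s 0; first by rewrite e; lia.
case: l' E => [|x l']; first by rewrite cats0.
by rewrite code_cons; have := digit_bounds x; have := @code_ge0 l'; have := radix_ge1; nia.
Qed.

Lemma code_size l : 1 < #|T|.+1 -> (2 ^ Z.of_nat (size l) <= 2 * code l + 1)%Z.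
Proof.
move=> T1; have r2 : (2 <= radix)%Z by rewrite /radix; lia.
elim: l => // x l IH; rewrite code_cons; have := digit_bounds x; have := @code_ge0 l.
rewrite -[size (x :: l)]/(size l).+1 Nat2Z.inj_succ Z.pow_succ_r; last lia.
by nia.
Qed.

Lemma power_le (mu n : nat) l : (radix <= 2 ^ Z.of_nat mu)%Z -> size l <= n ->
  (power l <= 2 ^ Z.of_nat (mu * n))%Z.
Proof.
move=> rm len; rewrite /power; apply: (@Z.le_trans _ ((2 ^ Z.of_nat mu) ^ Z.of_nat (size l))).
  by apply: Z.pow_le_mono_l; have := radix_ge1; lia.
rewrite -Z.pow_mul_r; try lia; apply: Z.pow_le_mono_r; first by [].
by nia.
Qed.

End StackCode.

Section StackMachine.

Variables (A J Ph C : finType) (ph0 : Ph).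

(* A configuration has a phase, a counter in unary and a family of stacks of
   letters (top first).  The counter measures unused space. *)
Record config := Config { phase : Ph; spare : nat; stack : J -> seq A }.

Record stack_rule := StackRule {
  phase_src : Ph; phase_tgt : Ph;
  spare_src : nat; spare_tgt : nat;
  at_bottom : J -> bool;
  stack_src : J -> seq A; stack_tgt : J -> seq A
}.

Variable rules : C -> stack_rule.

Definition stack_step c (X Y : config) : Prop :=
  [/\ phase X = phase_src (rules c), phase Y = phase_tgt (rules c),
      exists m, spare X = spare_src (rules c) + m /\ spare Y = spare_tgt (rules c) + m &
      forall j, exists l, [/\ stack X j = stack_src (rules c) j ++ l,
        stack Y j = stack_tgt (rules c) j ++ l & at_bottom (rules c) j -> l = [::]]].

Definition total (X : config) : nat := spare X + \sum_j size (stack X j).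

Definition origin : config := Config ph0 0 (fun _ => [::]).

Inductive stack_conn (n : nat) : config -> Prop :=
| stack_conn0 : stack_conn n origin
| stack_conn_step c X Y : stack_conn n X -> total Y <= n ->
    stack_step c X Y \/ stack_step c Y X -> stack_conn n Y.

(* The coordinates are the phase, the counter and the stacks.  The digits are
   the bottom marker, the unary digit, the letters and the phases. *)
Definition digits : finType := (option (option A) + Ph)%type.
Definition mark : digits := inl None.
Definition one : digits := inl (Some None).
Definition ltr (x : A) : digits := inl (Some (Some x)).
Definition coords : finType := option (option J).

Definition encode (X : config) (i : coords) : seq digits :=
  match i with
  | None => [:: inr (phase X)]
  | Some None => nseq (spare X) one ++ [:: mark]
  | Some (Some j) => map ltr (stack X j) ++ [:: mark]
  end.

(* Shifted so that [origin] becomes the vector 0. *)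
Definition vector_of (X : config) (i : coords) : Z :=
  (code (encode X i) - code (encode origin i))%Z.

(** A test for the bottom puts the marker into the prefix to be replaced; as the marker occurs only
    at the end of a stack, nothing can follow it. *)
Definition word_of (p : Ph) (n : nat) (bot : J -> bool) (st : J -> seq A) (i : coords) :
    seq digits :=
  match i with
  | None => [:: inr p]
  | Some None => nseq n one
  | Some (Some j) => map ltr (st j) ++ nseq (bot j) mark
  end.

Definition word_src c : coords -> seq digits :=
  let r := rules c in word_of (phase_src r) (spare_src r) (at_bottom r) (stack_src r).
Definition word_tgt c : coords -> seq digits :=
  let r := rules c in word_of (phase_tgt r) (spare_tgt r) (at_bottom r) (stack_tgt r).

Definition vec_a c i : Z := (code (word_src c i) - code (encode origin i))%Z.
Definition vec_b c i : Z := (code (word_tgt c i) - code (encode origin i))%Z.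
Definition mod_p c i : Z := power (word_src c i).
Definition mod_q c i : Z := power (word_tgt c i).

Local Notation amove := (affine_move vec_a vec_b mod_p mod_q).
Local Notation aconn := (affine_conn vec_a vec_b mod_p mod_q).

Lemma config_eq X Y : phase X = phase Y -> spare X = spare Y ->
  (forall j, stack X j = stack Y j) -> X = Y.
Proof. by case: X Y => p n f [p' n' f'] /= -> -> e; congr Config; apply/funext. Qed.

Lemma ltr_inj : injective ltr.
Proof. by move=> x y []. Qed.

Lemma vector_of_inj : injective vector_of.
Proof.
move=> X Y e; have E i : encode X i = encode Y i.
  by apply: code_inj; have := congr1 (fun f => f i) e; rewrite /vector_of; lia.
apply: config_eq => [||j]; first by have := E None => -[].
  have := congr1 size (E (Some None)); rewrite !size_cat !size_nseq /=; lia.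
by have := E (Some (Some j)); rewrite /= !cats1 => /rcons_inj[/(inj_map ltr_inj)].
Qed.

Lemma step_vector c X Y : stack_step c X Y -> amove c false (vector_of X) (vector_of Y).
Proof.
move=> [e1 e2 [m [e3 e4]] e5].
have H i : exists r, encode X i = word_src c i ++ r /\ encode Y i = word_tgt c i ++ r.
  case: i => [[j|]|] /=.
  - have [l [-> -> bl]] := e5 j; exists (map ltr l ++ nseq (~~ at_bottom (rules c) j) mark).
    rewrite !map_cat -!catA; case: (at_bottom _ _) bl => /= [->//|_]; by [].
  - by exists (nseq m one ++ [:: mark]); rewrite e3 e4 !nseqD -!catA.
  - by exists [::]; rewrite e1 e2.
exists (fun i => code (projT1 (cid (H i)))); split; apply/funext => i;
  case: (cid (H i)) => /= q [E1 E2]; rewrite /vector_of /vec_a /vec_b /mod_p /mod_q;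
  by rewrite ?E1 ?E2 code_cat; lia.
Qed.

Lemma cat_mark (s t : seq A) (bot : bool) (l : seq digits) :
  map ltr s ++ [:: mark] = (map ltr t ++ nseq bot mark) ++ l ->
  [/\ s = t ++ drop (size t) s, bot -> drop (size t) s = [::] &
      l = map ltr (drop (size t) s) ++ nseq (~~ bot) mark].
Proof.
elim: t s => [|x t IH] s /=.
  rewrite drop0; case: bot => /=; last by move=> <-.
  by case: s => [|y s] //= -[<-].
case: s => [|y s]; first by case.
by case=> <- /IH[h0 h1 h2]; split=> //=; congr (_ :: _).
Qed.

Lemma nseq_mark n n' (l : seq digits) : nseq n one ++ [:: mark] = nseq n' one ++ l ->
  exists m, n = n' + m /\ l = nseq m one ++ [:: mark].
Proof.
elim: n' n => [|n' IH] n /=; first by move=> <-; exists n.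
case: n => [|n]; first by case.
by case=> /IH[m [-> ->]]; exists m.
Qed.

(* The digits are nonzero, so a number that agrees with a stack below the
   relevant power is again the code of a stack. *)
Lemma decode_config X p n bot st (u : coords -> Z) p' n' st' :
  (forall i, code (encode X i) =
    code (word_of p n bot st i) + power (word_of p n bot st i) * u i)%Z ->
  exists Y, [/\ phase X = p, phase Y = p', 
    exists m, spare X = n + m /\ spare Y = n' + m,
    forall j, exists l, [/\ stack X j = st j ++ l, stack Y j = st' j ++ l & bot j -> l = [::]] &
    forall i, code (encode Y i) =
      (code (word_of p' n' bot st' i) + power (word_of p' n' bot st' i) * u i)%Z].
Proof.
move=> H; have D i := decode (H i).
have [l1 /nseq_mark[m [Em El1]] Eu1] := D (Some None).
exists (Config p' (n' + m) (fun j => st' j ++ drop (size (st j)) (stack X j))); split=> //.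
- by have [l [Ep _] _] := D None.
- by exists m.
- move=> j; have [l /cat_mark[E1 E2 _] _] := D (Some (Some j)).
  by exists (drop (size (st j)) (stack X j)).
- case=> [[j|]|].
  + have [l /cat_mark[E1 E2 El] ->] := D (Some (Some j)); rewrite -code_cat; congr code.
    rewrite El /= !map_cat -!catA; congr (_ ++ _).
    by case: (bot j) E2 => /= [->|_].
  + by rewrite Eu1 El1 -code_cat /= nseqD catA.
  + by have [l [_ El] ->] := D None; rewrite -code_cat -El.
Qed.

(** The parameter u of an affine move decodes to the untouched parts of the stacks, so a move never
    leaves the set of codes. *)
Lemma vector_step c X y : amove c false (vector_of X) y ->
  exists2 Y, y = vector_of Y & stack_step c X Y.
Proof.
case=> u [E1 E2]; have [|Y [h1 h2 h3 h4 h5]] := @decode_config X (phase_src (rules c))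
  (spare_src (rules c)) (at_bottom (rules c)) (stack_src (rules c)) u
  (phase_tgt (rules c)) (spare_tgt (rules c)) (stack_tgt (rules c)).
  by move=> i; have := congr1 (fun f => f i) E1; rewrite /vector_of /vec_a /mod_p /word_src; lia.
exists Y; last by [].
by rewrite E2; apply/funext => i; rewrite /vector_of h5 /vec_b /mod_q /word_tgt; lia.
Qed.

Lemma vector_step_inv c X y : amove c true (vector_of X) y ->
  exists2 Y, y = vector_of Y & stack_step c Y X.
Proof.
case=> u [E1 E2]; have [|Y [h1 h2 h3 h4 h5]] := @decode_config X (phase_tgt (rules c))
  (spare_tgt (rules c)) (at_bottom (rules c)) (stack_tgt (rules c)) u
  (phase_src (rules c)) (spare_src (rules c)) (stack_src (rules c)).
  by move=> i; have := congr1 (fun f => f i) E2; rewrite /vector_of /vec_b /mod_q /word_tgt; lia.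
exists Y; last first.
  split=> //; first by have [m [e1 e2]] := h3; exists m.
  by move=> j; have [l [e1 e2 e3]] := h4 j; exists l.
by rewrite E1; apply/funext => i; rewrite /vector_of h5 /vec_a /mod_p /word_src; lia.
Qed.

Definition digit_bits : nat := #|digits|.+1.

Lemma radix_bits : (radix digits <= 2 ^ Z.of_nat digit_bits)%Z.
Proof.
rewrite /radix /digit_bits; elim: #|digits|.+1 => // n IH.
by rewrite Nat2Z.inj_succ Z.pow_succ_r; have := Z.pow_pos_nonneg 2 (Z.of_nat n); lia.
Qed.

Lemma size_encode X i : size (encode X i) <= (total X).+1.
Proof.
rewrite /total; case: i => [[j|]|] //=; rewrite size_cat ?size_nseq ?size_map addn1 ltnS.
  by rewrite (bigD1 j) //=; lia.
exact: leq_addr.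
Qed.

Lemma bounded_vector n X : total X <= n -> bounded (digit_bits * n.+1) (vector_of X).
Proof.
move=> leX i; have h1 := @code_ge0 _ (encode X i); have h2 := @code_ge0 _ (encode origin i).
have h3 := @code_lt _ (encode X i); have h4 := @code_lt _ (encode origin i).
have t0 : total origin = 0 by rewrite /total /= big1.
have h5 := power_le radix_bits (leq_trans (size_encode X i) (leX : total X < n.+1)).
have h6 : (power (encode origin i) <= 2 ^ Z.of_nat (digit_bits * n.+1))%Z.
  by apply: power_le radix_bits _; have := size_encode origin i; rewrite t0; lia.
by rewrite /vector_of; lia.
Qed.

Definition total_bound (k : nat) : nat := #|J|.+1 * (k + digit_bits + 3).

Lemma vector_total k X : bounded k (vector_of X) -> total X <= total_bound k.
Proof.
move=> bX; have T1 : 1 < #|digits|.+1 by rewrite ltnS; apply/card_gt0P; exists mark.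
have H i : size (encode X i) <= k + digit_bits + 3.
  have := bX i; rewrite /vector_of.
  have h1 := @code_size _ (encode X i) T1; have h4 := @code_lt _ (encode origin i).
  have t0 : total origin = 0 by rewrite /total /= big1.
  have h2 := @code_ge0 _ (encode origin i).
  have h6 : (power (encode origin i) <= 2 ^ Z.of_nat (digit_bits * 1))%Z.
    by apply: power_le radix_bits _; have := size_encode origin i; rewrite t0; lia.
  rewrite muln1 in h6 => h.
  have : (2 ^ Z.of_nat (size (encode X i)) <= 2 ^ Z.of_nat (k + digit_bits + 3))%Z.
    apply: Z.le_trans h1 _; rewrite !Nat2Z.inj_add !Z.pow_add_r; try lia.
    have := Z.pow_pos_nonneg 2 (Z.of_nat k); have := Z.pow_pos_nonneg 2 (Z.of_nat digit_bits).
    have -> : (2 ^ Z.of_nat 3 = 8)%Z by [].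
    by nia.
  set m := size (encode X i); case: (leqP m (k + digit_bits + 3)) => // ltm le2.
  have lt2 := @Z.pow_lt_mono_r 2 (Z.of_nat (k + digit_bits + 3)) (Z.of_nat m).
  by exfalso; move: le2; apply: Zlt_not_le; apply: lt2; lia.
rewrite /total /total_bound mulSn; apply: leq_add.
  by apply: leq_trans (H (Some None)); rewrite size_cat size_nseq leq_addr.
rewrite -sum_nat_const; apply: leq_sum => j _.
by apply: leq_trans (H (Some (Some j))); rewrite size_cat size_map leq_addr.
Qed.

Definition word_bits : nat :=
  digit_bits * \max_(x : C * coords) maxn (size (word_src x.1 x.2)) (size (word_tgt x.1 x.2)).

Lemma power_word_bits (w : coords -> seq digits) c i :
  size (w i) <= maxn (size (word_src c i)) (size (word_tgt c i)) ->
  (power (w i) <= 2 ^ Z.of_nat word_bits.+1)%Z.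
Proof.
move=> le; apply: (@Z.le_trans _ (2 ^ Z.of_nat word_bits)).
  apply: power_le radix_bits _; apply: leq_trans le _.
  exact: (@leq_bigmax _ (fun x : C * coords =>
    maxn (size (word_src x.1 x.2)) (size (word_tgt x.1 x.2))) (c, i)).
by apply: Z.pow_le_mono_r; lia.
Qed.

Lemma mod_p_le c i : (mod_p c i <= 2 ^ Z.of_nat word_bits.+1)%Z.
Proof. exact: (@power_word_bits _ c i (leq_maxl _ _)). Qed.

Lemma mod_q_le c i : (mod_q c i <= 2 ^ Z.of_nat word_bits.+1)%Z.
Proof. exact: (@power_word_bits _ c i (leq_maxr _ _)). Qed.

Lemma stack_conn_total n X : stack_conn n X -> total X <= n.
Proof. by case=> [|c Y Z _]; rewrite // /total big1. Qed.

Lemma stack_conn_leq n n' X : n <= n' -> stack_conn n X -> stack_conn n' X.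
Proof.
move=> le; elim=> [|c Y Z _ IH leZ st]; first exact: stack_conn0.
exact: (stack_conn_step IH (leq_trans leZ le) st).
Qed.

Lemma stack_affine n X : stack_conn n X -> aconn (digit_bits * n.+1) (vector_of X).
Proof.
elim=> [|c Y X' _ IH leX' st].
  have -> : vector_of origin = @zero coords by apply/funext => i; rewrite /vector_of /zero; lia.
  exact: affine_conn0.
case: st => /step_vector mv.
  exact: (affine_conn_step (c := c) (e := false) IH (bounded_vector leX') mv).
exact: (affine_conn_step (c := c) (e := true) IH (bounded_vector leX') mv).
Qed.

Lemma affine_stack k z : aconn k z -> exists2 X, z = vector_of X & stack_conn (total_bound k) X.
Proof.
elim=> [|c e y y' _ [X -> cX] by' mv].
  exists origin; last exact: stack_conn0.
  by apply/funext => i; rewrite /vector_of /zero; lia.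
case: e mv => mv.
  have [Y EY st] := vector_step_inv mv; exists Y => //; subst y'.
  by apply: stack_conn_step cX (vector_total by') _; right; exact: st.
have [Y EY st] := vector_step mv; exists Y => //; subst y'.
by apply: stack_conn_step cX (vector_total by') _; left; exact: st.
Qed.

End StackMachine.

(** * Turing machines as stack machines *)

Section Simulation.

Variable M : machine.
Local Notation tapes := 'I_(other_tapes M).+1.
Local Notation heads := {ffun tapes -> state M}.

(* [None] holds the part of the input that is still to be loaded, the other
   stacks are the two halves of the tapes, with top at the head. *)
Definition stacks : finType := option (tapes * bool).
Implicit Types (f : stacks -> seq (letter M)) (h : heads) (Z : configuration M).

Definition phases : finType := option (option (option heads)).
Definition in_phase : phases := None.
Definition load_phase : phases := Some None.
Definition clean_phase : phases := Some (Some None).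
Definition run_phase h : phases := Some (Some (Some h)).

Definition start_heads : heads := [ffun i => start_state i].
Definition accept_heads : heads := [ffun i => accept_state i].

Definition tape_stacks Z (j : stacks) : seq (letter M) :=
  match j with
  | None => [::]
  | Some (i, false) => rev (left (Z i))
  | Some (i, true) => right (Z i)
  end.

Definition only (j : stacks) (s : seq (letter M)) (i : stacks) : seq (letter M) :=
  if i == j then s else [::].

Notation no_letters := (fun _ : stacks => [::] : seq (letter M)).
Notation nowhere := (fun _ : stacks => false).

Definition source_heads (k : command M) : heads := [ffun i => Defs.head (source (rule k i))].
Definition target_heads (k : command M) : heads := [ffun i => Defs.head (target (rule k i))].
Definition source_letters (k : command M) : nat := tape_letters (fun i => source (rule k i)).
Definition target_letters (k : command M) : nat := tape_letters (fun i => target (rule k i)).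

Definition rule_names : finType :=
  (option (bool * bool) + (letter M + (command M + stacks * letter M)))%type.
Definition grow : rule_names := inl None.
Definition switch : rule_names := inl (Some (false, false)).
Definition start : rule_names := inl (Some (false, true)).
Definition finish : rule_names := inl (Some (true, false)).
Definition shrink : rule_names := inl (Some (true, true)).
Definition load x : rule_names := inr (inl x).
Definition run k : rule_names := inr (inr (inl k)).
Definition pop j x : rule_names := inr (inr (inr (j, x))).

Definition idle_rule := StackRule in_phase in_phase 0 0 nowhere no_letters no_letters.

(* The input phase may change the counter, all later rules preserve the total
   until acceptance, when everything may be erased.  Commands are not applied to
   accepting configurations. *)
Definition sim_rule (c : rule_names) : stack_rule (letter M) stacks phases :=
  match c with
  | inl None => StackRule in_phase in_phase 0 1 nowhere no_letters no_letters
  | inl (Some (false, false)) =>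
      StackRule in_phase load_phase 0 0 (fun j => j != None) no_letters no_letters
  | inl (Some (false, true)) =>
      StackRule load_phase (run_phase start_heads) 0 0 (fun j => j == None) no_letters no_letters
  | inl (Some (true, false)) =>
      StackRule (run_phase accept_heads) clean_phase 0 0 nowhere no_letters no_letters
  | inl (Some (true, true)) =>
      StackRule clean_phase clean_phase 1 0 nowhere no_letters no_letters
  | inr (inl x) =>
      if x \in input_alphabet M then
        StackRule load_phase load_phase 0 0 nowhere (only None [:: x])
          (only (Some (ord0, false)) [:: x])
      else idle_rule
  | inr (inr (inl k)) =>
      if source_heads k == accept_heads then idle_rule else
      StackRule (run_phase (source_heads k)) (run_phase (target_heads k))
        (target_letters k - source_letters k) (source_letters k - target_letters k)
        (fun j => match j with
                  | None => false
                  | Some (i, false) => at_left (rule k i)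
                  | Some (i, true) => at_right (rule k i)
                  end)
        (tape_stacks (fun i => source (rule k i))) (tape_stacks (fun i => target (rule k i)))
  | inr (inr (inr (j, x))) =>
      StackRule clean_phase clean_phase 0 0 nowhere (only j [:: x]) no_letters
  end.

Local Notation sconfig := (config (letter M) stacks phases).
Local Notation sstep := (stack_step sim_rule).
Local Notation sconn := (stack_conn clean_phase sim_rule).
Implicit Types (X Y : sconfig).

Definition tape_config h f : configuration M :=
  fun i => Tape (rev (f (Some (i, false)))) (h i) (f (Some (i, true))).

Lemma big_stacks (F : stacks -> nat) :
  \sum_j F j = F None + \sum_i (F (Some (i, false)) + F (Some (i, true))).
Proof.
rewrite (bigD1 None) //=; congr (_ + _).
rewrite (reindex_omap Some id) /=; last by case.
rewrite (eq_bigl xpredT); last by move=> j; rewrite eqxx.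
rewrite (eq_bigr (fun p => (fun i b => F (Some (i, b))) p.1 p.2)); last by case.
rewrite -(pair_bigA _ (fun i b => F (Some (i, b)))); apply: eq_bigr => i _.
by rewrite big_bool addnC.
Qed.

Lemma tape_letters_config h f :
  \sum_j size (f j) = size (f None) + tape_letters (tape_config h f).
Proof.
by rewrite big_stacks; congr (_ + _); apply: eq_bigr => i _; rewrite size_rev.
Qed.

Lemma sum_tape_stacks Z : \sum_j size (tape_stacks Z j) = tape_letters Z.
Proof. by rewrite big_stacks; apply: eq_bigr => i _; rewrite size_rev. Qed.

Lemma command_step_fun k Z Z1 Z2 : command_step k Z Z1 -> command_step k Z Z2 -> Z1 = Z2.
Proof.
move=> h1 h2; apply/funext => i; have [x [y [_ _ e1 ->]]] := h1 i.
have [x' [y' [_ _ e2 ->]]] := h2 i; move: e2; rewrite e1 => -[e3 e4].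
have es : size x = size x' by have := congr1 size e3; rewrite !size_cat; lia.
move/eqP: e3; rewrite eqseq_cat // => /andP[/eqP-> _].
by move/eqP: e4; rewrite eqseq_cat // eqxx => /eqP->.
Qed.

Definition accepting (s : nat) Z : Prop :=
  exists2 p, rewriting (@machine_step M) (@accept_configuration M) Z p &
    rewriting_space (@tape_letters M) Z p <= s.

Lemma accepting_accept s h f : h = accept_heads -> tape_letters (tape_config h f) <= s ->
  accepting s (tape_config h f).
Proof.
move=> -> le; exists [::]; last by rewrite /rewriting_space big_seq1.
by split=> // i /=; rewrite ffunE.
Qed.

(** Determinism enters here: an accepting computation from [Z] has to begin with [k]. If [Z] were
    accepting, the empty computation would say nothing about [Z']. *)
Lemma accepting_step s k Z Z' : deterministic M -> command_step k Z Z' ->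
  tape_letters Z <= s -> ~ accept_configuration Z -> accepting s Z <-> accepting s Z'.
Proof.
move=> det st leZ nacc; split=> [[p [hp ha] hs]|[p [hp ha] hs]]; last first.
  exists (Z' :: p); last by move: hs; rewrite /rewriting_space !big_cons; lia.
  by split=> //=; apply/andP; split=> //; apply/asboolP; exists k.
case: p hp ha hs => [|Z1 p] //= /andP[/asboolP[k' st'] hp] ha hs.
have ek : k' = k by apply: (det Z); [exists Z1 | exists Z'].
rewrite ek in st'; rewrite (command_step_fun st st'); exists p => //.
by move: hs; rewrite /rewriting_space !big_cons; lia.
Qed.

(** The tapes once the rest of the input has been loaded; the loading rules leave them unchanged. *)
Definition unload f (j : stacks) : seq (letter M) :=
  match j with
  | None => [::]
  | Some (i, b) => if (i == ord0) && ~~ b then rev (f None) ++ f j else f j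
  end.

Definition loading s f : Prop :=
  all (mem (input_alphabet M)) (f None) /\ accepting s (tape_config start_heads (unload f)).

(** Connections use rules in both directions, so this has to be preserved both ways. Leaving the
    cleaning phase backwards leads to accepting heads, where the empty computation accepts. *)
Definition invariant (s : nat) (X : sconfig) : Prop :=
  match phase X with
  | None => (forall j, j != None -> stack X j = [::]) /\ loading s (stack X)
  | Some None => loading s (stack X)
  | Some (Some None) => True
  | Some (Some (Some h)) => accepting s (tape_config h (stack X))
  end.

Lemma same_stacks (S : stack_rule (letter M) stacks phases) X Y :
  (forall j, exists l, [/\ stack X j = [::] ++ l, stack Y j = [::] ++ l &
    at_bottom S j -> l = [::]]) ->
  stack X = stack Y /\ forall j, at_bottom S j -> stack X j = [::].
Proof.
move=> H; split; first by apply/funext => j; have [l [-> -> _]] := H j.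
by move=> j; have [l [-> _ e]] := H j; exact: e.
Qed.

Lemma run_command_step k X Y : source_heads k != accept_heads -> sstep (run k) X Y ->
  command_step k (tape_config (source_heads k) (stack X))
    (tape_config (target_heads k) (stack Y)).
Proof.
rewrite /stack_step /= => /negPf-> /= [_ _ _ H] i.
have [l [e1 e2 e3]] := H (Some (i, false)); have [r [e4 e5 e6]] := H (Some (i, true)).
exists (rev l), r; rewrite /tape_config /= !ffunE e1 e2 e4 e5 /= !rev_cat !revK; split=> //.
by move/e3=> ->.
Qed.

Lemma command_letters k Z Z' : command_step k Z Z' ->
  tape_letters Z + target_letters k = tape_letters Z' + source_letters k.
Proof.
move=> st; rewrite /tape_letters /source_letters /target_letters /tape_letters -!big_split.
apply: eq_bigr => i _; have [x [y [_ _ -> ->]]] := st i.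
by rewrite /= !size_cat; lia.
Qed.

Lemma command_run_step k Z Z' n m : command_step k Z Z' -> ~ accept_configuration Z ->
  n + tape_letters Z = m + tape_letters Z' ->
  sstep (run k) (Config (run_phase [ffun i => Defs.head (Z i)]) n (tape_stacks Z))
    (Config (run_phase [ffun i => Defs.head (Z' i)]) m (tape_stacks Z')).
Proof.
move=> st nacc en; have el := command_letters st.
have es : [ffun i => Defs.head (Z i)] = source_heads k.
  by apply/ffunP => i; rewrite !ffunE; have [x [y [_ _ -> _]]] := st i.
have et : [ffun i => Defs.head (Z' i)] = target_heads k.
  by apply/ffunP => i; rewrite !ffunE; have [x [y [_ _ _ ->]]] := st i.
have /negPf ns : source_heads k != accept_heads.
  apply/eqP => e; apply: nacc => i.
  by have := congr1 (fun h : heads => h i) (etrans es e); rewrite !ffunE.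
rewrite /stack_step /= ns /= es et; split=> //.
  (* At most one of the two truncated differences of letter counts is nonzero; the counter gives up
     or receives exactly the change in the number of tape letters. *)
  by exists (n - (target_letters k - source_letters k)); lia.
case=> [[i b]|]; last by exists [::].
have [x [y [hx hy eZ eZ']]] := st i; case: b; first by exists y; rewrite /= eZ eZ'.
by exists (rev x); rewrite /= eZ eZ' !rev_cat; split=> // /hx ->.
Qed.

Lemma spare_total (S : stack_rule (letter M) stacks phases) X Y (m : nat) :
  spare X = spare_src S + m -> spare Y = spare_tgt S + m ->
  (forall j, exists l, [/\ stack X j = stack_src S j ++ l, stack Y j = stack_tgt S j ++ l &
    at_bottom S j -> l = [::]]) ->
  total X + spare_tgt S + \sum_j size (stack_tgt S j) =
  total Y + spare_src S + \sum_j size (stack_src S j).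
Proof.
move=> e1 e2 H; rewrite /total e1 e2.
have E : \sum_j size (stack X j) + \sum_j size (stack_tgt S j) =
    \sum_j size (stack Y j) + \sum_j size (stack_src S j).
  rewrite -!big_split; apply: eq_bigr => j _; have [l [-> -> _]] := H j.
  by rewrite /= !size_cat; lia.
by lia.
Qed.

Lemma step_total c X Y : sstep c X Y -> ~ (phase X = in_phase /\ phase Y = in_phase) ->
  ~ (phase X = clean_phase /\ phase Y = clean_phase) -> total X = total Y.
Proof.
move=> [ep ep' [m [e1 e2]] H] np nc; have := spare_total e1 e2 H.
have only_size j x : \sum_i size (only j [:: x] i) = 1.
  by rewrite (bigD1 j) //= /only eqxx big1 // => i /negPf->.
have none_size : \sum_(i : stacks) size ([::] : seq (letter M)) = 0 by rewrite big1.
move: ep ep'; case: (c) => [[[[] []]|]|[x|[k|[j x]]]] /= ep ep'; rewrite ?none_size;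
  try by [lia | case: np | case: nc].
  move: ep ep'; case: ifP => _ /= ep ep'; last by case: np.
  by rewrite !only_size; lia.
move: ep ep'; case: ifP => _ /= ep ep'; first by case: np.
by rewrite !sum_tape_stacks /source_letters /target_letters; lia.
Qed.

Lemma load_unload x X Y : x \in input_alphabet M -> sstep (load x) X Y ->
  unload (stack X) = unload (stack Y) /\
  all (mem (input_alphabet M)) (stack X None) = all (mem (input_alphabet M)) (stack Y None).
Proof.
move=> Ax; rewrite /stack_step /= Ax /= => -[_ _ _ H].
have [l [e1 e2 _]] := H None; split; last by rewrite e1 e2 /= Ax.
apply/funext => -[[i b]|] //=; have [r [-> -> _]] := H (Some (i, b)).
rewrite e1 e2 /only /=; case: eqP => [->|ni] /=; last first.
  by case: eqP => // -[/ni].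
by case: b => //=; rewrite rev_cons cat_rcons.
Qed.

Lemma unload_empty f : f None = [::] -> unload f = f.
Proof. by move=> e; apply/funext => -[[i b]|] //=; rewrite e; case: ifP. Qed.

Lemma invariant_step s c X Y : deterministic M -> total X <= s -> total Y <= s ->
  sstep c X Y -> invariant s X <-> invariant s Y.
Proof.
move=> det leX leY st.
have idle_step : stack_step (fun _ => idle_rule) c X Y -> invariant s X <-> invariant s Y.
  case=> e1 e2 _ /same_stacks[e _]; rewrite /invariant e1 e2 /=.
  by rewrite e.
have leT (T : sconfig) h : tape_letters (tape_config h (stack T)) <= total T.
  by rewrite /total (tape_letters_config h); lia.
case: c st idle_step => [[[[] []]|]|[x|[k|[j x]]]] st idle_step.
- by case: st => /= e1 e2 _ _; rewrite /invariant e1 e2.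
- case: st => /= e1 e2 _ _; rewrite /invariant e1 e2 /=; split=> // _.
  by apply: accepting_accept => //; apply: leq_trans leX.
- case: st => /= e1 e2 _ /(@same_stacks (sim_rule start))[e eb].
  rewrite /invariant e1 e2 -e /= /loading unload_empty; last exact: eb.
  by rewrite (eb None) //=; split=> [[]|].
- case: st => /= e1 e2 _ /(@same_stacks (sim_rule switch))[e eb].
  by rewrite /invariant e1 e2 -e /=; split=> [[]//|].
- case: st => /= e1 e2 _ /(@same_stacks (sim_rule grow))[e _].
  by rewrite /invariant e1 e2 /= e.
- case Ax : (x \in input_alphabet M).
    have [e1 e2] := load_unload Ax st; case: st; rewrite /= Ax /= => e3 e4 _ _.
    by rewrite /invariant e3 e4 /= /loading e1 e2.
  by apply: idle_step; move: st; rewrite /stack_step /= Ax.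
- case E : (source_heads k == accept_heads).
    by apply: idle_step; move: st; rewrite /stack_step /= E.
  have cs := run_command_step (negbT E) st; case: st; rewrite /= E /= => e1 e2 _ _.
  rewrite /invariant e1 e2 /=; apply: accepting_step cs _ _ => //.
    exact: leq_trans (leT _ _) leX.
  move=> acc; move/eqP: E; apply; apply/ffunP => i; rewrite [RHS]ffunE.
  exact: acc.
- by case: st => /= e1 e2 _ _; rewrite /invariant e1 e2.
Qed.

Lemma invariant_conn s X : deterministic M -> sconn s X -> invariant s X.
Proof.
move=> det; elim=> // c Y Y' cY IH leY [] st.
  exact: (invariant_step det (stack_conn_total cY) leY st).1.
exact: (invariant_step det leY (stack_conn_total cY) st).2.
Qed.

Definition input_config u : sconfig := Config in_phase 0 (only None u).

Lemma sum_only j u : \sum_i size (only j u i) = size u.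
Proof. by rewrite (bigD1 j) //= /only eqxx big1 ?addn0 // => i /negPf->. Qed.

Lemma total_input u : total (input_config u) = size u.
Proof. by rewrite /total sum_only. Qed.

Lemma unload_input u : tape_config start_heads (unload (only None u)) = input_configuration u.
Proof.
apply/funext => i; rewrite /tape_config /unload /only ffunE /input_configuration /=.
by rewrite andbT andbF; case: ifP; rewrite ?cats0 ?revK.
Qed.

Lemma accepting_input s u : accepting s (input_configuration u) -> input_space u <= s.
Proof.
by case=> p rw les; have [le _] := min_spaceP (@tape_letters M) rw; exact: leq_trans le les.
Qed.

Lemma input_conn_accepts s u : deterministic M -> sconn s (input_config u) ->
  accepts u /\ input_space u <= s.
Proof.
move=> det /(invariant_conn det)[_ [Au acc]]; rewrite /= unload_input in acc.
split; last exact: accepting_input.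
by split; [exact: Au | case: acc => p rw _; exists p].
Qed.

Lemma accepts_accepting u : accepts u -> accepting (input_space u) (input_configuration u).
Proof.
case=> _ [p rw]; have [_ [q rq e]] := min_spaceP (@tape_letters M) rw.
by exists q; rewrite // e.
Qed.

Lemma input_space_leq n (u : seq (letter M)) : accepts u -> size u <= n ->
  input_space u <= machine_space M n.
Proof.
move=> acc le.
exact: (@leq_bigmax_cond _ _ (fun v : n.-bseq (letter M) => input_space v) (Bseq le)
  (asboolT acc)).
Qed.

Lemma machine_space_mono n n' : n <= n' -> machine_space M n <= machine_space M n'.
Proof.
move=> le; apply/bigmax_leqP => u /asboolP acc; apply: input_space_leq => //.
exact: leq_trans (size_bseq u) le.
Qed.

Definition update f j s (i : stacks) := if i == j then s else f i.

Lemma total_update (p : phases) n f j x s : f j = x :: s ->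
  total (Config p n f) = (total (Config p n (update f j s))).+1.
Proof.
move=> e; rewrite /total /= (bigD1 j) // [in RHS](bigD1 j) //= /update eqxx e -addnS.
by congr (_ + _); rewrite -addSn; congr (_ + _); apply: eq_bigr => i /negPf->.
Qed.

Lemma update_only f j x s i : f j = x :: s ->
  f i = only j [:: x] i ++ update f j s i.
Proof. by move=> e; rewrite /only /update; case: eqP => // ->. Qed.

Lemma clean_conn X : phase X = clean_phase -> sconn (total X) X.
Proof.
move: {2}(total X) (erefl (total X)) => n; elim: n X => [|n IH] X en ep.
  have -> : X = origin _ _ clean_phase; last exact: stack_conn0.
  apply: config_eq => //=; first by move: en; rewrite /total; lia.
  move=> j; apply: size0nil; move: en; rewrite /total (bigD1 j) //=; lia.
case eb : (spare X) => [|m].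
  have [j [x [s e]]] : exists j x s, stack X j = x :: s.
    apply: contrapT => none; move: en; rewrite /total eb big1 // => j _.
    by case e : (stack X j) => [//|x s]; case: none; exists j, x, s.
  set Y := Config clean_phase (spare X) (update (stack X) j s).
  have eY : total X = (total Y).+1 := total_update clean_phase (spare X) e.
  apply: (stack_conn_step (X := Y) (c := pop j x)) => //.
    by apply: stack_conn_leq (IH Y _ _) => //; lia.
  right; split=> //; first by exists 0; rewrite eb.
  by move=> i; exists (update (stack X) j s i); rewrite /= -update_only.
set Y := Config clean_phase m (stack X).
have eY : total X = (total Y).+1 by rewrite /total eb.
apply: (stack_conn_step (X := Y) (c := shrink)) => //.
  by apply: stack_conn_leq (IH Y _ _) => //; lia.
right; split=> //; first by exists m; rewrite eb.
by move=> i; exists (stack X i).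
Qed.

Lemma grow_conn N b m f :
  sconn N (Config in_phase (b + m) f) -> sconn N (Config in_phase b f).
Proof.
elim: m b => [|m IH] b; first by rewrite addn0.
rewrite addnS -addSn => /IH cY; apply: (stack_conn_step (c := grow) cY).
  by have := stack_conn_total cY; rewrite /total /=; lia.
by right; split=> //; [exists b | move=> j; exists (f j)].
Qed.

Lemma load_conn N b f : all (mem (input_alphabet M)) (f None) ->
  sconn N (Config load_phase b (unload f)) -> sconn N (Config load_phase b f).
Proof.
move: {2}(f None) (erefl (f None)) => u; elim: u f => [|x u IH] f e.
  by rewrite unload_empty.
pose top : stacks := Some (ord0, false); pose g := update (update f None u) top (x :: f top).
rewrite e /= => /andP[Ax Au] cf; have Af : x \in input_alphabet M := Ax.
have st : sstep (load x) (Config load_phase b f) (Config load_phase b g).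
  rewrite /stack_step /= Af; split=> //=; first by exists b.
  move=> j; exists (update f None u j); rewrite /g /update /only; split=> //.
    by case: eqP => // ->.
  by case: eqP => // ->.
have cg : sconn N (Config load_phase b g).
  by apply: IH => //; rewrite -(load_unload Af st).1.
apply: (stack_conn_step (c := load x) cg); last by right.
rewrite (step_total st) ?(stack_conn_total cg) //.
  by case.
by case.
Qed.

Lemma accept_conn N Z : accept_configuration Z -> tape_letters Z <= N ->
  sconn N (Config (run_phase [ffun i => Defs.head (Z i)]) (N - tape_letters Z) (tape_stacks Z)).
Proof.
move=> acc leZ; have -> : [ffun i => Defs.head (Z i)] = accept_heads.
  by apply/ffunP => i; rewrite !ffunE; exact: acc.
set Y := Config clean_phase (N - tape_letters Z) (tape_stacks Z).
have eY : total Y = N by rewrite /total sum_tape_stacks /=; lia.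
have cY : sconn N Y by rewrite -{1}eY; exact: clean_conn.
apply: (stack_conn_step (c := finish) cY); first by rewrite -[X in _ <= X]eY.
by right; split=> //; [exists (N - tape_letters Z) | move=> j; exists (tape_stacks Z j)].
Qed.

Lemma run_conn N p Z : rewriting (@machine_step M) (@accept_configuration M) Z p ->
  rewriting_space (@tape_letters M) Z p <= N ->
  sconn N (Config (run_phase [ffun i => Defs.head (Z i)]) (N - tape_letters Z) (tape_stacks Z)).
Proof.
elim: p Z => [|Z' p IH] Z rw hs.
  by apply: accept_conn; [exact: rw.2 | apply: leq_trans hs; rewrite /rewriting_space big_seq1].
have leZ : tape_letters Z <= N by move: hs; rewrite /rewriting_space big_cons; lia.
(* A computation may pass through an accepting configuration, where the simulation blocks all
   commands; it then turns to cleaning at once. *)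
have [acc|nacc] := pselect (accept_configuration Z); first exact: accept_conn.
have [hp ha] := rw.
have [k st] : machine_step Z Z' by move: hp => /= /andP[/asboolP].
have cZ : sconn N (Config (run_phase [ffun i => Defs.head (Z' i)]) (N - tape_letters Z')
    (tape_stacks Z')).
  apply: IH; first by split=> //; case/andP: hp.
  by move: hs; rewrite /rewriting_space !big_cons; lia.
have leZ' : tape_letters Z' <= N by move: hs; rewrite /rewriting_space !big_cons; lia.
apply: (stack_conn_step (c := run k) cZ).
  by rewrite /total sum_tape_stacks /=; lia.
by right; apply: command_run_step => //; lia.
Qed.

Lemma tape_stacks_input u : tape_stacks (input_configuration u) = unload (only None u).
Proof.
apply/funext => -[[i []]|] //=; rewrite /only ?andbF ?andbT //=.
by case: ifP => _; rewrite ?cats0.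
Qed.

Lemma input_conn N b u : accepts u -> b + size u <= N -> input_space u <= N ->
  sconn N (Config in_phase b (only None u)).
Proof.
move=> acc leb leN; have [Au _] := acc; have [p rw lep] := accepts_accepting acc.
apply: (@grow_conn _ _ (N - size u - b)).
have [size_u total_u] : tape_letters (input_configuration u) = size u /\
    forall n p, total (Config p n (only None u) : sconfig) = n + size u.
  split=> [|n q]; last by rewrite /total sum_only.
  by rewrite /tape_letters (bigD1 ord0) //= addn0 big1 ?addn0 // => i /negPf->.
set n := b + _; have en : n + size u = N by rewrite /n; lia.
apply: (stack_conn_step (X := Config load_phase n (only None u)) (c := switch)).
- apply: load_conn; first exact: Au.
  set f := unload (only None u).
  have et : total (Config (run_phase start_heads) n f) = N.
    by rewrite /total /= /f -tape_stacks_input sum_tape_stacks size_u.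
  apply: (stack_conn_step (X := Config (run_phase start_heads) n f) (c := start)).
  + have -> : start_heads = [ffun i => Defs.head (input_configuration u i)] by [].
    rewrite /f -tape_stacks_input; have -> : n = N - tape_letters (input_configuration u).
      by rewrite size_u; lia.
    by apply: run_conn rw _; exact: leq_trans lep leN.
  + by rewrite -[X in _ <= X]et.
  + right; split=> //; first by exists n.
    by move=> j; exists (f j); split=> // /eqP->.
- by rewrite total_u en.
- right; split=> //; first by exists n.
  by move=> j; exists (only None u j); split=> //; rewrite /only /= => /negPf->.
Qed.

(** Outside the input and cleaning phases the total is constant, so the path is cut at its last
    visit to one of these. From the cleaning phase everything can be erased within the total of [X];
    otherwise [X] hangs on an accepted input of the same total. *)
Lemma conn_from_input s X : deterministic M -> sconn s X -> sconn (total X) X \/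
  exists b u, [/\ accepts u, b + size u = total X & forall N, total X <= N ->
    sconn N (Config in_phase b (only None u)) -> sconn N X].
Proof.
move=> det; elim=> [|c X' Y cX IH leY st]; first by left; exact: stack_conn0.
have iY := invariant_conn det (stack_conn_step cX leY st).
have [cl|ncl] := pselect (phase Y = clean_phase); first by left; exact: clean_conn.
have [ip|nip] := pselect (phase Y = in_phase).
  move: iY; rewrite /invariant ip => -[emp [Au acc]].
  have eY : Y = Config in_phase (spare Y) (only None (stack Y None)).
    apply: config_eq => // j; rewrite /= /only; case: eqP => [->//|/eqP]; exact: emp.
  right; exists (spare Y), (stack Y None); split.
  - move: acc; rewrite eY /= unload_input => acc; split; first exact: Au.
    by case: acc => p rw _; exists p.
  - by rewrite [in RHS]eY /total sum_only.
  - by move=> N _; rewrite -eY.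
have eT : total X' = total Y.
  case: st => st; first by apply: (step_total st); case.
  by apply: esym; apply: (step_total st); case.
case: IH => [cX'|[b [u [acc eu H]]]].
  by left; apply: stack_conn_step st; rewrite ?eT //; rewrite -eT.
right; exists b, u; split=> // [|N leN cN]; first by rewrite eu.
have cX' : sconn N X' by apply: H; rewrite ?eT.
exact: stack_conn_step cX' leN st.
Qed.

(** The input from which [X] stems has at most n letters, so the space function of [M] applies to
    it, and the counter can be grown to the space that its computation requires. *)
Lemma conn_space s n X : deterministic M -> sconn s X -> total X <= n ->
  sconn (n + machine_space M n) X.
Proof.
move=> det /(conn_from_input det)[cX|[b [u [acc eu H]]]] leX.
  by apply: stack_conn_leq cX; lia.
apply: H; first by lia.
apply: input_conn => //; first by lia.
by apply: leq_trans (leq_addl n _); apply: input_space_leq => //; lia.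
Qed.

End Simulation.

(** * Comparison of the two space functions *)

Lemma word_space_group (P : presentation) n (w : word P) : group_eq w [::] -> size w <= n ->
  word_space w <= group_space P n.
Proof.
move=> w1 le.
exact: (@leq_bigmax_cond _ _ (fun v : n.-bseq (signed_letter P) => word_space v) (Bseq le)
  (asboolT w1)).
Qed.

Lemma group_space_mono (P : presentation) n n' : n <= n' -> group_space P n <= group_space P n'.
Proof.
move=> le; apply/bigmax_leqP => w /asboolP w1; apply: word_space_group => //.
exact: leq_trans (size_bseq w) le.
Qed.

Lemma dominated_linear (f g : nat -> nat) c1 c2 c3 : (forall m n, m <= n -> g m <= g n) ->
  (forall n, 0 < n -> f n <= c1 * g (c2 * n) + c3 * n) -> dominated f g.
Proof.
move=> mono H; exists (c1 + c2 + c3).+1 => // n n0; apply: leq_trans (H n n0) _.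
apply: leq_add; last by rewrite leq_mul2r; lia.
by apply: leq_mul; [lia | apply: mono; rewrite leq_mul2r; lia].
Qed.

Section MachineGroup.

Variable M : machine.
Hypothesis det : deterministic M.

Local Notation rules := (@sim_rule M).
Local Notation base := (clean_phase M).
Local Notation va := (vec_a base rules).
Local Notation vb := (vec_b base rules).
Local Notation mp := (mod_p rules).
Local Notation mq := (mod_q rules).
Local Notation kappa := (word_bits rules).

Definition machine_group : presentation := full_group va vb mp mq.

Lemma mod_p_gt0 c i : (0 < mp c i)%Z. Proof. exact: power_gt0. Qed.
Lemma mod_q_gt0 c i : (0 < mq c i)%Z. Proof. exact: power_gt0. Qed.

Definition bits : nat := digit_bits (letter M) (phases M).
Definition reach (k : nat) : nat := total_bound (letter M) (stacks M) (phases M) k.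
Definition group_reach (n : nat) : nat := zsize va vb mp mq kappa n.
(** From k bits to a configuration of total at most [reach k], connected to 0 with the additional
    space of [M], and back to bits. *)
Definition affine_space (k : nat) : nat := bits * (reach k + machine_space M (reach k)).+1.

Lemma reach_mono k k' : k <= k' -> reach k <= reach k'.
Proof. by move=> le; rewrite /reach /total_bound leq_mul2l; lia. Qed.

Lemma affine_space_mono k k' : k <= k' -> affine_space k <= affine_space k'.
Proof.
move=> /reach_mono le; rewrite /affine_space leq_mul2l ltnS leq_add ?orbT //.
exact: machine_space_mono.
Qed.

Lemma affine_space_conn k z : bounded k z -> (exists k', affine_conn va vb mp mq k' z) ->
  affine_conn va vb mp mq (affine_space k) z.
Proof.
move=> bz [k' /affine_stack[X ez cX]]; rewrite ez in bz *.
exact: stack_affine (conn_space det cX (vector_total bz)).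
Qed.

Lemma machine_group_kill n (w : word machine_group) : size w <= n -> group_eq w [::] ->
  kill (bound va vb mp mq kappa affine_space n + n * 4) w.
Proof.
exact: (full_kill mod_p_gt0 mod_q_gt0 (@mod_p_le _ _ _ _ _) (@mod_q_le _ _ _ _ _)
  affine_space_conn affine_space_mono).
Qed.

Lemma reach_linear : exists c, forall n, 0 < n -> reach (group_reach n) <= c * n.
Proof.
exists (#|stacks M|.+1 * ((kappa.+1 + 1) * (edge_size va vb mp mq + 2) + bits + 3)) => n n0.
rewrite /reach /total_bound /group_reach /zsize -/bits -mulnA leq_mul2l /= mulnA.
by set x := (kappa.+1 + 1) * _; nia.
Qed.

Lemma group_dominated : dominated (group_space machine_group) (machine_space M).
Proof.
have [c Hc] := reach_linear; set s := stable_cost va vb mp mq kappa.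
apply: (@dominated_linear _ _ (s * bits) c (s * (bits * (c + 1) + 2) + 4)).
  exact: machine_space_mono.
move=> n n0; apply/bigmax_leqP => w /asboolP w1.
apply: leq_trans (word_space_leq (machine_group_kill (size_bseq w) w1)) _.
have le1 := Hc n n0; have le2 := machine_space_mono M le1.
have : affine_space (group_reach n) <= bits * (c * n + machine_space M (c * n)).+1.
  by rewrite /affine_space leq_mul2l ltnS leq_add ?orbT.
rewrite /bound -/s -/(group_reach n); set x := affine_space _; set y := machine_space _ _ => lex.
have : (x + n).+1 <= bits * y + (bits * (c + 1) + 2) * n by nia.
move=> /(leq_mul (leqnn s)); rewrite mulnDr !mulnA => le.
by rewrite mulnDl addnA mulnC -mulnA; lia.
Qed.

(** The vector of an input has linearly many bits, so its test word has linear length. Removing this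
    word in space s yields a connection through configurations of total linear in s, hence
    acceptance in such space. *)
Lemma machine_dominated : dominated (machine_space M) (group_space machine_group).
Proof.
pose X u := @input_config M u; pose z u := vector_of base (X u).
pose t := digit_cost mp mq kappa * 4 + 4.
have [c Hc] := reach_linear.
apply: (@dominated_linear _ _ (c * 2) (t * (bits * 2 + 1)) (c * 2)); first exact: group_space_mono.
move=> n n0; apply/bigmax_leqP => u /asboolP acc.
have leX : total (X u) <= n by rewrite total_input size_bseq.
have bz : bounded (bits * n.+1) (z u) := bounded_vector leX.
pose w : word machine_group := test_word va vb mp mq (bits * n.+1) (z u).
have cX : stack_conn base rules (n + input_space u) (X u).
  by apply: input_conn => //; rewrite ?leq_addl ?add0n ?(leq_trans (size_bseq u)) ?leq_addr.
have sw : size w <= t * (bits * 2 + 1) * n.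
  apply: leq_trans (size_test_word va vb mp mq kappa bz) _; rewrite -/t -mulnA leq_mul2l; nia.
have w1 : group_eq w [::].
  exact: (test_word_group_eq mod_p_gt0 mod_q_gt0 (@mod_p_le _ _ _ _ _) (@mod_q_le _ _ _ _ _)
    bz (stack_affine cX)).
set N := t * _ * n in sw *; have leN := word_space_group w1 sw.
set g := group_space _ _ in leN *.
(* The summand [n] makes the argument to which [Hc] is applied positive. *)
have kw : kill (g + n) w.
  by apply: kill_leq (kill_word_space (machine_group_kill sw w1)); lia.
have := kill_test_word mod_p_gt0 mod_q_gt0 (@mod_p_le _ _ _ _ _) (@mod_q_le _ _ _ _ _) bz kw.
case/affine_stack => Y /vector_of_inj <- /(input_conn_accepts det)[_ le].
apply: leq_trans le _; apply: leq_trans (Hc ((g + n) * 2) _) _; first by lia.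
by rewrite -mulnDr -mulnA [2 * _]mulnC.
Qed.

End MachineGroup.

Theorem theorem1p4 (M : machine) :
  deterministic M ->
  exists P : presentation, equivalent (group_space P) (machine_space M).
Proof.
move=> det; exists (machine_group M); split; first exact: group_dominated.
exact: machine_dominated.
Qed.
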